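(* For every nonnegative integer $n$, \begin{align*} \overline{b}_5(4n+1) &= c_5(n)-2\overline{b}_5(2n-1),\\ \overline{b}_5(10n) &= \tfrac{1}{2}c_5(10n+2),\\ \overline{b}_5(10n+1) &= c_5(5n+1),\\ \overline{b}_5(10n+2) &= \tfrac{1}{4}\overline{a}_5(2n+1) +\tfrac{1}{2}c_5(2n),\\ \overline{b}_5(10n+3) &= c_5(5n+2),\\ \overline{b}_5(10n+4) &= \tfrac{1}{2}c_5(10n+6),\\ \overline{b}_5(10n+6) &= 0,\\ \overline{b}_5(10n+8) &= 0,\\ \overline{b}_5(20n+5) &= -c_5(5n+1),\\ \overline{b}_5(20n+7) &= \tfrac{1}{2}\overline{a}_5(2n+1) +c_5(2n),\\ \overline{b}_5(20n+9) &= -c_5(5n+2),\\ \overline{b}_5(20n+15) &= 0,\\ \overline{b}_5(20n+19) &= 0. \end{align*}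
   Context: For a partition $\lambda=(\lambda_1,\ldots,\lambda_m)$ of $n$ with conjugate parts $\lambda'_j$, the hook number of the node $(i,j)$ of its Ferrers--Young diagram is $\lambda_i+\lambda'_j-i-j+1$; $\lambda$ is a $5$-core if none of its hook numbers is divisible by $5$. $c_5(n)$ denotes the number of partitions of $n$ that are $5$-cores. With $f_j:=\prod_{k\ge 1}(1-q^{jk})$ (for $|q|<1$, or as a formal power series), its generating function is $\sum_{n\ge 0} c_5(n)q^n = f_5^5/f_1$ (a known identity). Let $\varphi(-q):=\sum_{n=-\infty}^{\infty}(-1)^n q^{n^2}=f_1^2/f_2$ and $\psi(-q):=\sum_{n=0}^{\infty}(-q)^{n(n+1)/2}=f_1f_4/f_2$, so that $\varphi(-q^5)=f_5^2/f_{10}$ and $\psi(-q^5)=f_5f_{20}/f_{10}$. The integers $\overline{a}_5(n)$ and $\overline{b}_5(n)$ are defined by $$\sum_{n=0}^\infty \overline{a}_5(n)q^n=\frac{\varphi^5(-q^5)}{\varphi(-q)}=1+2q+4q^2+8q^3+14q^4+14q^5+20q^6+24q^7+\cdots,$$ $$\sum_{n=0}^\infty \overline{b}_5(n)q^n=\frac{\psi^5(-q^5)}{\psi(-q)}=1+q+q^2+2q^3+3q^4-q^5+2q^7-2q^9+6q^{10}+\cdots .$$ By convention $c_5(n)=\overline{a}_5(n)=\overline{b}_5(n)=0$ for $n<0$. *)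

(* Defs.v *)
From mathcomp Require Import all_boot all_order all_algebra.

Set Implicit Arguments.
Unset Strict Implicit.
Unset Printing Implicit Defensive.

Import Order.TTheory GRing.Theory Num.Theory.

Local Open Scope ring_scope.

(* Rows and columns are numbered from 1, so 'part l i' is the i-th part of l. *)

Definition is_partition (l : seq nat) : bool := sorted geq l && (0%N \notin l).

Definition part (l : seq nat) (i : nat) : nat := nth 0%N l i.-1.

Definition conj_part (l : seq nat) (j : nat) : nat :=
  count (fun p => j <= p)%N l.

(* For a node (i, j) of the diagram the natural subtraction is not truncated. *)
Definition hook (l : seq nat) (i j : nat) : nat :=
  (part l i + conj_part l j + 1 - (i + j))%N.

Definition is_core (t : nat) (l : seq nat) : bool :=
  all (fun i => all (fun j => ~~ (t %| hook l i j)%N) (iota 1 (part l i)))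
      (iota 1 (size l)).

(* A partition of n has at most n parts, each at most n (partition_bounded
   below), so all partitions of n occur, once each, in this finite type. *)
Definition num_cores (t n : nat) : nat :=
  #|[set l : {bseq n of 'I_n.+1} |
      let p := [seq nat_of_ord x | x <- l] in
      [&& is_partition p, sumn p == n & is_core t p]]|.

Lemma partition_bounded (n : nat) (l : seq nat) :
  is_partition l -> sumn l = n ->
  exists b : {bseq n of 'I_n.+1}, l = [seq nat_of_ord x | x <- b].
Proof.
move=> /andP[_ l0] <-; set n' := sumn l.
have szl : (size l <= n')%N.
  rewrite /n'; elim: l l0 {n'} => //= x l IHl.
  rewrite inE negb_or eq_sym -lt0n => /andP[x0 /IHl szl].
  by rewrite -add1n leq_add.
have lel x : x \in l -> (x < n'.+1)%N.
  rewrite ltnS /n'; elim: l {l0 n' szl} => //= y l IHl; rewrite inE.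
  case/predU1P => [->|/IHl xl]; first exact: leq_addr.
  exact: leq_trans xl (leq_addl _ _).
have sz : (size [seq (inord x : 'I_n'.+1) | x <- l] <= n')%N by rewrite size_map.
exists (Bseq sz) => /=; rewrite -map_comp map_id_in // => x /lel xn /=.
by rewrite inordK.
Qed.

(* Formal power series over the integers, as coefficient sequences. *)

Definition fps := nat -> int.

Definition fps_one : fps := fun n => (n == 0%N)%:R.

Definition fps_mul (f g : fps) : fps :=
  fun n => \sum_(i < n.+1) f i * g (n - i)%N.

Definition fps_exp (f : fps) (k : nat) : fps := iter k (fps_mul f) fps_one.

(* The series f(q^k), for k > 0. *)
Definition fps_dilate (k : nat) (f : fps) : fps :=
  fun n => if (k %| n)%N then f (n %/ k)%N else 0.

Fixpoint fps_inv_seq (f : fps) (n : nat) : seq int :=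
  if n is m.+1 then
    let s := fps_inv_seq f m in
    rcons s (- \sum_(i < m.+1) f i.+1 * s`_(m - i))
  else [:: 1].

(* The multiplicative inverse of a series f with constant coefficient 1. *)
Definition fps_inv (f : fps) : fps := fun n => (fps_inv_seq f n)`_n.

Lemma size_fps_inv_seq (f : fps) (n : nat) : size (fps_inv_seq f n) = n.+1.
Proof. by elim: n => //= n IHn; rewrite size_rcons IHn. Qed.

Lemma nth_fps_inv_seq (f : fps) (n m : nat) :
  (m <= n)%N -> (fps_inv_seq f n)`_m = fps_inv f m.
Proof.
elim: n => [|n IHn]; first by rewrite leqn0 => /eqP->.
rewrite leq_eqVlt => /predU1P[-> //|]; rewrite ltnS => mn.
by rewrite /= nth_rcons size_fps_inv_seq ltnS mn IHn.
Qed.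

Lemma fps_mulV (f : fps) : f 0%N = 1 -> fps_mul f (fps_inv f) =1 fps_one.
Proof.
move=> f0 [|n]; first by rewrite /fps_mul big_ord1 f0 mul1r.
rewrite /fps_mul big_ord_recl f0 mul1r subn0 {1}/fps_inv /=.
rewrite nth_rcons size_fps_inv_seq ltnn eqxx /fps_one /=.
apply/eqP; rewrite addrC subr_eq0; apply/eqP/eq_bigr => i _.
by rewrite /bump /= add1n subSS nth_fps_inv_seq // leq_subr.
Qed.

(* The series phi(-q): the coefficient of q^m in the bilateral sum of
   (-1)^k q^(k^2), where only the integers k in [-m, m] can contribute. *)
Definition phi_neg : fps := fun m =>
  \sum_(k <- [seq i%:Z - m%:Z | i <- iota 0 (2 * m).+1] | k ^+ 2 == m%:Z)
    (-1) ^ k.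

(* The series psi(-q): the coefficient of q^m in the sum over k >= 0 of
   (-q)^(k(k+1)/2), where only k <= m can contribute. *)
Definition psi_neg : fps := fun m =>
  \sum_(k < m.+1 | (k * k.+1 %/ 2 == m)%N) (-1) ^+ (k * k.+1 %/ 2)%N.

Definition abar5_series : fps :=
  fps_mul (fps_exp (fps_dilate 5 phi_neg) 5) (fps_inv phi_neg).

Definition bbar5_series : fps :=
  fps_mul (fps_exp (fps_dilate 5 psi_neg) 5) (fps_inv psi_neg).

Definition zero_on_neg (f : nat -> int) (z : int) : int :=
  if z is Posz n then f n else 0.

Definition c5 : int -> int := zero_on_neg (fun n => (num_cores 5 n)%:Z).
Definition abar5 : int -> int := zero_on_neg abar5_series.
Definition bbar5 : int -> int := zero_on_neg bbar5_series.

(* Main.v *)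
Require Import Defs.
From HB Require Import structures.
From mathcomp Require Import all_boot all_order all_algebra.
From mathcomp Require Import algC cyclotomic.
From mathcomp Require Import boolp classical_sets cardinality fsbigop.
From mathcomp Require Import zify ring lra.

Set Implicit Arguments.
Unset Strict Implicit.
Unset Printing Implicit Defensive.

Import Order.TTheory GRing.Theory Num.Theory.

Local Open Scope ring_scope.

(* With e_j the eta product f_j, put X = q e_5^5 / e_1 and Y = e_1^5 / e_5; X is
   q times the generating function of 5-cores, by the abacus description of
   their beta sets and the triple product.  These are the two Eisenstein series
   of weight 2 and character (./5).  Gaussian sums of two squares, split modulo
   2 + i, give two eta identities of level 10, from which phi(-q^5)^5 / phi(-q)
   and q^3 psi(q^5)^5 / psi(q) are linear combinations of X(q), X(q^2), Y(q)
   and Y(q^2).  The 5-dissection of e_1 shows that x(5n) = 5 x(n),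
   y(5n) = y(n), and that Y is -5 times the twist of X by (./5) away from the
   multiples of 5; the 2-dissection of X is the Hecke relation
   x(2n) = x(n) + 2 x(n/2).  All thirteen identities are then linear
   consequences. *)

(** The shape of the thirteen identities comes from the index modulo 5. At indices prime to 5, y is
    5 x or -5 x, and the sign decides whether a combination such as 5 x + y doubles or vanishes,
    that is, whether c_5 or 0 appears. At an index 5 k it becomes 25 x(k) + y(k) instead, in which y
    no longer reduces to x in a uniform way; for odd k it is 5 times the coefficient of phi(-q^5)^5
    / phi(-q) at k, plus 10 x(k), hence the terms in a_5.

    The cores themselves correspond to integer vectors on a hyperplane, whose generating function
    does not factor. A further sum over the total charge s, weighted by q^(s(s-1)/2), removes the
    constraint and leaves a product of five theta series.

    No dimension count for modular forms enters: each relation is a polynomial identity between eta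
    products, after clearing denominators in the integral domain of power series. The passage to
    psi(q) is the substitution of -q for q, which puts a sign (-1)^n on b_5(n). *)

Record series (R : Type) := Series { coef : nat -> R }.

Lemma seriesP (R : Type) (f g : series R) : coef f =1 coef g -> f = g.
Proof. by case: f g => f [g] /= /funext ->. Qed.

HB.instance Definition _ (R : Type) := gen_eqMixin (series R).
HB.instance Definition _ (R : Type) := gen_choiceMixin (series R).

(** * Formal power series *)

Section SeriesRing.
Variable R : comNzRingType.
Implicit Types f g h : series R.

Let szero : series R := Series (fun=> 0).
Let sone : series R := Series (fun n => (n == 0%N)%:R).
Let sopp f := Series (fun n => - coef f n).
Let sadd f g := Series (fun n => coef f n + coef g n).
Let smul f g := Series (fun n => \sum_(i < n.+1) coef f i * coef g (n - i)%N).

Let saddA : associative sadd.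
Proof. by move=> f g h; apply: seriesP => n /=; rewrite addrA. Qed.
Let saddC : commutative sadd.
Proof. by move=> f g; apply: seriesP => n /=; rewrite addrC. Qed.
Let sadd0 : left_id szero sadd.
Proof. by move=> f; apply: seriesP => n /=; rewrite add0r. Qed.
Let saddN : left_inverse szero sopp sadd.
Proof. by move=> f; apply: seriesP => n /=; rewrite addNr. Qed.

HB.instance Definition _ :=
  GRing.isZmodule.Build (series R) saddA saddC sadd0 saddN.

Definition trunc n f : {poly R} := \poly_(i < n) coef f i.

Lemma coef_trunc n f i : (i < n)%N -> (trunc n f)`_i = coef f i.
Proof. by rewrite coef_poly => ->. Qed.

(** A coefficient of a product depends only on truncations, so the ring laws for series are read off
    from those of polynomials. *)
Let coef_smul n f g i : (i < n)%N ->
  coef (smul f g) i = (trunc n f * trunc n g)`_i.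
Proof.
move=> ltin; rewrite coefM; apply: eq_bigr => j _.
by rewrite !coef_trunc //; have := ltn_ord j; lia.
Qed.

Let smul_trunc f (p q : {poly R}) n :
  (forall i, (i <= n)%N -> p`_i = q`_i) ->
  (trunc n.+1 f * p)`_n = (trunc n.+1 f * q)`_n.
Proof.
move=> pq; rewrite !coefM; apply: eq_bigr => j _.
by rewrite pq // leq_subr.
Qed.

Let smulC : commutative smul.
Proof.
by move=> f g; apply: seriesP => n; rewrite !(@coef_smul n.+1) // mulrC.
Qed.

Let smulA : associative smul.
Proof.
move=> f g h; apply: seriesP => n.
rewrite [smul (smul f g) h]smulC !(@coef_smul n.+1) //.
rewrite (@smul_trunc f _ (trunc n.+1 g * trunc n.+1 h)); last first.
  by move=> i lein; rewrite coef_trunc ?(@coef_smul n.+1).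
rewrite (@smul_trunc h _ (trunc n.+1 f * trunc n.+1 g)); last first.
  by move=> i lein; rewrite coef_trunc ?(@coef_smul n.+1).
by rewrite mulrA mulrC.
Qed.

Let smul1 : left_id sone smul.
Proof.
move=> f; apply: seriesP => n /=.
rewrite big_ord_recl /= mul1r subn0 big1 ?addr0 // => i _.
by rewrite /bump /= mul0r.
Qed.

Let smulD : left_distributive smul sadd.
Proof.
move=> f g h; apply: seriesP => n /=; rewrite -big_split /=.
by apply: eq_bigr => i _; rewrite mulrDl.
Qed.

Let sone_neq0 : sone != szero.
Proof.
by apply/eqP => /(congr1 (fun f => coef f 0)) /= /eqP; rewrite oner_eq0.
Qed.

HB.instance Definition _ := GRing.Zmodule_isComNzRing.Build (series R)
  smulA smulC smul1 smulD sone_neq0.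

Lemma coefM_series f g n :
  coef (f * g) n = \sum_(i < n.+1) coef f i * coef g (n - i)%N.
Proof. by []. Qed.
Lemma coefM_trunc n f g i :
  (i < n)%N -> coef (f * g) i = (trunc n f * trunc n g)`_i.
Proof. exact: coef_smul. Qed.
Lemma coefD_series f g n : coef (f + g) n = coef f n + coef g n.
Proof. by []. Qed.
Lemma coefN_series f n : coef (- f) n = - coef f n.
Proof. by []. Qed.
Lemma coef0_series n : coef (0 : series R) n = 0.
Proof. by []. Qed.
Lemma coef1_series n : coef (1 : series R) n = (n == 0%N)%:R.
Proof. by []. Qed.
Lemma coefB_series f g n : coef (f - g) n = coef f n - coef g n.
Proof. by []. Qed.
Lemma coefMn_series f m n : coef (f *+ m) n = coef f n *+ m.
Proof. by elim: m => [|m IHm]; rewrite ?mulr0n // !mulrS coefD_series IHm. Qed.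

Lemma coef_natrM m f n : coef (m%:R * f) n = m%:R * coef f n.
Proof. by rewrite !mulr_natl coefMn_series. Qed.

Lemma coef_sum_series (I : Type) (r : seq I) (P : pred I) (F : I -> series R) n :
  coef (\sum_(i <- r | P i) F i) n = \sum_(i <- r | P i) coef (F i) n.
Proof. by elim/big_rec2: _ => // i a f _ <-. Qed.

(** Inverses are chosen classically; the resulting unit ring carries the integral domain structure
    over a domain, and with it cancellation by [mulfI]. *)
Let sunit : pred (series R) := fun f => `[< exists g, g * f = 1 >].
Let sinv f :=
  if pselect (exists g, g * f = 1) is left ex then projT1 (cid ex) else f.

Let smulV : {in sunit, left_inverse 1 sinv *%R}.
Proof.
by move=> f /asboolP fV; rewrite /sinv; case: pselect => // ex; case: cid.
Qed.
Let sunitP f g : g * f = 1 -> sunit f.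
Proof. by move=> gf; apply/asboolP; exists g. Qed.
Let sinv_out : {in [predC sunit], sinv =1 id}.
Proof.
move=> f fV; have Nex : ~ exists g, g * f = 1.
  by move=> [g /sunitP gf]; move/negP: fV; apply.
by rewrite /sinv; case: pselect.
Qed.

HB.instance Definition _ :=
  GRing.ComNzRing_hasMulInverse.Build (series R) smulV sunitP sinv_out.

End SeriesRing.

Arguments coefM_trunc {R} n f g i _.

Section SeriesDomain.
Variable R : idomainType.

(** The product of the lowest terms of two nonzero series is the lowest term of their product. *)
Let series_integral : GRing.integral_domain_axiom (series R).
Proof.
move=> f g fg0; apply/orP; case: (pselect (f = 0)) => [->|f0]; first by left.
case: (pselect (g = 0)) => [->|g0]; [by right; rewrite eqxx|exfalso].
have ex (h : series R) : h <> 0 -> exists n, coef h n != 0.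
  move=> h0; apply: contrapT => /forallNP all0; apply: h0; apply: seriesP => n.
  by apply/eqP/negPn/negP; exact: all0.
case: (ex_minnP (ex _ f0)) => m fm minm; case: (ex_minnP (ex _ g0)) => n gn minn.
have /eqP := congr1 (fun h => coef h (m + n)) fg0.
rewrite coef0_series coefM_series.
rewrite (bigD1 (Ordinal (leq_addr n m : m < (m + n).+1)%N)) //= addKn big1.
  by rewrite addr0 mulf_eq0 (negPf fm) (negPf gn).
move=> i; rewrite -val_eqE /= => im.
have [lt_im|le_mi] := ltnP i m.
  suff -> : coef f i = 0 by rewrite mul0r.
  by apply/eqP/negPn/negP => /minm; lia.
suff -> : coef g (m + n - i) = 0 by rewrite mulr0.
by apply/eqP/negPn/negP => /minn; have := ltn_ord i; lia.
Qed.

HB.instance Definition _ :=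
  GRing.ComUnitRing_isIntegral.Build (series R) series_integral.
End SeriesDomain.

(** * Substitutions in power series *)

Section SeriesMorphisms.
Variable R : comNzRingType.
Implicit Types f g h : series R.

Definition qX : series R := Series (fun n => (n == 1)%:R).
Definition const (c : R) : series R := Series (fun n => if n is 0 then c else 0).

Lemma trunc_qX n : (1 < n)%N -> trunc n qX = 'X.
Proof.
move=> n1; apply/polyP => i; rewrite coef_poly coefX.
by case: ltnP => // ni; rewrite eqn_leq leqNgt (leq_trans n1 ni).
Qed.

Lemma coef_qXM f k :
  coef (qX * f) k = if k is k'.+1 then coef f k' else 0.
Proof.
rewrite (@coefM_trunc _ k.+2) // trunc_qX // coefXM.
by case: k => [|k] //=; rewrite coef_trunc // ltnS ltnW.
Qed.

Lemma coef_qXnM n f k :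
  coef (qX ^+ n * f) k = if (k < n)%N then 0 else coef f (k - n).
Proof.
elim: n k => [|n IHn] k; first by rewrite expr0 mul1r subn0.
by rewrite exprS -mulrA coef_qXM; case: k => // k; rewrite IHn ltnS subSS.
Qed.

Lemma coef_qXn n k : coef (qX ^+ n) k = (k == n)%:R.
Proof.
by rewrite -[qX ^+ n]mulr1 coef_qXnM coef1_series subn_eq0 eqn_leq; case: ltngtP.
Qed.

Lemma coef_constM c f k : coef (const c * f) k = c * coef f k.
Proof.
rewrite coefM_series big_ord_recl subn0 /= big1 ?addr0 // => i _.
by rewrite /bump /= mul0r.
Qed.

(** For [k = 0] the convention [n %/ 0 = 0] makes this the constant term of [f], so that it is a
    ring morphism for every [k]. *)
Definition dil (k : nat) f : series R :=
  Series (fun n => if (k %| n)%N then coef f (n %/ k)%N else 0).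

Lemma coef0M f g : coef (f * g) 0 = coef f 0 * coef g 0.
Proof. by rewrite coefM_series big_ord1. Qed.

Lemma coef0_exp f n : coef (f ^+ n) 0 = coef f 0 ^+ n.
Proof. by elim: n => // n IHn; rewrite !exprS coef0M IHn. Qed.

Let dil_is_zmod k : zmod_morphism (dil k).
Proof.
by move=> f g; apply: seriesP => n /=; case: ifP; rewrite ?subr0.
Qed.

(** For positive [k] this is composition of the truncated polynomials with a power of ['X]; the case
    [k = 0] is multiplicativity of the constant term. *)
Let dil_is_monoid k : monoid_morphism (dil k).
Proof.
split.
  apply: seriesP => n /=; case: ifP => [/dvdnP[m ->]|]; last first.
    by case: n => // /negP[]; rewrite dvdn0.
  by case: k => [|k]; rewrite ?muln0 // mulnK // muln_eq0 orbF.
move=> f g; apply: seriesP => n; case: k => [|k].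
  have d0 (h : series R) : coef (dil 0 h) 0 = coef h 0 by [].
  case: n => [|n]; first by rewrite d0 !coef0M !d0.
  rewrite coefM_series big1 ?[LHS]/= // => i _ /=; rewrite !dvd0n.
  by case: eqP => [->|_]; rewrite ?mul0r // subn0 mulr0.
have dilE (h : series R) N i : (i < N)%N ->
    (trunc N h \Po 'X^(k.+1))`_i = coef (dil k.+1 h) i.
  move=> iN; rewrite coef_comp_poly_Xn //=; case: ifP => // _.
  by rewrite coef_trunc // (leq_ltn_trans (leq_div _ _)).
transitivity (((trunc n.+1 f \Po 'X^(k.+1)) * (trunc n.+1 g \Po 'X^(k.+1)))`_n).
  rewrite -comp_polyM coef_comp_poly_Xn //= -[X in if X then _ else _]/(k.+1 %| n)%N.
  case: ifP => // _; rewrite -(@coefM_trunc _ n.+1) //.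
  by rewrite ltnS leq_div.
rewrite coefM coefM_series; apply: eq_bigr => i _; rewrite !dilE //.
by have := ltn_ord i; lia.
Qed.

HB.instance Definition _ k :=
  GRing.isZmodMorphism.Build (series R) (series R) (dil k) (dil_is_zmod k).
HB.instance Definition _ k :=
  GRing.isMonoidMorphism.Build (series R) (series R) (dil k) (dil_is_monoid k).

Lemma dil_dil k l f : dil k (dil l f) = dil (k * l) f.
Proof.
apply: seriesP => n /=; case: (posnP k) => [->|k0].
  by rewrite mul0n divn0 dvdn0 div0n !dvd0n.
have [/dvdnP[m ->]|nkn] := boolP (k %| n)%N.
  by rewrite mulnK // [(m * k)%N]mulnC dvdn_pmul2l // divnMl.
by case: ifP => // kln; case/negP: nkn; apply: dvdn_trans kln; exact: dvdn_mulr.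
Qed.

Lemma dil_qX k : (0 < k)%N -> dil k qX = qX ^+ k.
Proof.
move=> k0; apply: seriesP => n; rewrite coef_qXn /=.
case: ifP => [/dvdnP[m ->]|]; first by rewrite mulnK // -{2}[k]mul1n eqn_pmul2r.
by case: eqP => // ->; rewrite dvdnn.
Qed.

Lemma coef_dil k f n : (0 < k)%N -> coef (dil k f) (k * n) = coef f n.
Proof. by move=> k0; rewrite /= dvdn_mulr // mulKn. Qed.

(** The substitution of [c q] for [q]: with [c = -1] it relates psi(q) and psi(-q), with fifth roots
    of unity it yields the conjugates in a norm. *)
Definition scal (c : R) f : series R := Series (fun n => c ^+ n * coef f n).

Let scal_is_zmod c : zmod_morphism (scal c).
Proof. by move=> f g; apply: seriesP => n /=; rewrite mulrBr. Qed.

Let scal_is_monoid c : monoid_morphism (scal c).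
Proof.
split; first by apply: seriesP => -[|n] /=; rewrite ?mulr0 // expr0 mul1r.
move=> f g; apply: seriesP => n /=; rewrite mulr_sumr; apply: eq_bigr => i _.
by rewrite mulrACA -exprD subnKC // -ltnS.
Qed.

HB.instance Definition _ c :=
  GRing.isZmodMorphism.Build (series R) (series R) (scal c) (scal_is_zmod c).
HB.instance Definition _ c :=
  GRing.isMonoidMorphism.Build (series R) (series R) (scal c) (scal_is_monoid c).

Lemma scal_qX c : scal c qX = const c * qX.
Proof.
apply: seriesP => n; rewrite coef_constM /=.
by case: eqP => [->|]; rewrite ?mulr0 ?mulr1.
Qed.

End SeriesMorphisms.

Arguments qX {R}.

(** * Congruence modulo powers of q and infinite products *)

Section EqMod.
Variable R : comNzRingType.
Implicit Types f g h : series R.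

Definition eqm N f g := forall k, (k < N)%N -> coef f k = coef g k.

Lemma eqm_refl N f : eqm N f f. Proof. by []. Qed.
Lemma eqm_sym N f g : eqm N f g -> eqm N g f.
Proof. by move=> fg k /fg. Qed.
Lemma eqm_trans N f g h : eqm N f g -> eqm N g h -> eqm N f h.
Proof. by move=> fg gh k kN; rewrite fg // gh. Qed.
Lemma eqm_le M N f g : (M <= N)%N -> eqm N f g -> eqm M f g.
Proof. by move=> MN fg k kM; apply: fg; apply: leq_trans MN. Qed.
Lemma eqmP f g : (forall N, eqm N f g) -> f = g.
Proof. by move=> fg; apply: seriesP => n; apply: (fg n.+1). Qed.
Lemma eqmM N f f' g g' : eqm N f f' -> eqm N g g' -> eqm N (f * g) (f' * g').
Proof.
move=> ff gg k kN; rewrite !coefM_series; apply: eq_bigr => i _.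
by rewrite ff ?gg //; have := ltn_ord i; lia.
Qed.
Lemma eqmX N n f g : eqm N f g -> eqm N (f ^+ n) (g ^+ n).
Proof. by move=> fg; elim: n => // n IHn; rewrite !exprS; apply: eqmM. Qed.
Lemma eqmD N f f' g g' : eqm N f f' -> eqm N g g' -> eqm N (f + g) (f' + g').
Proof. by move=> ff gg k kN; rewrite !coefD_series ff ?gg. Qed.
Lemma eqmN N f f' : eqm N f f' -> eqm N (- f) (- f').
Proof. by move=> ff k kN; rewrite !coefN_series ff. Qed.
Lemma eqm_sum N (I : Type) (r : seq I) (P : pred I) (F G : I -> series R) :
  (forall i, P i -> eqm N (F i) (G i)) ->
  eqm N (\sum_(i <- r | P i) F i) (\sum_(i <- r | P i) G i).
Proof. by move=> FG; elim/big_rec2: _ => // i f g /FG; apply: eqmD. Qed.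
Lemma eqm_prod1 N (I : Type) (r : seq I) (P : pred I) (F : I -> series R) :
  (forall i, P i -> eqm N (F i) 1) -> eqm N (\prod_(i <- r | P i) F i) 1.
Proof.
by move=> F1; elim/big_rec: _ => // i f /F1 Fi f1; rewrite -[1]mulr1; apply: eqmM.
Qed.
Lemma eqm_qXn N n f : (N <= n)%N -> eqm N (qX ^+ n * f) 0.
Proof.
by move=> Nn k kN; rewrite coef_qXnM (leq_trans kN Nn).
Qed.
Lemma eqm_dil N k f g : (0 < k)%N -> eqm N f g -> eqm N (dil k f) (dil k g).
Proof.
move=> k0 fg n nN /=; case: ifP => // _; apply: fg.
exact: leq_ltn_trans (leq_div _ _) nN.
Qed.
Lemma eqm_scal N c f g : eqm N f g -> eqm N (scal c f) (scal c g).
Proof. by move=> fg n nN /=; rewrite fg. Qed.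

(** Under [convergent] below, the factor of index [i] is 1 modulo q^(i+1), so the first [k + 1]
    factors already determine the coefficient of q^k. This explicit rate replaces any notion of
    limit. *)
Definition iprod (F : nat -> series R) : series R :=
  Series (fun k => coef (\prod_(i < k.+1) F i) k).

Definition convergent (F : nat -> series R) := forall i, eqm i.+1 (F i) 1.

Lemma eqm_prod_stable F N M : convergent F -> (N <= M)%N ->
  eqm N (\prod_(i < M) F i) (\prod_(i < N) F i).
Proof.
move=> cF /subnKC <-; rewrite big_split_ord /= -[X in eqm _ _ X]mulr1.
apply: eqmM => //; apply: eqm_prod1 => i _; apply: (eqm_le _ (cF _)); lia.
Qed.

Lemma eqm_iprod F N M : convergent F -> (N <= M)%N ->
  eqm N (iprod F) (\prod_(i < M) F i).
Proof.
move=> cF NM k kN /=; apply/esym; apply: eqm_prod_stable => //; lia.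
Qed.

Lemma iprodP F g : convergent F ->
  (forall N, eqm N g (\prod_(i < N) F i)) -> g = iprod F.
Proof.
move=> cF gF; apply: eqmP => N; apply: eqm_trans (gF N) _.
by apply: eqm_sym; apply: eqm_iprod.
Qed.

Lemma eq_iprod F G : F =1 G -> iprod F = iprod G.
Proof. by move=> FG; congr iprod; apply: funext. Qed.

Lemma convergentM F G : convergent F -> convergent G ->
  convergent (fun i => F i * G i).
Proof. by move=> cF cG i; rewrite -[1]mulr1; apply: eqmM. Qed.

Lemma iprodM F G : convergent F -> convergent G ->
  iprod (fun i => F i * G i) = iprod F * iprod G.
Proof.
move=> cF cG; apply/esym; apply: iprodP; first exact: convergentM.
by move=> N; rewrite big_split /=; apply: eqmM; apply: eqm_iprod.
Qed.

Lemma iprodX F n : convergent F -> iprod (fun i => F i ^+ n) = iprod F ^+ n.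
Proof.
move=> cF; apply/esym; apply: iprodP.
  move=> i; elim: n => // n IHn; rewrite exprS -[1]mulr1; exact: eqmM.
move=> N; rewrite prodrXl; elim: n => // n IHn; rewrite !exprS.
by apply: eqmM => //; apply: eqm_iprod.
Qed.

Lemma convergent_block A F : (0 < A)%N -> convergent F ->
  convergent (fun j => \prod_(r < A) F (A * j + r)%N).
Proof.
move=> A0 cF j; apply: eqm_prod1 => r _; apply: (eqm_le _ (cF _)); nia.
Qed.

Lemma iprod_block A F : (0 < A)%N -> convergent F ->
  iprod F = iprod (fun j => \prod_(r < A) F (A * j + r)%N).
Proof.
move=> A0 cF; apply: iprodP; first exact: convergent_block.
move=> N; have -> : \prod_(j < N) \prod_(r < A) F (A * j + r)%N
    = \prod_(i < A * N) F i.
  elim: N => [|N IHN]; first by rewrite muln0 !big_ord0.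
  by rewrite big_ord_recr /= IHN mulnS addnC big_split_ord.
by apply: eqm_iprod => //; nia.
Qed.

Lemma iprod_dil k F : (0 < k)%N -> convergent F ->
  dil k (iprod F) = iprod (fun j => dil k (F j)).
Proof.
move=> k0 cF; apply: iprodP.
  by move=> j; rewrite -(rmorph1 (@dil R k)); apply: eqm_dil.
move=> N; rewrite -rmorph_prod; apply: eqm_dil => //; exact: eqm_iprod.
Qed.

Lemma iprod_scal c F : convergent F ->
  scal c (iprod F) = iprod (fun j => scal c (F j)).
Proof.
move=> cF; apply: iprodP.
  by move=> j; rewrite -(rmorph1 (@scal R c)); apply: eqm_scal.
move=> N; rewrite -rmorph_prod; apply: eqm_scal => //; exact: eqm_iprod.
Qed.

Lemma coef0_iprod F : convergent F -> coef (iprod F) 0 = 1.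
Proof. by move=> cF; rewrite (eqm_iprod cF (leqnn 1)) // big_ord1 cF. Qed.

End EqMod.

Lemma convergent_qX (R : comNzRingType) (c : series R) (e : nat -> nat) :
  (forall i, i < e i)%N -> convergent (fun i => 1 - c * qX ^+ e i).
Proof.
move=> ei i; rewrite -[X in eqm _ _ X]subr0.
by apply: eqmD => //; apply: eqmN; rewrite mulrC; exact: eqm_qXn.
Qed.

Section SeriesMap.
Variables (R S : comNzRingType) (phi : {rmorphism R -> S}).

(** Serves to extend scalars from [int] to [algC], where there are fifth roots of unity. *)
Definition smap (f : series R) : series S := Series (fun n => phi (coef f n)).

Let smap_is_zmod : zmod_morphism smap.
Proof. by move=> f g; apply: seriesP => n /=; rewrite rmorphB. Qed.
Let smap_is_monoid : monoid_morphism smap.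
Proof.
split; first by apply: seriesP => n /=; rewrite rmorph_nat.
move=> f g; apply: seriesP => n /=; rewrite rmorph_sum.
by apply: eq_bigr => i _; rewrite rmorphM.
Qed.
HB.instance Definition _ :=
  GRing.isZmodMorphism.Build (series R) (series S) smap smap_is_zmod.
HB.instance Definition _ :=
  GRing.isMonoidMorphism.Build (series R) (series S) smap smap_is_monoid.

Lemma smap_qX : smap qX = qX.
Proof. by apply: seriesP => n /=; rewrite rmorph_nat. Qed.

Lemma smap_iprod F : convergent F -> smap (iprod F) = iprod (fun j => smap (F j)).
Proof.
have smapm N f g : eqm N f g -> eqm N (smap f) (smap g).
  by move=> fg n nN /=; rewrite fg.
move=> cF; apply: iprodP.
  by move=> j; rewrite -(rmorph1 smap); apply: smapm.
move=> N; rewrite -rmorph_prod; apply: smapm => //; exact: eqm_iprod.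
Qed.

End SeriesMap.

(** * Series summed over index sets *)

Local Open Scope classical_set_scope.

Section LatticeSeries.
Variable R : comNzRingType.

(* The sum of [w i * q ^ e i]; the exponents are integers for the sake of
   quadratic forms, and those met below are nonnegative. *)
Definition lat (I : choiceType) (w : I -> R) (e : I -> int) : series R :=
  Series (fun n => \sum_(i \in [set i | e i = n%:Z]) w i).

Definition summable (I : choiceType) (e : I -> int) :=
  (forall i, 0 <= e i) /\ forall N : nat, finite_set [set i | e i < N%:Z].

Lemma coef_monomial (c : R) n k :
  coef (const c * qX ^+ n) k = c * (k == n)%:R.
Proof. by rewrite coef_constM coef_qXn. Qed.

Lemma const_is_zmod : zmod_morphism (@const R).
Proof. by move=> c d; apply: seriesP => -[|n] //=; rewrite subr0. Qed.
Lemma const_is_monoid : monoid_morphism (@const R).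
Proof.
split; first by apply: seriesP => -[].
by move=> c d; apply: seriesP => -[|n]; rewrite coef_constM //= mulr0.
Qed.
HB.instance Definition _ :=
  GRing.isZmodMorphism.Build R (series R) (@const R) const_is_zmod.
HB.instance Definition _ :=
  GRing.isMonoidMorphism.Build R (series R) (@const R) const_is_monoid.

Lemma coef_lat (I : choiceType) (w : I -> R) e (s : seq I) n :
  uniq s -> (forall i, e i = n%:Z -> i \in s) ->
  coef (lat w e) n = \sum_(i <- s | e i == n%:Z) w i.
Proof.
move=> us es; rewrite /= (fsbigE [seq i <- s | e i == n%:Z]) ?filter_uniq //; last 2 first.
- by move=> i /=; rewrite mem_filter => /andP[/eqP].
- by move=> i /= ei; rewrite mem_filter ei eqxx es.
by rewrite big_filter_cond; apply: eq_bigl => i; rewrite andb_idr // => /eqP; rewrite inE.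
Qed.

(** Below q^N only finitely many indices matter, and any finite list containing them will do.
    Products and decompositions of such series are thereby reduced to finite sums. *)
Lemma lat_eqm (I : choiceType) (w : I -> R) e (r : seq I) N :
  uniq r -> (forall i, 0 <= e i) -> (forall i, e i < N%:Z -> i \in r) ->
  eqm N (lat w e) (\sum_(i <- r) const (w i) * qX ^+ `|e i|%N).
Proof.
move=> ur e0 er k kN; rewrite coef_sum_series.
under [RHS]eq_bigr do rewrite coef_monomial.
rewrite (coef_lat _ ur) => [|i ei]; last by rewrite er // ei ltz_nat.
rewrite big_mkcond; apply: eq_bigr => i _.
case: eqP => [->|nei]; first by rewrite eqxx mulr1.
case: eqP => [ek|_]; last by rewrite mulr0.
by case: nei; rewrite ek gez0_abs.
Qed.

Section Fixed.
Variables (I : choiceType) (w : I -> R) (e : I -> int).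
Hypothesis se : summable e.

Lemma summable_enum N :
  exists r : seq I, uniq r /\ forall i, (i \in r) = (e i < N%:Z).
Proof.
exists (finmap.enum_fset (fset_set [set i | e i < N%:Z])).
split; first exact: finmap.fset_uniq.
move=> i; rewrite in_fset_set; last exact: se.2.
by apply/idP/idP; rewrite inE.
Qed.

Lemma summable_reindex (J : choiceType) (h : J -> I) :
  injective h -> summable (e \o h).
Proof.
move=> hI; split=> [j|N]; first exact: se.1.
have := @finite_preimage _ _ [set i | e i < N%:Z] h; apply; last exact: se.2.
by move=> ? ? _ _ /hI.
Qed.

Lemma lat_reindex (J : choiceType) (h : J -> I) :
  bijective h -> lat (w \o h) (e \o h) = lat w e.
Proof.
case=> g hK gK; apply: seriesP => n /=; apply/esym/reindex_fsbig; split.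
- by move=> j.
- by move=> i j _ _ /(can_inj hK).
- by move=> i ei; exists (g i); rewrite /= ?gK.
Qed.

Lemma lat_qX n : lat w (fun i => n%:Z + e i) = qX ^+ n * lat w e.
Proof.
apply: seriesP => k; rewrite coef_qXnM /=; case: ltnP => kn.
  rewrite fsbig1 // => i /= ei; have := se.1 i; lia.
by apply: eq_fsbigl; apply/seteqP; split => i /=; lia.
Qed.

Lemma lat_dil n : (0 < n)%N -> lat w (fun i => n%:Z * e i) = dil n (lat w e).
Proof.
move=> n0; apply: seriesP => k /=; case: ifP => [/dvdnP[m ->]|kn].
  rewrite mulnK //; apply: eq_fsbigl; apply/seteqP; split => i /=; nia.
rewrite fsbig1 // => i /= ei; case/negP: kn; apply/dvdnP.
by exists `|e i|%N; have := se.1 i; nia.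
Qed.

End Fixed.

Lemma lat_const (I : choiceType) (w : I -> R) e c : summable e ->
  lat (fun i => c * w i) e = const c * lat w e.
Proof.
move=> se; have [e0 _] := se.
apply: eqmP => N; have [r [ur er]] := summable_enum se N.
apply: eqm_trans (lat_eqm _ ur e0 _) _; first by move=> i; rewrite er.
apply: eqm_sym; apply: eqm_trans (eqmM (@eqm_refl _ N _) (lat_eqm _ ur e0 _)) _.
  by move=> i; rewrite er.
move=> k kN; rewrite mulr_sumr !coef_sum_series; apply: eq_bigr => i _.
by rewrite rmorphM mulrA.
Qed.

Lemma summable_pair (I J : choiceType) (e : I -> int) (e' : J -> int) :
  summable e -> summable e' -> summable (fun p : I * J => e p.1 + e' p.2).
Proof.
move=> se se'; split=> [p|N]; first by rewrite addr_ge0 ?se.1 ?se'.1.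
apply: sub_finite_set (finite_setX (se.2 N) (se'.2 N)) => p /= eN.
by have := se.1 p.1; have := se'.1 p.2; split => /=; lia.
Qed.

Lemma latM (I J : choiceType) (w : I -> R) (w' : J -> R) e e' :
  summable e -> summable e' ->
  lat w e * lat w' e' =
  lat (fun p : I * J => w p.1 * w' p.2) (fun p : I * J => e p.1 + e' p.2).
Proof.
move=> se se'; apply: eqmP => N; have [r [ur er]] := summable_enum se N.
have [r' [ur' er']] := summable_enum se' N.
apply: (@eqm_trans _ _ _ ((\sum_(i <- r) const (w i) * qX ^+ `|e i|%N)
   * (\sum_(i <- r') const (w' i) * qX ^+ `|e' i|%N))).
  apply: eqmM; apply: lat_eqm => //; rewrite ?se.1 ?se'.1 //.
  - by case: se.
  - by move=> i; rewrite er.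
  - by case: se'.
  - by move=> i; rewrite er'.
have [e0 _] := summable_pair se se'.
apply: eqm_sym; apply: (eqm_trans (@lat_eqm _ _ _ (allpairs pair r r') _ _ _ _)).
- by apply: allpairs_uniq => // -[? ?] [? ?].
- exact: e0.
- move=> [i j] /= ij; apply: allpairs_f; rewrite ?er ?er'.
    by have := se'.1 j; lia.
  by have := se.1 i; lia.
rewrite big_allpairs_dep /= mulr_suml; apply: eqm_sum => i _.
rewrite mulr_sumr; apply: eqm_sum => j _ k kN.
have -> : `|(e i + e' j)%R|%N = (`|e i| + `|e' j|)%N.
  by have := se.1 i; have := se'.1 j; lia.
by rewrite rmorphM exprD mulrACA.
Qed.

Lemma lat_split (T : finType) (I : choiceType) (w : T * I -> R) e :
  summable e ->
  lat w e = \sum_(t : T) lat (fun i => w (t, i)) (fun i => e (t, i)).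
Proof.
move=> se; apply: eqmP => N; have [r [ur er]] := summable_enum se N.
pose s := undup [seq p.2 | p <- r].
have [e0 _] := se.
apply: (eqm_trans (@lat_eqm _ _ _ (allpairs pair (enum T) s) _ _ e0 _)).
- by apply: allpairs_uniq; rewrite ?enum_uniq ?undup_uniq // => -[? ?] [? ?].
- move=> [t i] eN; apply: allpairs_f; first by rewrite mem_enum.
  rewrite mem_undup.
  have rti : (t, i) \in r by rewrite er.
  exact: (map_f snd rti).
rewrite big_allpairs_dep /= big_enum /=; apply: eqm_sum => t _.
apply: eqm_sym; apply: lat_eqm => [|i|i eN]; [exact: undup_uniq | exact: e0 |].
rewrite mem_undup; have rti : (t, i) \in r by rewrite er.
exact: (map_f snd rti).
Qed.

Lemma summable_int (e : int -> int) (c : nat) :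
  (forall n, 0 <= e n) -> (forall n : int, (absz n)%:Z <= e n + c%:Z) -> summable e.
Proof.
move=> e0 ec; split=> // N.
pose s : seq int := [seq k%:Z - (N + c)%:Z | k <- iota 0 (2 * (N + c)).+1].
apply: sub_finite_set (finite_seq s) => n /= eN.
have nE : n = (absz (n + (N + c)%:Z))%:Z - (N + c)%:Z by have := ec n; lia.
rewrite /= nE; apply: (map_f (fun k : nat => k%:Z - (N + c)%:Z : int)).
by rewrite mem_iota; have := ec n; lia.
Qed.

End LatticeSeries.

(** * The triple product identity *)

Section Gauss.
Variables (S : comNzRingType) (Q : S).

(** The q-binomial coefficient, given by Pascal's rule so that it makes sense over any commutative
    ring without division. *)
Fixpoint gauss (n k : nat) : S :=
  match n, k with
  | _, 0 => 1
  | 0, _.+1 => 0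
  | n'.+1, k'.+1 => gauss n' k' + Q ^+ k * gauss n' k
  end.

Lemma gauss0 n : gauss n 0 = 1. Proof. by case: n. Qed.
Lemma gaussS n k : gauss n.+1 k.+1 = gauss n k + Q ^+ k.+1 * gauss n k.+1.
Proof. by []. Qed.

Lemma gauss_small n k : (n < k)%N -> gauss n k = 0.
Proof.
elim: n k => [|n IHn] [|k] //= nk.
by rewrite !IHn ?mulr0 ?addr0 //; lia.
Qed.

Definition qfact n := \prod_(i < n) (1 - Q ^+ i.+1).

Lemma qfactS n : qfact n.+1 = qfact n * (1 - Q ^+ n.+1).
Proof. by rewrite /qfact big_ord_recr. Qed.

Lemma gauss_qfact n k : (k <= n)%N ->
  gauss n k * qfact k * qfact (n - k) = qfact n.
Proof.
elim: n k => [|n IHn] [|k] //.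
- by rewrite /qfact big_ord0 !mulr1.
- by rewrite gauss0 subn0 /qfact big_ord0 !mul1r.
rewrite ltnS leq_eqVlt => /orP[/eqP ->|kn].
  rewrite subnn gaussS (@gauss_small n n.+1) // mulr0 addr0 !qfactS.
  by rewrite mulrA -[in RHS](IHn n) // subnn; ring.
have E1 := IHn k (ltnW kn); have E2 := IHn k.+1 kn.
have E3 : (n - k)%N = (n - k.+1).+1 by lia.
rewrite subSS gaussS !qfactS E3 !qfactS.
rewrite E3 !qfactS in E1; rewrite qfactS in E2.
have E4 : Q ^+ n.+1 = Q ^+ k.+1 * Q ^+ (n - k.+1).+1 by rewrite -exprD; congr (_ ^+ _); lia.
rewrite E4 mulrDl mulrDl.
(* By both induction hypotheses the two summands are multiples of [qfact n], with weights 1 -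
   Q^(k+1) and Q^(k+1) (1 - Q^(n-k)), whose sum is 1 - Q^(n+1). *)
transitivity ((1 - Q ^+ k.+1) * (gauss n k * qfact k * (qfact (n - k.+1) * (1 - Q ^+ (n - k.+1).+1)))
  + Q ^+ k.+1 * (1 - Q ^+ (n - k.+1).+1) * (gauss n k.+1 * (qfact k * (1 - Q ^+ k.+1)) * qfact (n - k.+1))).
  by ring.
by rewrite E1 E2; ring.
Qed.

(** The homogeneous variable [y] will be a power of q: it centres the product without negative
    exponents. *)
Lemma q_binomial (x y : S) n :
  \prod_(j < n) (y + x * Q ^+ j) =
  \sum_(k < n.+1) gauss n k * (Q ^+ 'C(k, 2) * x ^+ k * y ^+ (n - k)).
Proof.
elim: n x => [|n IHn] x.
  by rewrite big_ord0 big_ord1 !expr0 !mulr1.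
rewrite big_ord_recl expr0 mulr1.
under eq_bigr do rewrite exprS mulrA.
rewrite IHn [RHS]big_ord_recl gauss0 subn0 !expr0 !mul1r.
have binE k : 'C(k.+1, 2) = (k + 'C(k, 2))%N by rewrite binS bin1 addnC.
under [in RHS]eq_bigr => k _ do rewrite lift0 gaussS mulrDl subSS.
rewrite big_split /= mulrDl [LHS]addrC [RHS]addrCA; congr (_ + _).
  rewrite mulr_sumr; apply: eq_bigr => k _.
  by rewrite binE exprMn !exprD exprS; ring.
rewrite big_ord_recl gauss0 subn0 !expr0 !mul1r mulrDr -exprS; congr (_ + _).
rewrite [in RHS]big_ord_recr /= (@gauss_small n n.+1) // mulr0 mul0r addr0.
rewrite mulr_sumr; apply: eq_bigr => k _; rewrite /bump /= add1n.
have -> : (n - k)%N = (n - k.+1).+1 by have := ltn_ord k; lia.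
by rewrite exprMn [y ^+ _.+1]exprS; ring.
Qed.

End Gauss.

Definition tri (n : int) : int := (n * (n - 1) %/ 2)%Z.

Lemma tri2 n : 2 * tri n = n * (n - 1).
Proof.
have nE := divz_eq n 2; rewrite /tri.
have [] : (n %% 2)%Z = 0 \/ (n %% 2)%Z = 1 by lia.
  by move=> n2; rewrite n2 in nE; rewrite nE; nia.
by move=> n2; rewrite n2 in nE; rewrite nE; nia.
Qed.

Lemma tri_bin (k : nat) : tri k = 'C(k, 2)%:Z.
Proof.
elim: k => [|k IHk] //; rewrite binS bin1 PoszD -IHk.
by have := tri2 k; have := tri2 k.+1; nia.
Qed.

(* Locked, lest conversion unfold these series when comparing two of them.
   The exponent is A n (n - 1) / 2 + B n, so theta eps A B is
   f(eps q^B, eps q^(A - B)) in Ramanujan's notation for a sign eps. *)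
HB.lock Definition theta_exp (A B : nat) (n : int) : int := A%:Z * tri n + B%:Z * n.
HB.lock Definition eta (R : comNzRingType) (A : nat) : series R :=
  iprod (fun j => 1 - qX ^+ (A * j.+1)).
HB.lock Definition poch (R : comNzRingType) (c : R) (A B : nat) : series R :=
  iprod (fun i => 1 + const c * qX ^+ (A * i + B)).
HB.lock Definition theta (R : comNzRingType) (eps : R) (A B : nat) : series R :=
  lat (fun n : int => eps ^+ `|n|%N) (theta_exp A B).

Section TripleProduct.
Variable R : comNzRingType.
Implicit Types f g h : series R.

Lemma eqm_cancel N f g h :
  coef f 0 = 1 -> eqm N (f * g) (f * h) -> eqm N g h.
Proof.
move=> f0 fgh; suff gh k : (k < N)%N -> coef (g - h) k = 0.
  by move=> k /gh; rewrite coefB_series => /eqP; rewrite subr_eq0 => /eqP.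
elim/ltn_ind: k => k IHk kN.
have : coef (f * (g - h)) k = 0 by rewrite mulrBr coefB_series fgh // subrr.
rewrite coefM_series big_ord_recl f0 mul1r subn0 big1 ?addr0 // => i _.
rewrite IHk ?mulr0 //= /bump /=; have := ltn_ord i; lia.
Qed.

Lemma convergent_eta A : (0 < A)%N ->
  convergent (fun j => 1 - qX ^+ (A * j.+1) : series R).
Proof.
move=> A0 j; have ltA i : (i < A * i.+1)%N by nia.
by have := @convergent_qX R 1 _ ltA j; rewrite mul1r.
Qed.

Lemma eqm_qfact_eta A N n : (0 < A)%N -> (N <= n)%N ->
  eqm N (eta R A) (qfact (qX ^+ A) n).
Proof.
move=> A0 Nn; rewrite eta.unlock /qfact; under eq_bigr do rewrite -exprM.
exact: (eqm_iprod (convergent_eta A0)).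
Qed.

(** Central q-binomial coefficients tend to the inverse of the eta product: in [gauss_qfact] all
    three factorials agree with [eta R A] modulo q^N. *)
Lemma eqm_gauss_eta A N n k : (0 < A)%N -> (N <= k)%N -> (N <= n - k)%N ->
  (k <= n)%N -> eqm N (eta R A * gauss (qX ^+ A) n k) 1.
Proof.
move=> A0 Nk Nnk kn; apply: (@eqm_cancel _ (eta R A)).
  by rewrite eta.unlock; apply/coef0_iprod/convergent_eta.
rewrite mulr1; apply: (@eqm_trans _ _ _ (qfact (qX ^+ A) n)); last first.
  by apply/eqm_sym/eqm_qfact_eta => //; lia.
rewrite -(gauss_qfact _ kn).
have -> : eta R A * (eta R A * gauss (qX ^+ A) n k) = gauss (qX ^+ A) n k * eta R A * eta R A.
  by ring.
by apply: eqmM; [apply: eqmM => // |]; apply: eqm_qfact_eta.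
Qed.

(** The passage to the limit shared by the triple product and Jacobi's cube identity. Where |n| < N
    + 2, the q-binomial coefficient is already the inverse of eta; elsewhere [e n >= |n| - 1] pushes
    the term beyond q^N on both sides. *)
Lemma lat_gauss_limit A (c : int -> R) (e : int -> int) N m :
  (0 < A)%N -> (forall n, 0 <= e n) -> (forall n : int, (absz n)%:Z <= e n + 1) ->
  (2 * N + 2 <= m)%N ->
  eqm N (lat c e) (eta R A * \sum_(k < (2 * m).+1) gauss (qX ^+ A) (2 * m) k *
    (const (c (k%:Z - m%:Z)) * qX ^+ absz (e (k%:Z - m%:Z)))).
Proof.
move=> A0 e0 en mN; pose r : seq int := [seq k%:Z - m%:Z | k <- iota 0 (2 * m).+1].
have rP (n : int) : e n < N%:Z -> n \in r.
  move=> eN; have nN : (absz n <= N)%N by have := en n; lia.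
  have nE : n = (absz (n + m%:Z))%:Z - m%:Z by lia.
  rewrite nE; apply: (map_f (fun k : nat => k%:Z - m%:Z : int)).
  by rewrite mem_iota; lia.
apply: eqm_trans (@lat_eqm _ _ _ _ r _ _ e0 rP) _.
  by rewrite map_inj_uniq ?iota_uniq // => i j; lia.
rewrite big_map -[(2 * m).+1]subn0 -/(index_iota 0 _) big_mkord mulr_sumr.
apply: eqm_sum => k _; rewrite mulrA.
have [n nE] : exists n : int, n = k%:Z - m%:Z by exists (k%:Z - m%:Z).
rewrite -nE.
have [nN|nN] := ltnP (absz n) (N + 2).
  rewrite -[X in eqm _ X _]mul1r; apply: eqmM => //.
  have k2m := ltn_ord k; have Nk : (N <= k)%N by lia.
  have Nmk : (N <= 2 * m - k)%N by lia.
  by apply/eqm_sym/eqm_gauss_eta => //; lia.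
have small f : eqm N (f * (const (c n) * qX ^+ `|e n|%N)) 0.
  by rewrite mulrA mulrC; apply: eqm_qXn; have := en n; lia.
rewrite -[X in eqm _ X _]mul1r; apply: eqm_trans (small _) _.
exact/eqm_sym/small.
Qed.

Section ThetaExp.
Variables A B : nat.
Hypotheses (A0 : (0 < A)%N) (BA : (B <= A)%N).

Lemma theta_exp_ge n : (absz n)%:Z <= theta_exp A B n + 1.
Proof.
rewrite theta_exp.unlock; have t2 := tri2 n; case: (leP 0 n) => n0.
  have t1 : n - 1 <= tri n by nia.
  have t0 : 0 <= tri n by nia.
  have : tri n <= A%:Z * tri n by nia.
  have : 0 <= B%:Z * n by nia.
  lia.
(* For negative [n], [B <= A] bounds the exponent below by [A] times [tri n + n], which equals
   [tri (- n)]. *)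
have t1 : - n - 1 <= tri n + n by nia.
have t0 : 0 <= tri n + n by nia.
have : tri n + n <= A%:Z * (tri n + n) by nia.
have : A%:Z * n <= B%:Z * n by nia.
by rewrite mulrDr; lia.
Qed.

Lemma theta_exp_ge0 n : 0 <= theta_exp A B n.
Proof.
rewrite theta_exp.unlock; have t2 := tri2 n; case: (leP 0 n) => n0.
  have t0 : 0 <= tri n by nia.
  by rewrite addr_ge0 // mulr_ge0.
have t0 : 0 <= tri n + n by nia.
have : 0 <= A%:Z * (tri n + n) by rewrite mulr_ge0.
have : A%:Z * n <= B%:Z * n by nia.
by rewrite mulrDr; lia.
Qed.

Lemma summable_theta : summable (theta_exp A B).
Proof.
apply: (@summable_int _ 1); [exact: theta_exp_ge0 | exact: theta_exp_ge].
Qed.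
End ThetaExp.

(** Recentring at [k = m] splits off an exponent independent of [k], namely that of the power of q
    by which the finite identities below are multiplied. *)
Lemma theta_exp_shift A B (m k : nat) : (0 < A)%N -> (B <= A)%N ->
  (k <= 2 * m)%N ->
  (A * 'C(k, 2) + B * k + A * m * (2 * m - k) =
   (B * m + A * 'C(m, 2) + A * m * m) + absz (theta_exp A B (k%:Z - m%:Z)))%N.
Proof.
move=> A0 BA km; have e0 := theta_exp_ge0 A0 BA (k%:Z - m%:Z).
apply/eqP; rewrite -eqz_nat !PoszD !PoszM gez0_abs // -!tri_bin.
have -> : (2 * m - k)%N = 2 * m%:Z - k%:Z :> int by lia.
have tE : tri k%:Z + m%:Z * (m%:Z - k%:Z) = tri m%:Z + tri (k%:Z - m%:Z).
  by have := tri2 k; have := tri2 m; have := tri2 (k%:Z - m%:Z); nia.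
apply/eqP; rewrite theta_exp.unlock.
transitivity (A%:Z * (tri k%:Z + m%:Z * (m%:Z - k%:Z)) + B%:Z * k%:Z + A%:Z * m%:Z * m%:Z).
  by ring.
by rewrite tE; ring.
Qed.

Section JTP.
Variables (eps : R) (A B : nat).
Hypotheses (eps2 : eps * eps = 1) (A0 : (0 < A)%N) (BA : (B <= A)%N).

Let eps_shift (k m : nat) : eps ^+ k = eps ^+ m * eps ^+ absz (k%:Z - m%:Z).
Proof.
have epsE n : eps ^+ (2 * n) = 1 by rewrite exprM expr2 eps2 expr1n.
have [km|mk] := leqP k m.
  have -> : m = (k + (m - k))%N by lia.
  have -> : absz (k%:Z - (k + (m - k))%N%:Z) = (m - k)%N by lia.
  by rewrite exprD -mulrA -exprD addnn -mul2n epsE mulr1.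
have -> : absz (k%:Z - m%:Z) = (k - m)%N by lia.
by rewrite -exprD; congr (_ ^+ _); lia.
Qed.

Lemma qX_lreg n f g : qX ^+ n * f = qX ^+ n * g -> f = g.
Proof.
move=> fg; apply: seriesP => k.
by have := congr1 (fun h => coef h (n + k)) fg; rewrite !coef_qXnM ltnNge leq_addr addKn.
Qed.

(** The q-binomial theorem with Q = q^A, x = eps q^B, y = q^(Am) and 2m factors. Drawing eps
    q^(B+Ai) out of the first half and q^(Am) out of the second leaves the two products; the signs
    drawn out are compensated since eps^2 = 1. *)
Lemma finite_triple_product m :
  (\prod_(i < m) (1 + const eps * qX ^+ (A * i.+1 - B))) *
  (\prod_(i < m) (1 + const eps * qX ^+ (B + A * i))) =
  \sum_(k < (2 * m).+1) gauss (qX ^+ A) (2 * m) k *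
    (const (eps ^+ absz (k%:Z - m%:Z)) * qX ^+ absz (theta_exp A B (k%:Z - m%:Z))).
Proof.
set c := const eps; set q : series R := qX.
have cc : c * c = 1 by rewrite -rmorphM eps2 rmorph1.
have cm : c ^+ m * c ^+ m = 1 by rewrite -exprMn cc expr1n.
set E := (B * m + A * 'C(m, 2) + A * m * m)%N.
apply: (@qX_lreg E); rewrite mulr_sumr -/q.
transitivity (c ^+ m * \prod_(j < 2 * m) (q ^+ (A * m) + c * q ^+ B * (q ^+ A) ^+ j)).
  have -> : (2 * m = m + m)%N by lia.
  rewrite big_split_ord /=.
  have -> : \prod_(i < m) (q ^+ (A * m) + c * q ^+ B * (q ^+ A) ^+ i) =
     c ^+ m * q ^+ (B * m + A * 'C(m, 2)) * \prod_(i < m) (1 + c * q ^+ (A * i.+1 - B)).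
    rewrite [in RHS](reindex_inj rev_ord_inj) /=.
    have -> : c ^+ m * q ^+ (B * m + A * 'C(m, 2)) = \prod_(i < m) (c * q ^+ (B + A * i)).
      elim: m {cm E} => [|k IHk]; first by rewrite big_ord0 !muln0 !expr0 mulr1.
      rewrite big_ord_recr /= -IHk binS bin1 mulrACA -exprSr -exprD.
      by congr (_ * _ ^+ _); lia.
    rewrite -big_split; apply: eq_bigr => i _ /=.
    rewrite subnSK // -exprM mulrDr mulr1 addrC -mulrA -exprD mulrACA cc mul1r -exprD.
    by congr (_ + _ ^+ _); have := ltn_ord i; nia.
  have -> : \prod_(i < m) (q ^+ (A * m) + c * q ^+ B * (q ^+ A) ^+ (m + i)) =
     q ^+ (A * m * m) * \prod_(i < m) (1 + c * q ^+ (B + A * i)).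
    have -> : q ^+ (A * m * m) = \prod_(i < m) q ^+ (A * m).
      by rewrite prodr_const card_ord exprM.
    rewrite -big_split; apply: eq_bigr => i _ /=.
    rewrite -exprM mulnDr !exprD; ring.
  rewrite /E !exprD -[LHS]mul1r -cm; ring.
rewrite q_binomial mulr_sumr; apply: eq_bigr => k _.
have ck : c ^+ k = c ^+ m * const (eps ^+ absz (k%:Z - m%:Z)).
  by rewrite /c -!rmorphXn -rmorphM -eps_shift.
have km : (k <= 2 * m)%N by rewrite -ltnS.
have key : (q ^+ A) ^+ 'C(k, 2) * (q ^+ B) ^+ k * (q ^+ (A * m)) ^+ (2 * m - k) =
   q ^+ E * q ^+ absz (theta_exp A B (k%:Z - m%:Z)).
  by rewrite -!exprM -!exprD /E -theta_exp_shift.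
transitivity ((c ^+ m * c ^+ m) * (gauss (q ^+ A) (2 * m) k *
  const (eps ^+ absz (k%:Z - m%:Z)) *
  ((q ^+ A) ^+ 'C(k, 2) * (q ^+ B) ^+ k * (q ^+ (A * m)) ^+ (2 * m - k)))).
  by rewrite exprMn ck; ring.
by rewrite cm mul1r key; ring.
Qed.

End JTP.
End TripleProduct.

(** * Theta functions as eta quotients *)

Section InfiniteProducts.
Variable R : comNzRingType.
Implicit Types (f g h : series R) (c eps : R).

Lemma cancel_coef0 f g h : coef f 0 = 1 -> f * g = f * h -> g = h.
Proof.
move=> f0 fgh; apply: eqmP => N; apply: (eqm_cancel f0).
by rewrite fgh; apply: eqm_refl.
Qed.

Lemma iprod_prod k (F : nat -> nat -> series R) :
  (forall r, convergent (F r)) ->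
  iprod (fun j => \prod_(r < k) F r j) = \prod_(r < k) iprod (F r).
Proof.
move=> cF; elim: k => [|k IHk].
  rewrite big_ord0; apply/esym/iprodP => [i|N].
    by rewrite big_ord0; apply: eqm_refl.
  by rewrite big1 => [|i _]; rewrite ?big_ord0 //; apply: eqm_refl.
rewrite big_ord_recr /= -IHk -iprodM //; last first.
  by move=> j; apply: eqm_prod1 => r _; apply: cF.
by apply: eq_iprod => j; rewrite big_ord_recr.
Qed.

Lemma convergent_poch c A B : (0 < A)%N -> (0 < B)%N ->
  convergent (fun i => 1 + const c * qX ^+ (A * i + B) : series R).
Proof.
move=> A0 B0 j; have ltA i : (i < A * i + B)%N by nia.
by have := @convergent_qX R (const (- c)) _ ltA j; rewrite rmorphN mulNr opprK.
Qed.

Lemma coef0_poch c A B : (0 < A)%N -> (0 < B)%N -> coef (poch c A B) 0 = 1.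
Proof. by move=> A0 B0; rewrite poch.unlock; apply/coef0_iprod/convergent_poch. Qed.

Lemma eta_poch A : eta R A = poch (-1) A A.
Proof.
rewrite eta.unlock poch.unlock; apply: eq_iprod => i.
by rewrite rmorphN rmorph1 mulN1r mulnS addnC.
Qed.

Lemma coef0_eta A : (0 < A)%N -> coef (eta R A) 0 = 1.
Proof. by move=> A0; rewrite eta_poch coef0_poch. Qed.

Lemma poch_block k c A B : (0 < k)%N -> (0 < A)%N -> (0 < B)%N ->
  poch c A B = \prod_(r < k) poch c (k * A) (A * r + B).
Proof.
move=> k0 A0 B0; rewrite poch.unlock (iprod_block k0); last exact: convergent_poch.
rewrite -(@iprod_prod k (fun r i => 1 + const c * qX ^+ (k * A * i + (A * r + B)))).
  apply: eq_iprod => j; apply: eq_bigr => r _.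
  by congr (1 + _ * _ ^+ _); lia.
by move=> r; apply: convergent_poch; rewrite ?muln_gt0 ?k0 ?addn_gt0 ?B0 ?orbT.
Qed.

Lemma poch_conj c A B : (0 < A)%N -> (0 < B)%N ->
  poch c A B * poch (- c) A B = poch (- (c * c)) (2 * A) (2 * B).
Proof.
move=> A0 B0; rewrite poch.unlock -iprodM; try exact: convergent_poch.
apply: eq_iprod => i; rewrite !rmorphN rmorphM /=.
have -> : (2 * A * i + 2 * B = (A * i + B) + (A * i + B))%N by lia.
by rewrite [qX ^+ (_ + _ + _)]exprD; ring.
Qed.

Lemma dil_const k c : dil k (const c) = const c :> series R.
Proof.
apply: seriesP => -[|n] /=; first by rewrite dvdn0 div0n.
case: ifP => // kn; case E : (n.+1 %/ k)%N => //.
by move: (divnK kn); rewrite E.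
Qed.

Lemma dil_poch k c A B : (0 < k)%N -> (0 < A)%N -> (0 < B)%N ->
  dil k (poch c A B) = poch c (k * A) (k * B).
Proof.
move=> k0 A0 B0; rewrite poch.unlock iprod_dil //; last exact: convergent_poch.
apply: eq_iprod => i.
rewrite rmorphD rmorph1 rmorphM rmorphXn /= dil_const dil_qX // -exprM.
by congr (1 + _ * _ ^+ _); lia.
Qed.

Lemma dil_eta k A : (0 < k)%N -> (0 < A)%N -> dil k (eta R A) = eta R (k * A).
Proof. by move=> k0 A0; rewrite !eta_poch dil_poch. Qed.

Lemma dil_theta k eps A B : (0 < k)%N -> (0 < A)%N -> (B <= A)%N ->
  dil k (theta eps A B) = theta eps (k * A) (k * B).
Proof.
move=> k0 A0 BA; rewrite theta.unlock -lat_dil //; last exact: summable_theta.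
congr lat; apply: funext => n; rewrite theta_exp.unlock !PoszM; ring.
Qed.

(** The limit of [finite_triple_product]. The strict bounds on [B] keep the exponents of both
    products positive, hence the products convergent. *)
Theorem triple_product eps A B :
  eps * eps = 1 -> (0 < B)%N -> (B < A)%N ->
  theta eps A B = eta R A * poch eps A (A - B) * poch eps A B.
Proof.
move=> eps2 B0 BA; have A0 : (0 < A)%N by lia.
apply: eqmP => N; rewrite theta.unlock.
apply: eqm_trans (lat_gauss_limit (m := 2 * N + 2) _ A0 _ _ _) _.
- by apply: theta_exp_ge0 => //; lia.
- by apply: theta_exp_ge => //; lia.
- by [].
rewrite -finite_triple_product //; last by lia.
rewrite -mulrA poch.unlock; apply: eqmM => //; apply: eqmM; apply: eqm_sym.
  have -> : \prod_(i < 2 * N + 2) (1 + const eps * qX ^+ (A * i.+1 - B))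
    = \prod_(i < 2 * N + 2) (1 + const eps * qX ^+ (A * i + (A - B))) :> series R.
    by apply: eq_bigr => i _; congr (1 + _ * _ ^+ _); lia.
  by apply: eqm_iprod; [apply: convergent_poch; lia | lia].
have -> : \prod_(i < 2 * N + 2) (1 + const eps * qX ^+ (B + A * i))
  = \prod_(i < 2 * N + 2) (1 + const eps * qX ^+ (A * i + B)) :> series R.
  by apply: eq_bigr => i _; congr (1 + _ * _ ^+ _); lia.
by apply: eqm_iprod; [apply: convergent_poch; lia | lia].
Qed.

Let N1 : (-1) * (-1) = 1 :> R. Proof. by rewrite mulrNN mulr1. Qed.
Let P1 : 1 * 1 = 1 :> R. Proof. by rewrite mulr1. Qed.

Notation e := (eta R).

(** Euler's pentagonal number theorem: the three products run over the residue classes of exponents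
    modulo 3. *)
Lemma eta_pentagonal : theta (-1) 3 1 = e 1.
Proof.
rewrite (triple_product N1) // !eta_poch (@poch_block 3 _ 1 1) //.
by rewrite !big_ord_recl big_ord0 /bump /= mulr1; ring.
Qed.

Lemma poch_odd A : (0 < A)%N -> poch (-1) (2 * A) A * e (2 * A) = e A.
Proof.
move=> A0; rewrite !eta_poch [RHS](@poch_block 2) //.
rewrite !big_ord_recl big_ord0 /bump /= mulr1 muln0 muln1 add0n.
by congr (_ * poch _ _ _); lia.
Qed.

Lemma poch_plus_odd A : (0 < A)%N ->
  poch 1 (2 * A) A * (e A * e (4 * A)) = e (2 * A) ^+ 2.
Proof.
move=> A0; have A20 : (0 < 2 * A)%N by lia.
rewrite -{1}(poch_odd A0) -(poch_odd A20).
have := @poch_conj 1 (2 * A) A A20 A0; rewrite mulr1 => <-.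
have -> : (2 * (2 * A) = 4 * A)%N by lia.
ring.
Qed.

Lemma poch_plus A : (0 < A)%N -> poch 1 A A * e A = e (2 * A).
Proof. by move=> A0; rewrite !eta_poch poch_conj // mulr1. Qed.

Definition phi eps := theta eps 2 1.
(** The exponents 2 n^2 - n, for n in Z, run once through the triangular numbers. *)
Definition psi : series R := theta 1 4 1.
(** In Ramanujan's notation f(q, q^4) f(q^2, q^3), the common value of the four noncentral classes
    of a sum of two triangular numbers modulo 2 + i. Up to a factor eps q, [H] is its analogue for
    two squares. *)
Definition G : series R := theta 1 5 1 * theta 1 5 2.
Definition H eps := theta eps 10 1 * theta eps 10 3.

Lemma phi_poch eps : eps * eps = 1 -> phi eps = e 2 * poch eps 2 1 ^+ 2.
Proof. by move=> eps2; rewrite /phi triple_product // subn1 /=; ring. Qed.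

Lemma phi_minus : phi (-1) * e 2 = e 1 ^+ 2.
Proof. by have := @poch_odd 1 isT; rewrite muln1 (phi_poch N1) => <-; ring. Qed.

Lemma phi_plus : phi 1 * (e 1 ^+ 2 * e 4 ^+ 2) = e 2 ^+ 5.
Proof.
have h := @poch_plus_odd 1 isT; rewrite !muln1 in h; rewrite (phi_poch P1).
transitivity (e 2 * (poch 1 2 1 * (e 1 * e 4)) ^+ 2); first by ring.
by rewrite h; ring.
Qed.

Lemma psi_eta : psi * e 1 = e 2 ^+ 2.
Proof.
have h := @poch_plus_odd 1 isT; rewrite !muln1 in h; rewrite -h.
rewrite /psi (triple_product P1) // (@poch_block 2 1 2 1) //.
by rewrite !big_ord_recl big_ord0 /bump /= mulr1; ring.
Qed.

Lemma G_eta : G * (e 1 * e 10) = e 2 * e 5 ^+ 3.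
Proof.
rewrite /G !(triple_product P1) // -(@poch_plus 1 isT) -(@poch_plus 5 isT).
rewrite [poch 1 1 1](@poch_block 5 1 1 1) //.
by rewrite !big_ord_recl big_ord0 /bump /= mulr1; ring.
Qed.

Let H_poch eps : eps * eps = 1 ->
  H eps * poch eps 10 5 = e 10 ^+ 2 * poch eps 2 1.
Proof.
move=> eps2; rewrite /H !triple_product // [poch eps 2 1](@poch_block 5 _ 2 1) //.
by rewrite !big_ord_recl big_ord0 /bump /= mulr1; ring.
Qed.

Lemma H_minus : H (-1) * (e 2 * e 5) = e 1 * e 10 ^+ 3.
Proof.
have h1 := @poch_odd 1 isT; have h5 := @poch_odd 5 isT.
rewrite muln1 in h1; rewrite -h1 -h5.
transitivity (H (-1) * poch (-1) 10 5 * (e 2 * e 10)); first by ring.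
by rewrite (H_poch N1); ring.
Qed.

Lemma H_plus : H 1 * (e 1 * e 4) = e 2 ^+ 2 * (e 5 * e 20).
Proof.
apply: (@cancel_coef0 (e 10 ^+ 2)); first by rewrite coef0_exp coef0_eta ?expr1n.
have h1 := @poch_plus_odd 1 isT; have h5 := @poch_plus_odd 5 isT.
rewrite !muln1 in h1; rewrite -h1 -{1}[e 10]/(e (2 * 5)) -h5.
transitivity (H 1 * poch 1 10 5 * (e 1 * e 4 * (e 5 * e 20))); first by ring.
by rewrite (H_poch P1) -h5; ring.
Qed.

End InfiniteProducts.

Lemma rmorph_gauss (S T : comNzRingType) (phi : {rmorphism S -> T}) (Q : S) n k :
  phi (gauss Q n k) = gauss (phi Q) n k.
Proof.
elim: n k => [|n IHn] [|k]; rewrite ?gauss0 ?rmorph1 ?rmorph0 //.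
by rewrite !gaussS rmorphD rmorphM rmorphXn !IHn.
Qed.

(** * Jacobi's cube identity *)

Section JacobiCube.
Variable R : comNzRingType.
Local Notation q := (qX : series R).

Let sgn (n : int) : R := (-1) ^+ `|n|%N.

(* The derivative at [x = 1] of the q-binomial expansion of
   [\prod_(j < 2 m) (q ^ m - x q ^ j)], whose factor of index [m] vanishes
   there. *)
Lemma finite_cube m :
  - (qfact q m.+1 * qfact q m) =
  \sum_(k < (2 * m.+1).+1) gauss q (2 * m.+1) k *
    (const (sgn (k%:Z - m.+1%:Z) * (k%:Z - m.+1%:Z)%:~R)
     * q ^+ absz (theta_exp 1 0 (k%:Z - m.+1%:Z))).
Proof.
set M := m.+1; set E := ('C(M, 2) + M * M)%N.
pose c k : series R := gauss q (2 * M) k * (q ^+ 'C(k, 2) * (-1) ^+ k * (q ^+ M) ^+ (2 * M - k)).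
have [r rE] : exists r : {poly series R}, r =
    \prod_(j < M) ((q ^+ M)%:P - 'X * (q ^+ j)%:P)
    * \prod_(i < m) ((q ^+ M)%:P - 'X * (q ^+ (M + i.+1))%:P) by eexists.
have pE : (q ^+ M)%:P * (1 - 'X) * r = \sum_(k < (2 * M).+1) (c k)%:P * 'X^k.
  have prodE (F : nat -> {poly series R}) : \prod_(j < 2 * M) F j =
      (\prod_(j < M) F j) * (F M * \prod_(i < m) F (M + i.+1)%N).
    have -> : (2 * M = M + m.+1)%N by rewrite /M; lia.
    rewrite big_split_ord; congr (_ * _); rewrite big_ord_recl /= addn0.
    by [].
  have := q_binomial q%:P (- 'X) (q ^+ M)%:P (2 * M).
  rewrite (prodE (fun j => (q ^+ M)%:P + - 'X * q%:P ^+ j)).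
  under eq_bigr do rewrite mulNr -polyC_exp.
  under [X in _ * (_ * X) = _]eq_bigr do rewrite mulNr -polyC_exp.
  rewrite mulNr -polyC_exp => pE; transitivity (\sum_(k < (2 * M).+1) gauss q%:P (2 * M) k *
     (q%:P ^+ 'C(k, 2) * (- 'X) ^+ k * (q ^+ M)%:P ^+ (2 * M - k))).
    by rewrite -pE rE; ring.
  apply: eq_bigr => k _.
  rewrite -(rmorph_gauss (@polyC (series R))) exprNn /c -!polyC_exp.
  have -> : (-1) ^+ k = ((-1) ^+ k)%:P :> {poly series R} by rewrite polyC_exp polyCN.
  by rewrite !polyCM; ring.
have c0 : \sum_(k < (2 * M).+1) c k = 0.
  have := congr1 (fun p => p.[1]) pE.
  rewrite !hornerE subrr !(mulr0, mul0r) horner_sum => c0; apply: etrans _ (esym c0).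
  by apply: eq_bigr => k _; rewrite !hornerE expr1n mulr1.
have c1 : - (q ^+ M) * r.[1] = \sum_(k < (2 * M).+1) c k *+ k.
  have := congr1 (fun p => (p^`()).[1]) pE.
  rewrite derivM !hornerE derivM derivB derivX derivC (derivC (1 : series R)).
  rewrite !hornerE subrr mulr0 !(mul0r, add0r, sub0r, addr0) mulrN1 => ->.
  rewrite raddf_sum horner_sum; apply: eq_bigr => k _.
  by rewrite /= mul_polyC derivZ derivXn hornerZ hornerMn hornerXn expr1n mulr_natr.
have r1 : r.[1] = (-1) ^+ M * q ^+ ('C(M, 2) + M * m) * (qfact q M * qfact q m).
  rewrite rE hornerM !horner_prod.
  have -> : \prod_(j < M) ((q ^+ M)%:P - 'X * (q ^+ j)%:P).[1] =
      (-1) ^+ M * q ^+ 'C(M, 2) * qfact q M.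
    rewrite /qfact [in RHS](reindex_inj rev_ord_inj) /=.
    have -> : (-1) ^+ M * q ^+ 'C(M, 2) = \prod_(j < M) (- q ^+ j).
      elim: M {E c r rE pE c0 c1} => [|k IHk]; first by rewrite big_ord0 !expr0 mulr1.
      by rewrite big_ord_recr /= -IHk binS bin1 exprSr exprD; ring.
    rewrite -big_split; apply: eq_bigr => j _; rewrite !hornerE /=.
    rewrite subnSK // mulrBr mulr1 mulNr -exprD subnKC ?opprK 1?addrC //.
    exact: ltnW.
  have -> : \prod_(i < m) ((q ^+ M)%:P - 'X * (q ^+ (M + i.+1))%:P).[1] =
      q ^+ (M * m) * qfact q m.
    have -> : q ^+ (M * m) = \prod_(i < m) q ^+ M by rewrite prodr_const card_ord exprM.
    rewrite -big_split; apply: eq_bigr => i _; rewrite !hornerE /=.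
    by rewrite exprD mulrBr mulr1.
  by rewrite exprD; ring.
have EE : E = (M + ('C(M, 2) + M * m))%N by rewrite /E /M; lia.
(* As the [c k] sum to 0, the weight [k] produced by the derivative may be recentred to [k - M], in
   accordance with the exponents. *)
have c01 : \sum_(k < (2 * M).+1) c k *+ k = \sum_(k < (2 * M).+1) c k * (k%:Z - M%:Z)%:~R.
  have intE (k : nat) : (k%:Z - M%:Z)%:~R = k%:R - M%:R :> series R by rewrite rmorphB.
  under [RHS]eq_bigr => k _ do rewrite intE mulrBr.
  by rewrite sumrB -mulr_suml c0 mul0r subr0; under eq_bigr do rewrite -mulr_natr.
have MM : (-1) ^+ M * (-1) ^+ M = 1 :> series R by rewrite -exprMn mulrNN mulr1 expr1n.
apply: (@qX_lreg _ E); rewrite mulr_sumr.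
transitivity ((-1) ^+ M * (- (q ^+ M) * r.[1])).
  transitivity ((-1) ^+ M * (-1) ^+ M * (q ^+ E * - (qfact q M * qfact q m))).
    by rewrite MM mul1r.
  by rewrite r1 EE !exprD; ring.
rewrite c1 c01 mulr_sumr; apply: eq_bigr => k _; rewrite /c.
have sE : (-1) ^+ k = (-1) ^+ M * const (sgn (k%:Z - M%:Z)) :> series R.
  rewrite /sgn rmorphXn rmorphN rmorph1 -exprD -signr_odd -[RHS]signr_odd.
  by congr ((-1) ^+ nat_of_bool _); lia.
have key : q ^+ 'C(k, 2) * (q ^+ M) ^+ (2 * M - k) = q ^+ E * q ^+ absz (theta_exp 1 0 (k%:Z - M%:Z)).
  rewrite -exprM -!exprD; congr (_ ^+ _).
  have := @theta_exp_shift 1 0 M k isT isT; rewrite !mul1n mul0n addn0 /E.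
  by move=> <- //; rewrite -ltnS.
transitivity (((-1) ^+ M * (-1) ^+ M) * (gauss q (2 * M) k *
   (const (sgn (k%:Z - M%:Z)) * (k%:Z - M%:Z)%:~R) *
   (q ^+ 'C(k, 2) * (q ^+ M) ^+ (2 * M - k)))).
  by rewrite sE; ring.
by rewrite MM mul1r key rmorphM rmorph_int; ring.
Qed.

(** The limit of [finite_cube]. Pairing n with 1 - n gives the usual form, the sum over k >= 0 of
    (-1)^k (2k+1) q^(k(k+1)/2). *)
Theorem eta_cube :
  eta R 1 ^+ 3 = - lat (fun n : int => sgn n * n%:~R) (theta_exp 1 0).
Proof.
apply: eqmP => N; rewrite -[X in eqm _ X _]opprK; apply: eqmN; apply: eqm_sym.
have N2 : (2 * N + 2 <= (2 * N + 1).+1)%N by lia.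
apply: eqm_trans (lat_gauss_limit _ (ltn0Sn 0) _ _ N2) _.
- exact: theta_exp_ge0.
- exact: theta_exp_ge.
rewrite expr1 -finite_cube !mulrN; apply: eqmN.
rewrite exprS expr2; apply: eqmM => //.
have := @eqm_qfact_eta R 1; rewrite expr1 => qe.
by apply: eqmM; apply: eqm_sym; apply: qe => //; lia.
Qed.

End JacobiCube.

(** Doubling removes the division in [tri], so that equalities of exponents become polynomial
    identities. *)
Lemma theta_exp2 A B n : 2 * theta_exp A B n = A%:Z * (n * (n - 1)) + 2 * (B%:Z * n).
Proof. by rewrite theta_exp.unlock mulrDr mulrCA tri2. Qed.

Ltac double_theta :=
  apply: (@mulfI _ (2 : int)) => //; rewrite /= ?mulrDr ?theta_exp2 /bump /=; ring.

(** * Rearrangements of theta series *)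

Section LatticeIdentities.
Variable R : comNzRingType.
Implicit Types eps : R.

Lemma sign_parity eps (a b : int) : eps * eps = 1 ->
  odd (absz a) = odd (absz b) -> eps ^+ absz a = eps ^+ absz b.
Proof.
move=> eps2 ab; have epsE n : eps ^+ n = eps ^+ odd n.
  by rewrite -{1}[n]odd_double_half exprD -mul2n exprM expr2 eps2 expr1n mulr1.
by rewrite epsE ab -epsE.
Qed.

Lemma eq_lat (I : choiceType) (w w' : I -> R) (e e' : I -> int) :
  w =1 w' -> e =1 e' -> lat w e = lat w' e'.
Proof. by move=> /funext -> /funext ->. Qed.

(* The Gaussian integers modulo [2 + i]. *)
Let gauss5 (p : 'I_5 * (int * int)) : int * int :=
  (p.2.2 - 2 * p.2.1 + (p.1 : nat)%:Z, 2 * p.2.2 + p.2.1).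

Let gauss5_bij : bijective gauss5.
Proof.
(* On the image of [(r, (m, n))] this form takes the value 5 n + r, so a division by 5 recovers [r]
   and [n]. *)
pose s (p : int * int) := p.1 + 2 * p.2.
pose g (p : int * int) : 'I_5 * (int * int) :=
  (inord (absz (s p %% 5)%Z), (p.2 - 2 * (s p %/ 5)%Z, (s p %/ 5)%Z)).
exists g => [[r [m n]]|[x y]]; rewrite /g /gauss5 /s /=.
  have r5 := ltn_ord r.
  have -> : n - 2 * m + (r : nat)%:Z + 2 * (2 * n + m) = n * 5 + (r : nat)%:Z by lia.
  have -> : ((n * 5 + (r : nat)%:Z) %/ 5)%Z = n by lia.
  have -> : ((n * 5 + (r : nat)%:Z) %% 5)%Z = r by lia.
  congr (_, (_, _)); last by lia.
  by apply: val_inj; rewrite /= inordK.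
have ltr : (absz ((x + 2 * y)%R %% 5)%Z < 5)%N by lia.
rewrite inordK //; congr (_, _); lia.
Qed.

Lemma lat_gauss5 (w : int * int -> R) (e : int * int -> int) : summable e ->
  lat w e = \sum_(r < 5) lat (fun p => w (gauss5 (r, p))) (fun p => e (gauss5 (r, p))).
Proof.
move=> se; rewrite -(lat_reindex w e gauss5_bij) lat_split //.
exact/summable_reindex/bij_inj/gauss5_bij.
Qed.

Lemma bij_pair (f g : int -> int) : bijective f -> bijective g ->
  bijective (fun p : int * int => (f p.1, g p.2)).
Proof.
case=> f' fK f'K [g' gK g'K]; exists (fun p : int * int => (f' p.1, g' p.2)).
  by case=> x y /=; rewrite fK gK.
by case=> x y /=; rewrite f'K g'K.
Qed.

Lemma bij_shift (c : int) : bijective (fun n : int => n + c).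
Proof. by exists (fun n => n - c) => n; lia. Qed.
Lemma bij_reflect (c : int) : bijective (fun n : int => c - n).
Proof. by exists (fun n => c - n) => n; lia. Qed.

Lemma bij_swap (f g : int -> int) : bijective f -> bijective g ->
  bijective (fun p : int * int => (f p.2, g p.1)).
Proof.
case=> f' fK f'K [g' gK g'K]; exists (fun p : int * int => (g' p.2, f' p.1)).
  by case=> x y /=; rewrite fK gK.
by case=> x y /=; rewrite f'K g'K.
Qed.

Lemma lat_bij (I J : choiceType) (h : I -> J) w e w' e' : bijective h ->
  (forall i, w i = w' (h i)) -> (forall i, e i = e' (h i)) ->
  lat w e = lat w' e' :> series R.
Proof. by move=> hB ww ee; rewrite -(lat_reindex w' e' hB); apply: eq_lat. Qed.

Definition triangular : series R := theta 1 1 0.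

Lemma thetaM eps A B C D : (0 < A)%N -> (B <= A)%N -> (0 < C)%N -> (D <= C)%N ->
  theta eps A B * theta eps C D =
  lat (fun p : int * int => eps ^+ absz p.1 * eps ^+ absz p.2)
      (fun p : int * int => theta_exp A B p.1 + theta_exp C D p.2).
Proof. by move=> *; rewrite theta.unlock latM //; apply: summable_theta. Qed.

Lemma summable_theta2 A B C D : (0 < A)%N -> (B <= A)%N -> (0 < C)%N -> (D <= C)%N ->
  summable (fun p : int * int => theta_exp A B p.1 + theta_exp C D p.2).
Proof. by move=> *; apply: summable_pair; apply: summable_theta. Qed.

Lemma summable_shift (n : nat) (I : choiceType) (e : I -> int) :
  summable e -> summable (fun i => n%:Z + e i).
Proof.
move=> se; split=> [i|N]; first by rewrite addr_ge0 ?se.1.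
by apply: sub_finite_set (se.2 N) => i /=; lia.
Qed.

(** The quadratic form is centred at (1/2, 1/2). The class [r = 4], made of the multiples of the
    modulus relative to this centre, reproduces the whole sum at q^5; quarter turns about the centre
    permute the other four classes, so each of them equals [G]. *)
Lemma triangular_square :
  triangular ^+ 2 = qX * dil 5 triangular ^+ 2 + 4%:R * G R.
Proof.
have bid : bijective (fun n : int => n) by exists id.
rewrite /triangular dil_theta // !expr2 !thetaM // lat_gauss5; last exact: summable_theta2.
have gE r (h : int * int -> int * int) : bijective h ->
    (forall p, theta_exp 1 0 (gauss5 (r, p)).1 + theta_exp 1 0 (gauss5 (r, p)).2
       = theta_exp 5 1 (h p).1 + theta_exp 5 2 (h p).2) ->
    lat (fun p => 1 ^+ absz (gauss5 (r, p)).1 * 1 ^+ absz (gauss5 (r, p)).2)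
      (fun p => theta_exp 1 0 (gauss5 (r, p)).1 + theta_exp 1 0 (gauss5 (r, p)).2) = G R.
  move=> hB he; rewrite /G thetaM //.
  by apply: (lat_bij hB) => p; [rewrite !expr1n | exact: he].
rewrite 5!big_ord_recl big_ord0 addr0.
have bx := bij_reflect; have bs := bij_shift.
rewrite (gE _ _ (bij_swap bid (bx 0))) => [|[m n]]; last by double_theta.
rewrite (gE _ _ (bij_pair bid bid)) => [|[m n]]; last by double_theta.
rewrite (gE _ _ (bij_pair (bx 1) (bx 0))) => [|[m n]]; last by double_theta.
rewrite (gE _ _ (bij_swap (bx 0) (bs (-1)))) => [|[m n]]; last by double_theta.
have -> : forall f g : series R, g + (g + (g + (g + f))) = f + 4%:R * g.
  by move=> f g; ring.
congr (_ + _); rewrite -[qX]expr1 -lat_qX; last exact: summable_theta2.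
apply: (lat_bij (bij_swap (bs 1) (bs (-1)))) => -[m n]; last by double_theta.
by rewrite !expr1n.
Qed.

(** The same dissection for x^2 + y^2, now centred at the origin: the class [r = 0] reproduces the
    sum, and each of the other four gives q [H] with one additional sign. *)
Lemma phi_square eps : eps * eps = 1 ->
  phi eps ^+ 2 = dil 5 (phi eps) ^+ 2 + 4%:R * (const eps * (qX * H eps)).
Proof.
move=> eps2; have bx := bij_reflect; have bs := bij_shift.
have bid : bijective (fun n : int => n) by exists id.
rewrite /phi dil_theta // !expr2 !thetaM // lat_gauss5; last exact: summable_theta2.
have gE r (h : int * int -> int * int) : bijective h ->
    (forall p, odd (absz (gauss5 (r, p)).1 + absz (gauss5 (r, p)).2) =
       odd (1 + absz (h p).1 + absz (h p).2)) ->
    (forall p, theta_exp 2 1 (gauss5 (r, p)).1 + theta_exp 2 1 (gauss5 (r, p)).2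
       = 1 + (theta_exp 10 1 (h p).1 + theta_exp 10 3 (h p).2)) ->
    lat (fun p => eps ^+ absz (gauss5 (r, p)).1 * eps ^+ absz (gauss5 (r, p)).2)
      (fun p => theta_exp 2 1 (gauss5 (r, p)).1 + theta_exp 2 1 (gauss5 (r, p)).2)
      = const eps * (qX * H eps).
  move=> hB hs he; rewrite /H thetaM // -[qX]expr1 -lat_qX; last exact: summable_theta2.
  rewrite -lat_const; last by apply: (@summable_shift 1); exact: summable_theta2.
  apply: (lat_bij hB) => p; last exact: he.
  rewrite -!exprD -exprS; have := @sign_parity eps (absz (gauss5 (r, p)).1 + absz (gauss5 (r, p)).2)%N
    (1 + absz (h p).1 + absz (h p).2)%N eps2 (hs p).
  by rewrite /= add1n.
rewrite 5!big_ord_recl big_ord0 addr0.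
rewrite (gE (lift ord0 ord0) _ (bij_pair bid (bx 0))); first last.
- by case=> m n; double_theta.
- by case=> m n /=; rewrite /bump /=; lia.
rewrite (gE (lift ord0 (lift ord0 ord0)) _ (bij_swap (bx 0) (bx 1))); first last.
- by case=> m n; double_theta.
- by case=> m n /=; rewrite /bump /=; lia.
rewrite (gE (lift ord0 (lift ord0 (lift ord0 ord0))) _ (bij_swap (bs 1) (bs (-1)))); first last.
- by case=> m n; double_theta.
- by case=> m n /=; rewrite /bump /=; lia.
rewrite (gE (lift ord0 (lift ord0 (lift ord0 (lift ord0 ord0)))) _ (bij_pair (bx 2) (bs 1))); first last.
- by case=> m n; double_theta.
- by case=> m n /=; rewrite /bump /=; lia.
have -> : forall f g : series R, f + (g + (g + (g + g))) = f + 4%:R * g.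
  by move=> f g; ring.
congr (_ + _).
apply: (lat_bij (bij_swap bid bid)) => -[m n]; last by double_theta.
rewrite -!exprD; apply: (@sign_parity eps (_ + _)%N (_ + _)%N eps2) => /=; lia.
Qed.

Let halves (p : bool * int) : int := if p.1 then 2 * p.2 else 1 - 2 * p.2.

Let halves_bij : bijective halves.
Proof.
pose g (n : int) : bool * int :=
  if (n %% 2)%Z == 0 then (true, (n %/ 2)%Z) else (false, ((1 - n) %/ 2)%Z).
exists g => [[b k]|n]; rewrite /g /halves /=.
  case: b; case: ifP => /eqP ? /=; try lia; congr (_, _); lia.
by case: eqP => ? /=; lia.
Qed.

(** The reflection of n to 1 - n preserves [tri] and exchanges even and odd indices; each half is a
    copy of psi. *)
Lemma triangular_psi : triangular = 2%:R * psi R.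
Proof.
rewrite /triangular /psi theta.unlock -(lat_reindex _ _ halves_bij) lat_split; last first.
  exact: (summable_reindex (summable_theta _ _) (bij_inj halves_bij)).
rewrite big_bool /= mulr_natl mulr2n.
by congr (_ + _); apply: eq_lat => k; rewrite ?expr1n // /halves; double_theta.
Qed.

(** An odd square is 1 plus 8 times a triangular number, each of which arises twice; even squares
    carry no sign. *)
Lemma phi_even_odd eps : eps * eps = 1 ->
  phi eps = dil 4 (phi 1) + 2%:R * (const eps * qX * dil 8 (psi R)).
Proof.
pose h (p : bool * int) : int := if p.1 then 2 * p.2 else 2 * p.2 - 1.
have hB : bijective h.
  pose g (n : int) : bool * int :=
    if (n %% 2)%Z == 0 then (true, (n %/ 2)%Z) else (false, ((1 + n) %/ 2)%Z).
  exists g => [[b k]|n]; rewrite /g /h /=.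
    case: b; case: ifP => /eqP ? /=; try lia; congr (_, _); lia.
  by case: eqP => ? /=; lia.
move=> eps2; have -> : 2%:R * (const eps * qX * dil 8 (psi R)) = const eps * qX * dil 8 triangular.
  rewrite triangular_psi rmorphM rmorph_nat; ring.
rewrite /phi /triangular !dil_theta // theta.unlock -(lat_reindex _ _ hB) lat_split; last first.
  exact: (summable_reindex (summable_theta _ _) (bij_inj hB)).
rewrite big_bool /=; congr (_ + _).
  apply: eq_lat => k; rewrite /h /=; last by double_theta.
  by rewrite expr1n -[RHS](expr0 eps); apply: (@sign_parity eps _ 0 eps2); lia.
rewrite -mulrA -[qX]expr1 -lat_qX; last exact: summable_theta.
rewrite -lat_const; last by apply: (@summable_shift 1); exact: summable_theta.
apply: eq_lat => k; rewrite /h /=; last by double_theta.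
by rewrite expr1n mulr1 -[RHS]expr1; apply: (@sign_parity eps _ 1 eps2); lia.
Qed.

Let fifths (p : 'I_5 * int) : int := 5 * p.2 + (p.1 : nat)%:Z.

Let fifths_bij : bijective fifths.
Proof.
exists (fun n : int => (inord (absz (n %% 5)%Z) : 'I_5, (n %/ 5)%Z)) => [[r k]|n] /=; last first.
  by rewrite /fifths /= inordK; lia.
have r5 := ltn_ord r; rewrite /fifths /=.
have -> : ((5 * k + (r : nat)%:Z) %/ 5)%Z = k by lia.
have -> : ((5 * k + (r : nat)%:Z) %% 5)%Z = r by lia.
by congr (_, _); apply: val_inj; rewrite /= inordK.
Qed.

Lemma theta_fifths eps A B : (0 < A)%N -> (B <= A)%N ->
  theta eps A B = \sum_(r < 5) lat (fun k : int => eps ^+ absz (5 * k + (r : nat)%:Z))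
    (fun k => theta_exp A B (5 * k + (r : nat)%:Z)).
Proof.
move=> A0 BA; have se := summable_theta A0 BA.
rewrite theta.unlock -(lat_reindex _ _ fifths_bij) lat_split //.
exact: (summable_reindex se (bij_inj fifths_bij)).
Qed.
End LatticeIdentities.

(** * Five-dissection of the eta product *)

Section Classes.
Variables (R : comNzRingType) (m : nat).
Implicit Types (f g : series R) (a b c : nat).

Definition in_class c f := forall n, (n %% m != c %% m)%N -> coef f n = 0.

Lemma in_class_eq a b f : (a %% m = b %% m)%N -> in_class a f -> in_class b f.
Proof. by move=> ab fa n nb; apply: fa; rewrite ab. Qed.

Lemma in_classD c f g : in_class c f -> in_class c g -> in_class c (f + g).
Proof. by move=> fc gc n nc; rewrite coefD_series fc ?gc ?addr0. Qed.

Lemma in_classN c f : in_class c f -> in_class c (- f).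
Proof. by move=> fc n nc; rewrite coefN_series fc ?oppr0. Qed.

Lemma in_classM a b f g : in_class a f -> in_class b g -> in_class (a + b) (f * g).
Proof.
move=> fa gb n nab; rewrite coefM_series big1 // => i _.
have [ia|/fa ->] := eqVneq (i %% m)%N (a %% m)%N; last by rewrite mul0r.
have [ib|/gb ->] := eqVneq ((n - i) %% m)%N (b %% m)%N; last by rewrite mulr0.
case/negP: nab; have -> : n = (i + (n - i))%N by rewrite subnKC // -ltnS.
by rewrite -modnDm ia ib modnDm.
Qed.

Lemma in_class_const x : in_class 0 (const x : series R).
Proof. by move=> [|n] //; rewrite mod0n eqxx. Qed.

Lemma in_classX k c f : in_class c f -> in_class (k * c) (f ^+ k).
Proof.
move=> fc; elim: k => [|k IHk]; first by rewrite expr0 -(rmorph1 (@const R)); apply: in_class_const.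
by rewrite exprS mulSn; apply: in_classM.
Qed.

Lemma in_class_qX : in_class 1 (qX : series R).
Proof. by move=> n n1 /=; have [n1E|//] := eqVneq n 1%N; rewrite n1E eqxx in n1. Qed.

Lemma in_class_dil k f : (m %| k)%N -> (0 < k)%N -> in_class 0 (dil k f).
Proof.
move=> mk k0 n nk /=; case: ifP => // kn; case/negP: nk.
by rewrite mod0n; apply: dvdn_trans kn.
Qed.

Lemma in_class_lat (I : choiceType) (w : I -> R) e c :
  (forall i, exists t, e i = m%:Z * t + c%:Z) -> in_class c (lat w e).
Proof.
move=> et n nc /=; rewrite fsbig1 // => i /= ei; have [t] := et i; rewrite ei => nE.
case/eqP: nc; apply/eqP; rewrite -eqz_nat -!modz_nat nE.
by rewrite mulrC modzMDl.
Qed.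

Definition part_of c f : series R :=
  Series (fun n => if (n %% m == c %% m)%N then coef f n else 0).

Let part_of_is_zmod c : zmod_morphism (part_of c).
Proof. by move=> f g; apply: seriesP => n /=; case: ifP; rewrite ?subr0. Qed.
HB.instance Definition _ c :=
  GRing.isZmodMorphism.Build (series R) (series R) (part_of c) (part_of_is_zmod c).

Lemma part_of_id c f : in_class c f -> part_of c f = f.
Proof. by move=> fc; apply: seriesP => n /=; case: eqP => // /eqP /fc ->. Qed.

Lemma part_of_out b c f : (b %% m != c %% m)%N -> in_class b f -> part_of c f = 0.
Proof.
move=> bc fb; apply: seriesP => n /=; case: eqP => // nc.
by rewrite fb // nc eq_sym.
Qed.

End Classes.

Section PeriodicTwist.
Variables (R : comNzRingType) (m : nat) (chi : nat -> R).
Hypothesis chi_mod : forall n, chi (n %% m)%N = chi n.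
Implicit Types f g : series R.

Definition twist f : series R := Series (fun n => chi n * coef f n).

Let twist_is_zmod : zmod_morphism twist.
Proof. by move=> f g; apply: seriesP => n /=; rewrite mulrBr. Qed.
HB.instance Definition _ :=
  GRing.isZmodMorphism.Build (series R) (series R) twist twist_is_zmod.

Lemma twist_class c f : in_class m c f -> twist f = const (chi c) * f.
Proof.
move=> fc; apply: seriesP => n; rewrite coef_constM /=.
case: (eqVneq (n %% m)%N (c %% m)%N) => [nc|/fc ->]; last by rewrite !mulr0.
by rewrite -chi_mod nc chi_mod.
Qed.

(** A periodic twist is linear over series in q^m, which lets eta products at multiples of m pass
    through it. *)
Lemma twistMr f g : in_class m 0 g -> twist (f * g) = twist f * g.
Proof.
move=> g0; apply: seriesP => n; rewrite coefM_series /= mulr_sumr.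
apply: eq_bigr => i _; rewrite mulrA.
case: (eqVneq ((n - i) %% m)%N (0 %% m)%N) => [ni|/g0 ->]; last by rewrite !mulr0.
have -> // : chi n = chi i.
rewrite -chi_mod -[RHS]chi_mod; congr chi.
have nE : n = (i + (n - i))%N by rewrite subnKC // -ltnS.
by rewrite [LHS](congr1 (modn^~ m) nE) -modnDmr ni mod0n addn0.
Qed.
End PeriodicTwist.

Lemma part_ofMr (R : comNzRingType) m c (f g : series R) :
  in_class m 0 g -> part_of m c (f * g) = part_of m c f * g.
Proof.
pose chi n : R := (n %% m == c %% m)%N%:R.
have pE h : part_of m c h = twist chi h.
  by apply: seriesP => n /=; rewrite /chi; case: eqP; rewrite ?mul1r ?mul0r.
by move=> g0; rewrite !pE (@twistMr _ m) // => n; rewrite /chi modn_mod.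
Qed.

Section FiveDissection.
Local Notation e := (eta int).
Let N1 : (-1) * (-1) = 1 :> int. Proof. by []. Qed.

Lemma theta31_fifths r k :
  theta_exp 3 1 (5 * k + r%:Z) = 5 * theta_exp 15 (3 * r + 7) k + (3 * 'C(r, 2) + r)%N%:Z.
Proof.
apply: (@mulfI _ (2 : int)) => //; rewrite mulrDr mulrCA !theta_exp2.
have -> : (3 * 'C(r, 2) + r)%N%:Z = 3 * tri r%:Z + r%:Z by rewrite tri_bin; lia.
have -> : (3 * r + 7)%N%:Z = 3 * r%:Z + 7 by lia.
by rewrite [2 * (_ + _)]mulrDr (mulrCA 2 3) tri2; ring.
Qed.

Lemma theta10_fifths r k :
  theta_exp 1 0 (5 * k + r%:Z) = 5 * theta_exp 5 (r + 2) k + 'C(r, 2)%:Z.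
Proof.
apply: (@mulfI _ (2 : int)) => //; rewrite mulrDr mulrCA !theta_exp2.
have -> : (r + 2)%N%:Z = r%:Z + 2 by lia.
by rewrite -tri_bin tri2; ring.
Qed.

(** The exponents 3 r(r-1)/2 + r for r < 5 are 0, 1, 5, 12, 22, in the classes 0, 1, 0, 2, 2 modulo
    5. The only one in class 1 carries a pentagonal series again, at q^25. *)
Lemma eta_five_dissection : exists P Q : series int,
  [/\ in_class 5 0 P, in_class 5 2 Q & e 1 = P - qX * e 25 + Q].
Proof.
pose L r : series int := lat (fun k : int => (-1) ^+ absz (5 * k + r%:Z))
    (fun k => theta_exp 3 1 (5 * k + r%:Z)).
have Lc r : in_class 5 (3 * 'C(r, 2) + r) (L r).
  by apply: in_class_lat => k; exists (theta_exp 15 (3 * r + 7) k); rewrite theta31_fifths.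
have L1 : L 1%N = - (qX * e 25).
  have -> : e 25 = dil 25 (e 1) by rewrite dil_eta.
  have cN : const (-1) = -1 :> series int by rewrite rmorphN rmorph1.
  transitivity (const (-1) * (qX * dil 25 (e 1))); last by rewrite cN mulN1r.
  rewrite -eta_pentagonal dil_theta //.
  rewrite -[qX]expr1 theta.unlock -lat_qX; last exact: summable_theta.
  rewrite -lat_const; last by apply: (@summable_shift 1); exact: summable_theta.
  apply: (lat_bij (bij_reflect 0)) => k /=; last by double_theta.
  rewrite -exprS; apply: (@sign_parity _ (-1) (5 * k + 1) (absz (0 - k)).+1%:Z N1); lia.
exists (L 0%N + L 2), (L 3 + L 4); split.
- by apply: in_classD; [exact: (Lc 0%N) | apply: in_class_eq (Lc 2)].
- by apply: in_classD; [apply: in_class_eq (Lc 3) | apply: in_class_eq (Lc 4)].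
rewrite -eta_pentagonal theta_fifths // -L1 5!big_ord_recl big_ord0 addr0.
by rewrite -/(L 0%N) -/(L 1%N) -/(L 2) -/(L 3) -/(L 4); ring.
Qed.

End FiveDissection.

(** * Norms over the fifth roots of unity *)

Section FifthRoots.
Variables (S : comNzRingType) (z : S).
Hypotheses (z5 : z ^+ 5 = 1) (z_sum : 1 + z + z ^+ 2 + z ^+ 3 + z ^+ 4 = 0).

(** The Gaussian periods, roots of t^2 + t - 1. Factors at inverse roots pair into polynomials in
    [a] or in [b], and the product over both pairs involves only their sum and product. *)
Let a := z + z ^+ 4.
Let b := z ^+ 2 + z ^+ 3.
Let ab_sum : a + b = -1.
Proof.
rewrite -[LHS]addr0 -[0 in LHS](subrr 1) addrCA -[RHS]addr0 -[0 in RHS]z_sum /a /b; ring.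
Qed.
Let ab_prod : a * b = -1.
Proof.
have z6 : z ^+ 6 = z by rewrite exprS z5 mulr1.
have z7 : z ^+ 7 = z ^+ 2 by rewrite exprS z6 expr2.
rewrite -ab_sum; transitivity (z ^+ 3 + z ^+ 4 + z ^+ 6 + z ^+ 7); first by rewrite /a /b; ring.
by rewrite z6 z7 /a /b; ring.
Qed.

(* The norm of [p - w + s] for the automorphisms acting on the three terms by
   the characters [0], [1], [2] of Z/5. *)
Lemma five_norm (p w s : S) : p * s = - w ^+ 2 ->
  \prod_(k < 5) (p - z ^+ k * w + z ^+ (2 * k) * s) = p ^+ 5 - 11%:R * w ^+ 5 + s ^+ 5.
Proof.
move=> psw; rewrite 5!big_ord_recr big_ord0 /=.
have z6 : z ^+ 6 = z by rewrite exprS z5 mulr1.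
have z7 : z ^+ 7 = z ^+ 2 by rewrite exprS z6 expr2.
have z8 : z ^+ 8 = z ^+ 3 by rewrite exprS z7 -exprS.
have z10 : z ^+ 10 = 1 by rewrite (exprM z 5 2) z5 expr1n.
pose U := p ^+ 2 + w ^+ 2 + s ^+ 2; pose V := p * w + w * s; pose T := p * s.
have e14 : (p - z * w + z ^+ 2 * s) * (p - z ^+ 4 * w + z ^+ 8 * s) = U - a * V + b * T.
  transitivity (p ^+ 2 + z ^+ 5 * w ^+ 2 + z ^+ 10 * s ^+ 2 - (z + z ^+ 4) * (p * w)
    + (z ^+ 2 + z ^+ 8) * (p * s) - (z ^+ 6 + z ^+ 9) * (w * s)); first by ring.
  have z9 : z ^+ 9 = z ^+ 4 by rewrite exprS z8 -exprS.
  by rewrite z5 z6 z8 z9 z10 /U /V /T /a /b; ring.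
have e23 : (p - z ^+ 2 * w + z ^+ 4 * s) * (p - z ^+ 3 * w + z ^+ 6 * s) = U - b * V + a * T.
  transitivity (p ^+ 2 + z ^+ 5 * w ^+ 2 + z ^+ 10 * s ^+ 2 - (z ^+ 2 + z ^+ 3) * (p * w)
    + (z ^+ 4 + z ^+ 6) * (p * s) - (z ^+ 7 + z ^+ 8) * (w * s)); first by ring.
  by rewrite z5 z6 z7 z8 z10 /U /V /T /a /b; ring.
have -> : 1 * (p - z ^+ 0 * w + z ^+ (2 * 0) * s) * (p - z ^+ 1 * w + z ^+ (2 * 1) * s)
   * (p - z ^+ 2 * w + z ^+ (2 * 2) * s) * (p - z ^+ 3 * w + z ^+ (2 * 3) * s)
   * (p - z ^+ 4 * w + z ^+ (2 * 4) * s) =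
   (p - w + s) * ((p - z * w + z ^+ 2 * s) * (p - z ^+ 4 * w + z ^+ 8 * s)) *
   ((p - z ^+ 2 * w + z ^+ 4 * s) * (p - z ^+ 3 * w + z ^+ 6 * s)) by ring.
rewrite e14 e23.
have UVT : (U - a * V + b * T) * (U - b * V + a * T) =
    U ^+ 2 - V ^+ 2 - T ^+ 2 + U * V - U * T - 3%:R * V * T.
  transitivity (U ^+ 2 + a * b * (V ^+ 2 + T ^+ 2) + (a + b) * (U * T - U * V)
    - ((a + b) ^+ 2 - 2%:R * (a * b)) * (V * T)); first by ring.
  by rewrite ab_sum ab_prod; ring.
rewrite -mulrA UVT; apply/eqP; rewrite -subr_eq0; apply/eqP.
(* The identity fails without the hypothesis on p s; the defect is this multiple of p s + w^2. *)
transitivity ((p * s + w ^+ 2) * (10%:R * w ^+ 3 - 5%:R * p * w * s)).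
  by rewrite /U /V /T; ring.
by rewrite psw addNr mul0r.
Qed.

(** For [n] prime to 5, the powers z^(kn) run through the same five roots as the z^k. *)
Lemma prod_fifth_roots n x : ~~ (5 %| n)%N ->
  \prod_(k < 5) (1 - z ^+ (k * n) * x) = 1 - x ^+ 5.
Proof.
move=> n5; have zmod k : z ^+ k = z ^+ (k %% 5).
  by rewrite {1}(divn_eq k 5) mulnC exprD exprM z5 expr1n mul1r.
have base : (1 - x) * ((1 - z * x) * (1 - z ^+ 4 * x)) * ((1 - z ^+ 2 * x) * (1 - z ^+ 3 * x))
    = 1 - x ^+ 5.
  have -> : (1 - z * x) * (1 - z ^+ 4 * x) = 1 - a * x + x ^+ 2.
    by transitivity (1 - a * x + z ^+ 5 * x ^+ 2); [rewrite /a; ring | rewrite z5 mul1r].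
  have -> : (1 - z ^+ 2 * x) * (1 - z ^+ 3 * x) = 1 - b * x + x ^+ 2.
    by transitivity (1 - b * x + z ^+ 5 * x ^+ 2); [rewrite /b; ring | rewrite z5 mul1r].
  transitivity ((1 - x) * (1 - (a + b) * x + (2%:R + a * b) * x ^+ 2 - (a + b) * x ^+ 3 + x ^+ 4)).
    by ring.
  by rewrite ab_sum ab_prod; ring.
rewrite -base 5!big_ord_recr big_ord0 /= mul0n expr0 !mul1r mul1n.
rewrite [z ^+ n]zmod [z ^+ (2 * n)]zmod [z ^+ (3 * n)]zmod [z ^+ (4 * n)]zmod.
have : (n %% 5 < 5)%N by rewrite ltn_mod.
rewrite -(modnMmr 2) -(modnMmr 3) -(modnMmr 4).
case E : (n %% 5)%N => [|[|[|[|[|r]]]]] // _; first by move: n5; rewrite /dvdn E.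
all: rewrite /= ?expr1; ring.
Qed.

End FifthRoots.

Section EtaNorm.
Variables (R : comNzRingType) (z : R).
Hypotheses (z5 : z ^+ 5 = 1) (z_sum : 1 + z + z ^+ 2 + z ^+ 3 + z ^+ 4 = 0).
Local Notation e := (eta R).
Local Notation q := (qX : series R).

Lemma scal_class m c k (f : series R) : z ^+ m = 1 -> in_class m c f ->
  scal (z ^+ k) f = const z ^+ (k * c) * f.
Proof.
move=> zm fc; apply: seriesP => n; rewrite -rmorphXn coef_constM /=.
case: (eqVneq (n %% m)%N (c %% m)%N) => [nc|/fc ->]; last by rewrite !mulr0.
have zmod j : z ^+ j = z ^+ (j %% m).
  by rewrite {1}(divn_eq j m) mulnC exprD exprM zm expr1n mul1r.
by rewrite -exprM zmod [in RHS]zmod -modnMmr nc modnMmr.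
Qed.

(** The conjugates of 1 - q^j multiply to 1 - q^(5j) if 5 does not divide j, and to (1 - q^j)^5
    otherwise. The former contribute e_5 / e_25, the latter e_5^5. *)
Lemma eta_norm : (\prod_(k < 5) scal (z ^+ k) (e 1)) * e 25 = e 5 ^+ 6.
Proof.
pose F j : series R := if (5 %| j.+1)%N then (1 - q ^+ j.+1) ^+ 5 else 1 - q ^+ (5 * j.+1).
have cq A : (0 < A)%N -> convergent (fun j => 1 - q ^+ (A * j.+1)).
  exact: convergent_eta.
have scE c j : scal c (1 - q ^+ (1 * j.+1)) = 1 - const (c ^+ j.+1) * q ^+ j.+1.
  by rewrite mul1n rmorphB rmorph1 rmorphXn /= scal_qX exprMn rmorphXn.
have csc c : convergent (fun j => 1 - const (c ^+ j.+1) * q ^+ j.+1).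
  by move=> j; have := eqm_scal c (cq 1%N isT j); rewrite rmorph1 scE.
have cF : convergent F.
  move=> j; rewrite /F; case: ifP => _.
    have c1 := cq 1%N isT j; rewrite mul1n in c1.
    have c1n : eqm j.+1 ((1 - q ^+ j.+1) ^+ 5) (1 ^+ 5) by exact: eqmX.
    by rewrite expr1n in c1n.
  by apply: (eqm_le _ (cq 5 isT j)).
have -> : \prod_(k < 5) scal (z ^+ k) (e 1) = iprod F.
  transitivity (\prod_(k < 5) iprod (fun j => 1 - const ((z ^+ k) ^+ j.+1) * q ^+ j.+1)).
    apply: eq_bigr => k _; rewrite eta.unlock iprod_scal; last exact: (cq 1%N isT).
    by apply: eq_iprod => j; exact: scE.
  rewrite -(@iprod_prod R 5 (fun k j => 1 - const ((z ^+ k) ^+ j.+1) * q ^+ j.+1)) //.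
  apply: eq_iprod => j.
  have z'5 : const z ^+ 5 = 1 :> series R by rewrite -rmorphXn z5 rmorph1.
  have z'sum : 1 + const z + const z ^+ 2 + const z ^+ 3 + const z ^+ 4 = 0 :> series R.
    by rewrite -!rmorphXn -(rmorph1 (@const R)) -!rmorphD z_sum rmorph0.
  transitivity (\prod_(k < 5) (1 - const z ^+ (k * j.+1) * q ^+ j.+1)).
    by apply: eq_bigr => k _; rewrite -exprM rmorphXn.
  rewrite /F; case: ifP => j5; last by rewrite prod_fifth_roots ?j5 // -exprM mulnC.
  case/dvdnP: j5 => i ->.
  rewrite (eq_bigr (fun=> 1 - q ^+ (i * 5))) ?prodr_const ?card_ord // => k _.
  by rewrite mulnA [(_ * 5)%N]mulnC exprM z'5 expr1n mul1r.
have b5 (f : nat -> series R) i :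
    \prod_(r < 5) f (5 * i + r)%N = f (5 * i)%N * f (5 * i + 1)%N * f (5 * i + 2)%N
      * f (5 * i + 3)%N * f (5 * i + 4)%N.
  by rewrite 5!big_ord_recr big_ord0 /= mul1r addn0.
have c5 := cq 5 isT; have c25 := cq 25 isT; have p5 : (0 < 5)%N by [].
have e5E : e 5 = iprod (fun i => \prod_(r < 5) (1 - q ^+ (5 * (5 * i + r).+1))).
  by rewrite eta.unlock (iprod_block p5 c5).
have e55E : e 5 ^+ 5 = iprod (fun i => (1 - q ^+ (5 * i.+1)) ^+ 5).
  by rewrite eta.unlock iprodX.
have c55 : convergent (fun i => (1 - q ^+ (5 * i.+1)) ^+ 5).
  by move=> j; have := eqmX 5 (c5 j); rewrite expr1n.
rewrite exprSr e55E e5E [e 25](_ : _ = iprod (fun j => 1 - q ^+ (25 * j.+1))); last first.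
  by rewrite eta.unlock.
have cF5 := convergent_block p5 cF; have c5b := convergent_block p5 c5.
rewrite (iprod_block p5 cF) -!iprodM //.
apply: eq_iprod => i; rewrite b5 (b5 (fun j => 1 - q ^+ (5 * j.+1))).
have FE r : (r < 4)%N -> F (5 * i + r)%N = 1 - q ^+ (5 * (5 * i + r).+1).
  by move=> r4; rewrite /F ifF //; apply/negbTE; lia.
have F0 : F (5 * i)%N = 1 - q ^+ (5 * (5 * i).+1) by rewrite -[(5 * i)%N]addn0 FE.
have F4 : F (5 * i + 4)%N = (1 - q ^+ (5 * i.+1)) ^+ 5.
  have -> : (5 * i.+1 = (5 * i + 4).+1)%N by lia.
  by rewrite /F ifT //; lia.
rewrite F4 !FE // F0.
have -> : (25 * i.+1 = 5 * (5 * i + 4).+1)%N by lia.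
by ring.
Qed.
End EtaNorm.

(** * Quintic relations from the five-dissection *)

Section FiveDissectionRelations.
Local Notation e := (eta int).
Local Notation q := (qX : series int).
Local Notation w := (q * e 25).

Lemma eta_neq0 A : (0 < A)%N -> e A != 0.
Proof.
move=> A0; apply/eqP => eA; have := coef0_eta int A0.
by rewrite eA coef0_series.
Qed.

Lemma natr_series_neq0 n : (n.+1%:R : series int) != 0.
Proof.
apply/eqP => /(congr1 (fun f => coef f 0)).
by rewrite coefMn_series coef1_series coef0_series /= => /eqP; rewrite pnatr_eq0.
Qed.

Lemma in_class_w : in_class 5 1 w.
Proof.
rewrite -[1%N]/(1 + 0)%N; apply: in_classM; first exact: in_class_qX.
have -> : e 25 = dil 25 (e 1) by rewrite dil_eta.
exact: in_class_dil.
Qed.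

(** The exponents in Jacobi's identity are triangular numbers, which are 0, 1 or 3 modulo 5. *)
Lemma eta_cube_part : part_of 5 2 (e 1 ^+ 3) = 0.
Proof.
rewrite eta_cube; apply: seriesP => n; rewrite coef0_series /=; case: eqP => // n2.
rewrite fsbig1 ?oppr0 // => k /= kn; exfalso.
have kE : k = 5 * (k %/ 5)%Z + `|(k %% 5)%Z|%N%:Z by lia.
have := theta10_fifths `|(k %% 5)%Z|%N (k %/ 5)%Z; rewrite -kE kn.
have : (`|(k %% 5)%Z| < 5)%N by lia.
have bE : ('C(0, 2) = 0) * ('C(1, 2) = 0) * ('C(2, 2) = 1) * ('C(3, 2) = 3) * ('C(4, 2) = 6) by [].
by case: (`|(k %% 5)%Z|%N) => [|[|[|[|[|r]]]]] //= _; rewrite bE; lia.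
Qed.

Section Monomials.
Variables p u s : series int.
Hypotheses (p0 : in_class 5 0 p) (u1 : in_class 5 1 u) (s2 : in_class 5 2 s).

(** The three series have degrees 0, 1, 2 in the grading by Z/5, so residue parts and twists of a
    polynomial in them are read off from its exponents. *)
Let mono_class n i j k : in_class 5 (j + 2 * k) (n%:R * (p ^+ i * u ^+ j * s ^+ k)).
Proof.
have -> : (j + 2 * k = 0 + (i * 0 + j * 1 + k * 2))%N by lia.
apply: in_classM; last by do !apply: in_classM; apply: in_classX.
by rewrite -(rmorph_nat (@const int)); apply: in_class_const.
Qed.

Lemma part_monomial c n i j k :
  part_of 5 c (n%:R * (p ^+ i * u ^+ j * s ^+ k)) =
  if ((j + 2 * k) %% 5 == c %% 5)%N then n%:R * (p ^+ i * u ^+ j * s ^+ k) else 0.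
Proof.
case: eqP => jk; first by apply/part_of_id/(in_class_eq jk)/mono_class.
by apply: (@part_of_out _ _ (j + 2 * k)) => //; apply/eqP.
Qed.

Lemma twist_monomial (chi : nat -> int) n i j k :
  (forall n, chi (n %% 5)%N = chi n) ->
  twist chi (n%:R * (p ^+ i * u ^+ j * s ^+ k)) =
  const (chi ((j + 2 * k) %% 5)%N) * (n%:R * (p ^+ i * u ^+ j * s ^+ k)).
Proof. by move=> chi5; rewrite chi5; apply/(twist_class chi5)/mono_class. Qed.

End Monomials.

(** The part of (P - w + Q)^3 in class 2 is 3 P (P Q + w^2). It vanishes by [eta_cube_part], and P
    has constant term 1. *)
Lemma eta_five_dissection_prod : exists P Q : series int,
  [/\ in_class 5 0 P, in_class 5 2 Q, e 1 = P - w + Q & P * Q = - w ^+ 2].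
Proof.
have [P [Q [P0 Q2 eE]]] := eta_five_dissection; exists P, Q; split => //.
have w1 := in_class_w.
have cP0 : coef P 0 = 1.
  have := congr1 (fun f => coef f 0) eE; rewrite coef0_eta // !coefD_series coefN_series.
  by rewrite coef_qXM (Q2 0%N) // oppr0 !addr0.
have := eta_cube_part; rewrite eE; move: w w1 {eE} => u u1.
have -> : (P - u + Q) ^+ 3 =
     1%:R * (P ^+ 3 * u ^+ 0 * Q ^+ 0) - 3%:R * (P ^+ 2 * u ^+ 1 * Q ^+ 0)
   + 3%:R * (P ^+ 2 * u ^+ 0 * Q ^+ 1) + 3%:R * (P ^+ 1 * u ^+ 2 * Q ^+ 0)
   - 1%:R * (P ^+ 0 * u ^+ 3 * Q ^+ 0) - 6%:R * (P ^+ 1 * u ^+ 1 * Q ^+ 1)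
   + 3%:R * (P ^+ 1 * u ^+ 0 * Q ^+ 2) + 3%:R * (P ^+ 0 * u ^+ 2 * Q ^+ 1)
   - 3%:R * (P ^+ 0 * u ^+ 1 * Q ^+ 2) + 1%:R * (P ^+ 0 * u ^+ 0 * Q ^+ 3) by ring.
rewrite !(raddfD, raddfB, raddfN) /= !part_monomial //= => PQ.
apply: (cancel_coef0 cP0); apply: (mulfI (natr_series_neq0 2)).
by apply/eqP; rewrite -subr_eq0 -[X in _ == X]PQ; apply/eqP; ring.
Qed.

Lemma smap_eta (phi : {rmorphism int -> algC}) A : (0 < A)%N -> smap phi (e A) = eta algC A.
Proof.
move=> A0; rewrite eta.unlock smap_iprod; last exact: convergent_eta.
by apply: eq_iprod => j; rewrite rmorphB rmorph1 rmorphXn /= smap_qX.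
Qed.

(** Replacing q by z^k q multiplies the three terms by 1, z^k and z^(2k), so the product in
    [eta_norm] is the one in [five_norm]. The computation takes place over [algC] and descends
    because [smap] is injective there. *)
Lemma eta_five_norm (P Q : series int) : in_class 5 0 P -> in_class 5 2 Q ->
  e 1 = P - w + Q -> P * Q = - w ^+ 2 ->
  (P ^+ 5 - 11%:R * w ^+ 5 + Q ^+ 5) * e 25 = e 5 ^+ 6.
Proof.
move=> P0 Q2 eE PQ; pose phi : {rmorphism int -> algC} := intmul 1.
have [z zP] := C_prim_root_exists (isT : 0 < 5)%N.
have z5 := prim_expr_order zP.
have z1 : z != 1.
  apply/eqP => z1; have := eq_prim_root_expr zP 1 0.
  by rewrite expr1 expr0 z1 eqxx.
have z_sum : 1 + z + z ^+ 2 + z ^+ 3 + z ^+ 4 = 0.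
  apply: (@mulfI _ (1 - z)); first by rewrite subr_eq0 eq_sym.
  by transitivity (1 - z ^+ 5); [ring | rewrite z5 subrr mulr0].
have phi_inj : injective (smap phi).
  move=> f g fg; apply: seriesP => n; have := congr1 (fun h => coef h n) fg.
  exact: intr_inj.
have phi_class c f : in_class 5 c f -> in_class 5 c (smap phi f).
  by move=> fc n /fc /= ->; rewrite rmorph0.
apply: phi_inj; rewrite rmorphM rmorphXn /= !smap_eta // -(eta_norm z5 z_sum).
congr (_ * _); rewrite -(smap_eta phi) // eE.
have z'5 : const z ^+ 5 = 1 :> series algC by rewrite -rmorphXn z5 rmorph1.
have z'sum : 1 + const z + const z ^+ 2 + const z ^+ 3 + const z ^+ 4 = 0 :> series algC.
  by rewrite -!rmorphXn -(rmorph1 (@const algC)) -!rmorphD z_sum rmorph0.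
have PQ' : smap phi P * smap phi Q = - smap phi w ^+ 2.
  by rewrite -rmorphM PQ rmorphN rmorphXn.
transitivity (smap phi P ^+ 5 - 11%:R * smap phi w ^+ 5 + smap phi Q ^+ 5).
  by move: (w) => u; ring.
rewrite -(five_norm z'5 z'sum PQ'); apply: eq_bigr => k _.
rewrite rmorphD rmorphB /= rmorphD rmorphB /=.
rewrite (scal_class k z5 (phi_class _ _ P0)) (scal_class k z5 (phi_class _ _ in_class_w)).
by rewrite (scal_class k z5 (phi_class _ _ Q2)) muln0 expr0 mul1r muln1 [(2 * k)%N]mulnC.
Qed.

(* The second factor is the product of the nontrivial conjugates of the first,
   as in five_norm. *)
Lemma quintic_factor (R : comNzRingType) (p u s : R) : p * s = - u ^+ 2 ->
  (p - u + s) * (p ^+ 4 + p ^+ 3 * u + 2%:R * p ^+ 2 * u ^+ 2 + 3%:R * p * u ^+ 3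
    + 5%:R * u ^+ 4 + 3%:R * u ^+ 3 * s + 2%:R * u ^+ 2 * s ^+ 2 + u * s ^+ 3 + s ^+ 4)
  = p ^+ 5 - 11%:R * u ^+ 5 + s ^+ 5.
Proof.
move=> ps; have ps0 : p * s + u ^+ 2 = 0 by rewrite ps addNr.
apply/eqP; rewrite -subr_eq0; apply/eqP.
transitivity ((p * s + u ^+ 2) * (6%:R * u ^+ 3 + 2%:R * u ^+ 2 * s + u * s ^+ 2 + s ^+ 3
   + p ^+ 3 + p ^+ 2 * u + 2%:R * p * u ^+ 2)); first by ring.
by rewrite ps0 mul0r.
Qed.

(** The bracket is u times the second factor of [quintic_factor], each monomial being multiplied by
    (d/5), where d is its degree when p, u, s have degrees 0, 1, 2; the term 5 u^5 thus drops
    out. *)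
Lemma quintic_power (R : comNzRingType) (p u s : R) : p * s = - u ^+ 2 ->
  (p - u + s) ^+ 5 = p ^+ 5 - 11%:R * u ^+ 5 + s ^+ 5
   - 5%:R * (p ^+ 4 * u - p ^+ 3 * u ^+ 2 - 2%:R * p ^+ 2 * u ^+ 3 + 3%:R * p * u ^+ 4
     + 3%:R * u ^+ 4 * s - 2%:R * u ^+ 3 * s ^+ 2 - u ^+ 2 * s ^+ 3 + u * s ^+ 4).
Proof.
move=> ps; have ps0 : p * s + u ^+ 2 = 0 by rewrite ps addNr.
apply/eqP; rewrite -subr_eq0; apply/eqP.
transitivity ((p * s + u ^+ 2) * (5%:R * p ^+ 3 - 20%:R * p ^+ 2 * u + 10%:R * p ^+ 2 * s
  + 20%:R * p * u ^+ 2 - 30%:R * p * u * s + 10%:R * p * s ^+ 2 + 10%:R * u ^+ 3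
  + 20%:R * u ^+ 2 * s - 20%:R * u * s ^+ 2 + 5%:R * s ^+ 3)); first by ring.
by rewrite ps0 mul0r.
Qed.

(** The Legendre symbol (n/5). *)
Definition chi5 (n : nat) : int := nth 0 [:: 0; 1; -1; -1; 1] (n %% 5).

(** Multiplication by e_5, which is a series in q^5, turns everything into polynomials in P, w, Q: X
    becomes w times the cofactor of e_1 in its norm, Y(q^5) becomes the norm, and Y becomes e_1^5.
    In class 0 only the term 5 w^5 of the first survives; the twist comes from [quintic_power]. *)
Lemma five_dissection_relations (X Y : series int) :
  X * e 1 = q * e 5 ^+ 5 -> Y * e 5 = e 1 ^+ 5 ->
  part_of 5 0 X = 5%:R * dil 5 X /\ Y = dil 5 Y - 5%:R * twist chi5 X.
Proof.
move=> XE YE; have [P [Q [P0 Q2 eE PQ]]] := eta_five_dissection_prod.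
have NN := eta_five_norm P0 Q2 eE PQ.
have chi_mod n : chi5 (n %% 5)%N = chi5 n by rewrite /chi5 modn_mod.
have d1 : dil 5 (e 1) = e 5 by rewrite dil_eta.
have d5 : dil 5 (e 5) = e 25 by rewrite dil_eta.
have e50 : in_class 5 0 (e 5) by rewrite -d1; apply: in_class_dil.
have w1 := in_class_w.
have XM : X * e 5 =
    1%:R * (P ^+ 4 * w ^+ 1 * Q ^+ 0) + 1%:R * (P ^+ 3 * w ^+ 2 * Q ^+ 0)
  + 2%:R * (P ^+ 2 * w ^+ 3 * Q ^+ 0) + 3%:R * (P ^+ 1 * w ^+ 4 * Q ^+ 0)
  + 5%:R * (P ^+ 0 * w ^+ 5 * Q ^+ 0) + 3%:R * (P ^+ 0 * w ^+ 4 * Q ^+ 1)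
  + 2%:R * (P ^+ 0 * w ^+ 3 * Q ^+ 2) + 1%:R * (P ^+ 0 * w ^+ 2 * Q ^+ 3)
  + 1%:R * (P ^+ 0 * w ^+ 1 * Q ^+ 4).
  apply: (@cancel_coef0 _ (e 5 ^+ 5)); first by rewrite coef0_exp coef0_eta ?expr1n.
  transitivity (X * e 5 ^+ 6); first by ring.
  by rewrite -NN -(quintic_factor PQ) -eE !mulrA XE; ring.
have e5c : coef (e 5) 0 = 1 by rewrite coef0_eta.
split.
  apply: (cancel_coef0 e5c); rewrite mulrC -part_ofMr // XM !raddfD /= !part_monomial //=.
  transitivity (5%:R * dil 5 (X * e 1)); last by rewrite rmorphM /= d1; ring.
  by rewrite XE rmorphM rmorphXn /= d5 dil_qX //; ring.
have twE : twist chi5 X * e 5 = P ^+ 4 * w - P ^+ 3 * w ^+ 2 - 2%:R * P ^+ 2 * w ^+ 3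
   + 3%:R * P * w ^+ 4 + 3%:R * w ^+ 4 * Q - 2%:R * w ^+ 3 * Q ^+ 2 - w ^+ 2 * Q ^+ 3 + w * Q ^+ 4.
  rewrite -(twistMr chi_mod) // XM !raddfD /= !twist_monomial // /chi5 /=.
  have cN : const (-1) = -1 :> series int by rewrite rmorphN rmorph1.
  by rewrite cN rmorph1 rmorph0; ring.
have YN : dil 5 Y * e 5 = P ^+ 5 - 11%:R * w ^+ 5 + Q ^+ 5.
  apply: (@cancel_coef0 _ (e 25)); first by rewrite coef0_eta.
  rewrite [RHS]mulrC NN [e 5 ^+ 6]exprS -d1 -rmorphXn -YE rmorphM /= d1 d5; ring.
apply: (cancel_coef0 e5c); rewrite mulrC YE eE (quintic_power PQ) -YN -twE; ring.
Qed.

End FiveDissectionRelations.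

(** * Eta quotients of level 10 and 20 *)

Section EtaQuotients.
Local Notation e := (eta int).
Local Notation q := (qX : series int).
Local Notation ps := (psi int).
Local Notation pm := (phi (-1) : series int).
Local Notation pp := (phi 1 : series int).
Local Notation GG := (G int).

Ltac eta_cancel t :=
  apply: (@mulfI _ t); first by rewrite ?(mulf_neq0, expf_neq0, eta_neq0).

Lemma dil_psi_eta k : (0 < k)%N -> dil k ps * e k = e (2 * k) ^+ 2.
Proof.
move=> k0; rewrite -[in LHS](muln1 k) -dil_eta // muln1 -rmorphM psi_eta.
by rewrite rmorphXn /= dil_eta // mulnC.
Qed.

Lemma dil_phi_minus_eta k : (0 < k)%N -> dil k pm * e (2 * k) = e k ^+ 2.
Proof.
move=> k0; rewrite [(2 * k)%N]mulnC -dil_eta // -rmorphM phi_minus.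
by rewrite rmorphXn /= dil_eta // muln1.
Qed.

Lemma psi_square : ps ^+ 2 = q * dil 5 ps ^+ 2 + GG.
Proof.
have := triangular_square int; rewrite triangular_psi rmorphM rmorph_nat => J.
apply: (mulfI (natr_series_neq0 3)).
transitivity ((2%:R * ps) ^+ 2); first by ring.
by rewrite J; ring.
Qed.

Lemma psi_phi : ps ^+ 2 = pp * dil 2 ps.
Proof.
have h1 := psi_eta int; have h2 := phi_plus int.
have h3 : dil 2 ps * e 2 = e 4 ^+ 2 := dil_psi_eta (isT : 0 < 2)%N.
eta_cancel (e 1 ^+ 2 * e 4 ^+ 2 * e 2).
transitivity ((ps * e 1) ^+ 2 * e 4 ^+ 2 * e 2); first by ring.
transitivity (pp * (e 1 ^+ 2 * e 4 ^+ 2) * (dil 2 ps * e 2)); last by ring.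
by rewrite h1 h2 h3; ring.
Qed.

Lemma phi_conj : pp * pm = dil 2 pm ^+ 2.
Proof.
have h1 := phi_minus int; have h2 := phi_plus int.
have h3 : dil 2 pm * e 4 = e 2 ^+ 2 := dil_phi_minus_eta (isT : 0 < 2)%N.
eta_cancel (e 1 ^+ 2 * e 4 ^+ 2 * e 2).
transitivity (pp * (e 1 ^+ 2 * e 4 ^+ 2) * (pm * e 2)); first by ring.
transitivity ((dil 2 pm * e 4) ^+ 2 * e 1 ^+ 2 * e 2); last by ring.
by rewrite h1 h2 h3; ring.
Qed.

Lemma phi_minus_square : pm ^+ 2 = dil 5 pm ^+ 2 - 4%:R * (q * H (-1)).
Proof.
have cN : const (-1) = -1 :> series int by rewrite rmorphN rmorph1.
by rewrite phi_square // cN; ring.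
Qed.

Lemma phi_plus_square : pp ^+ 2 = dil 5 pp ^+ 2 + 4%:R * (q * H 1).
Proof. by rewrite phi_square // rmorph1; ring. Qed.

(** This is [psi_square] with theta functions replaced by eta quotients and denominators cleared;
    the next lemma does the same for [phi_minus_square]. *)
Lemma eta_psi_relation :
  e 2 ^+ 4 * e 5 ^+ 2 * e 10 = q * e 1 ^+ 2 * e 10 ^+ 5 + e 1 * e 2 * e 5 ^+ 5.
Proof.
have h1 := psi_eta int; have hG := G_eta int.
have h5 : dil 5 ps * e 5 = e 10 ^+ 2 := dil_psi_eta (isT : 0 < 5)%N.
transitivity ((ps * e 1) ^+ 2 * e 5 ^+ 2 * e 10); first by rewrite h1; ring.
transitivity (q * (dil 5 ps * e 5) ^+ 2 * e 1 ^+ 2 * e 10 + GG * (e 1 * e 10) * e 1 * e 5 ^+ 2).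
  by rewrite exprMn psi_square; ring.
by rewrite h5 hG; ring.
Qed.

Lemma eta_phi_relation :
  e 1 ^+ 4 * e 10 ^+ 2 * e 5 = e 2 ^+ 2 * e 5 ^+ 5 - 4%:R * (q * e 1 * e 2 * e 10 ^+ 5).
Proof.
have h1 := phi_minus int; have hH := H_minus int.
have h5 : dil 5 pm * e 10 = e 5 ^+ 2 := dil_phi_minus_eta (isT : 0 < 5)%N.
transitivity ((pm * e 2) ^+ 2 * e 10 ^+ 2 * e 5); first by rewrite h1; ring.
transitivity ((dil 5 pm * e 10) ^+ 2 * e 2 ^+ 2 * e 5
   - 4%:R * (q * (H (-1) * (e 2 * e 5)) * e 2 * e 10 ^+ 2)).
  by rewrite exprMn phi_minus_square; ring.
by rewrite h5 hH; ring.
Qed.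

(** With u = e_2 e_5^5 and v = q e_1 e_10^5, the two relations above have right-hand sides e_1 (u +
    v) and e_2 (u - 4 v). This is their product, u^2 - 3 u v - 4 v^2. *)
Lemma eta_level_ten_relation :
  e 1 ^+ 3 * e 2 ^+ 3 * e 5 ^+ 3 * e 10 ^+ 3 =
  e 2 ^+ 2 * e 5 ^+ 10 - 3%:R * (q * e 1 * e 2 * e 5 ^+ 5 * e 10 ^+ 5)
  - 4%:R * (q ^+ 2 * e 1 ^+ 2 * e 10 ^+ 10).
Proof.
eta_cancel (e 1 * e 2).
transitivity ((e 1 ^+ 4 * e 10 ^+ 2 * e 5) * (e 2 ^+ 4 * e 5 ^+ 2 * e 10)); first by ring.
by rewrite eta_psi_relation eta_phi_relation; ring.
Qed.

Section Quotients.
Variables X Y : series int.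
Hypotheses (XE : X * e 1 = q * e 5 ^+ 5) (YE : Y * e 5 = e 1 ^+ 5).

Let X2E : dil 2 X * e 2 = q ^+ 2 * e 10 ^+ 5.
Proof.
rewrite -[e 2](dil_eta int (isT : 0 < 2)%N (isT : 0 < 1)%N) -rmorphM XE.
by rewrite rmorphM rmorphXn /= dil_qX // dil_eta.
Qed.

Let Y2E : dil 2 Y * e 10 = e 2 ^+ 5.
Proof.
rewrite -[e 10](dil_eta int (isT : 0 < 2)%N (isT : 0 < 5)%N) -rmorphM YE.
by rewrite rmorphXn /= dil_eta.
Qed.

(** In the u, v of [eta_level_ten_relation], the terms in Y carry (u - 4v) + 4 (u + v) = 5 u. The
    coefficient 4 is chosen to cancel v; the product relation then turns this into 5 (u^2 - 3uv -
    4v^2), and the terms 15 u v and 20 v^2 from X leave 5 u^2. *)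
Lemma phi_quotient A : A * pm = dil 5 pm ^+ 5 ->
  5%:R * A = 15%:R * X + 20%:R * dil 2 X + Y + 4%:R * dil 2 Y.
Proof.
move=> AE; have h1 := phi_minus int.
have h5 : dil 5 pm * e 10 = e 5 ^+ 2 := dil_phi_minus_eta (isT : 0 < 5)%N.
have A2 : A * (e 10 ^+ 5 * e 1 ^+ 2) = e 5 ^+ 10 * e 2.
  transitivity (A * (pm * e 2) * e 10 ^+ 5); first by rewrite h1; ring.
  transitivity ((dil 5 pm * e 10) ^+ 5 * e 2); last by rewrite h5; ring.
  by rewrite mulrA AE; ring.
eta_cancel (e 1 ^+ 2 * e 2 * e 5 ^+ 2 * e 10 ^+ 5).
transitivity (5%:R * (A * (e 10 ^+ 5 * e 1 ^+ 2)) * e 2 * e 5 ^+ 2); first by ring.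
transitivity (15%:R * (X * e 1) * e 1 * e 2 * e 5 ^+ 2 * e 10 ^+ 5
  + 20%:R * (dil 2 X * e 2) * e 1 ^+ 2 * e 5 ^+ 2 * e 10 ^+ 5
  + (Y * e 5) * e 1 ^+ 2 * e 2 * e 5 * e 10 ^+ 5
  + 4%:R * (dil 2 Y * e 10) * e 1 ^+ 2 * e 2 * e 5 ^+ 2 * e 10 ^+ 4); last by ring.
rewrite A2 XE X2E YE Y2E.
transitivity (15%:R * (q * e 5 ^+ 5) * e 1 * e 2 * e 5 ^+ 2 * e 10 ^+ 5
  + 20%:R * (q ^+ 2 * e 10 ^+ 5) * e 1 ^+ 2 * e 5 ^+ 2 * e 10 ^+ 5
  + 5%:R * e 5 ^+ 2 * (e 1 ^+ 3 * e 2 ^+ 3 * e 5 ^+ 3 * e 10 ^+ 3)).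
  by rewrite eta_level_ten_relation; ring.
transitivity (15%:R * (q * e 5 ^+ 5) * e 1 * e 2 * e 5 ^+ 2 * e 10 ^+ 5
  + 20%:R * (q ^+ 2 * e 10 ^+ 5) * e 1 ^+ 2 * e 5 ^+ 2 * e 10 ^+ 5
  + (e 1 ^+ 4 * e 10 ^+ 2 * e 5) * e 1 ^+ 3 * e 2 * e 10 ^+ 3
  + 4%:R * (e 2 ^+ 4 * e 5 ^+ 2 * e 10) * e 1 ^+ 2 * e 2 ^+ 2 * e 10 ^+ 3); last by ring.
by rewrite eta_phi_relation eta_psi_relation; ring.
Qed.

(** As for [phi_quotient], with u cancelled instead: (u - 4v) - (u + v) = -5 v gives -5 (u^2 - 3uv -
    4v^2), and 5 u^2 - 15 u v from X leaves 20 v^2. *)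
Lemma psi_quotient B : B * ps = dil 5 ps ^+ 5 ->
  20%:R * (q ^+ 3 * B) = 5%:R * X - 15%:R * dil 2 X + Y - dil 2 Y.
Proof.
move=> BE; have h1 := psi_eta int.
have h5 : dil 5 ps * e 5 = e 10 ^+ 2 := dil_psi_eta (isT : 0 < 5)%N.
have B2 : B * (e 2 ^+ 2 * e 5 ^+ 5) = e 10 ^+ 10 * e 1.
  transitivity (B * (ps * e 1) * e 5 ^+ 5); first by rewrite h1; ring.
  transitivity ((dil 5 ps * e 5) ^+ 5 * e 1); last by rewrite h5; ring.
  by rewrite mulrA BE; ring.
eta_cancel (e 1 * e 2 ^+ 2 * e 5 ^+ 5 * e 10 ^+ 2).
transitivity (20%:R * q ^+ 3 * (B * (e 2 ^+ 2 * e 5 ^+ 5)) * e 1 * e 10 ^+ 2); first by ring.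
transitivity (5%:R * (X * e 1) * e 2 ^+ 2 * e 5 ^+ 5 * e 10 ^+ 2
  - 15%:R * (dil 2 X * e 2) * e 1 * e 2 * e 5 ^+ 5 * e 10 ^+ 2
  + (Y * e 5) * e 1 * e 2 ^+ 2 * e 5 ^+ 4 * e 10 ^+ 2
  - (dil 2 Y * e 10) * e 1 * e 2 ^+ 2 * e 5 ^+ 5 * e 10); last by ring.
rewrite B2 XE X2E YE Y2E.
transitivity (5%:R * q * e 10 ^+ 2 * (e 2 ^+ 2 * e 5 ^+ 10
  - 3%:R * (q * e 1 * e 2 * e 5 ^+ 5 * e 10 ^+ 5)
  - e 1 ^+ 3 * e 2 ^+ 3 * e 5 ^+ 3 * e 10 ^+ 3)).
  by rewrite eta_level_ten_relation; ring.
transitivity (5%:R * (q * e 5 ^+ 5) * e 2 ^+ 2 * e 5 ^+ 5 * e 10 ^+ 2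
  - 15%:R * (q ^+ 2 * e 10 ^+ 5) * e 1 * e 2 * e 5 ^+ 5 * e 10 ^+ 2
  + (e 1 ^+ 4 * e 10 ^+ 2 * e 5) * e 1 ^+ 2 * e 2 ^+ 2 * e 5 ^+ 3
  - (e 2 ^+ 4 * e 5 ^+ 2 * e 10) * e 1 * e 2 ^+ 3 * e 5 ^+ 3); last by ring.
by rewrite eta_phi_relation eta_psi_relation; ring.
Qed.

End Quotients.

(** * The two-dissection of X *)

Let psi2 := dil 2 ps.
Let psi10 := dil 10 ps.
Let phi5 := dil 5 pp.

Let psi_phi5 : dil 5 ps ^+ 2 = phi5 * psi10.
Proof. by rewrite -rmorphXn /= psi_phi rmorphM /= dil_dil. Qed.

Let psi_square2 : psi2 ^+ 2 = q ^+ 2 * psi10 ^+ 2 + dil 2 GG.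
Proof.
rewrite /psi2 -rmorphXn /= psi_square rmorphD rmorphM rmorphXn /=.
by rewrite dil_dil dil_qX.
Qed.

(** The squares of the two sides agree by the relations already known; since series over [int] form
    a domain, the sides agree up to sign, and the constant terms settle the sign. *)
Lemma eta_one_five : psi2 * phi5 - q * pp * psi10 = e 1 * e 5.
Proof.
set K := LHS.
have hG := G_eta int; have hH := H_plus int.
have hG2 : dil 2 GG * (e 2 * e 20) = e 4 * e 10 ^+ 3.
  transitivity (dil 2 (GG * (e 1 * e 10))).
    by rewrite !rmorphM /= !dil_eta.
  by rewrite hG rmorphM rmorphXn /= !dil_eta.
have KG : K ^+ 2 = GG ^+ 2 - 4%:R * (q * H 1 * dil 2 GG).
  (* An identity of Lagrange type whose pieces are all known: the three differences are -4 q H(1),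
     G(q^2) and G. *)
  transitivity ((dil 5 pp ^+ 2 - pp ^+ 2) * (psi2 ^+ 2 - q ^+ 2 * psi10 ^+ 2)
     + ((pp * psi2) - q * (phi5 * psi10)) ^+ 2).
    by rewrite /K; ring.
  by rewrite -psi_phi -psi_phi5 psi_square2 phi_plus_square psi_square; ring.
have K2 : K ^+ 2 = (e 1 * e 5) ^+ 2.
  rewrite KG; eta_cancel ((e 1 * e 10) ^+ 2 * (e 2 * e 20) * (e 1 * e 4)).
  transitivity ((GG * (e 1 * e 10)) ^+ 2 * (e 2 * e 20) * (e 1 * e 4)
    - 4%:R * q * (H 1 * (e 1 * e 4)) * (dil 2 GG * (e 2 * e 20)) * (e 1 * e 10) ^+ 2); first by ring.
  rewrite hG hH hG2.
  transitivity (e 5 * (e 1 ^+ 4 * e 10 ^+ 2 * e 5) * e 1 * e 2 * e 4 * e 20); last by ring.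
  by rewrite eta_phi_relation; ring.
have /eqP : (K - e 1 * e 5) * (K + e 1 * e 5) = 0.
  by transitivity (K ^+ 2 - (e 1 * e 5) ^+ 2); [ring | rewrite K2 subrr].
rewrite mulf_eq0 subr_eq0 => /orP[/eqP //|/eqP K0]; exfalso.
have dil0 k (f : series int) : coef (dil k f) 0 = coef f 0 by rewrite /= dvdn0 div0n.
have psi0 : coef ps 0 = 1.
  have := congr1 (fun f => coef f 0) (psi_eta int).
  by rewrite coef0_exp coef0M !coef0_eta // mulr1.
have phi0 : coef pp 0 = 1.
  have := congr1 (fun f => coef f 0) (phi_plus int).
  by rewrite coef0_exp coef0M [coef (_ * _) 0]coef0M !coef0_exp !coef0_eta // !expr1n !mulr1.
have := congr1 (fun f => coef f 0) K0.
rewrite coefD_series coef0M !coef0_eta // /K coefB_series !coef0M !dil0 psi0 phi0.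
by rewrite coef0_series.
Qed.

(** As e_2 is even, it suffices to split X e_2 = q e_10^2 G phi(-q^5), where G = phi(q) psi(q^2) - q
    phi(q^5) psi(q^10). Splitting phi(q) and phi(-q^5) by parity leaves in the even part a
    difference of theta products, which is [eta_one_five] at q^4. What remains is [eta_psi_relation]
    at q^2. *)
Lemma quintic_two_dissection X : X * e 1 = q * e 5 ^+ 5 ->
  part_of 2 0 X = dil 2 X + 2%:R * dil 4 X.
Proof.
move=> XE; have hG := G_eta int.
have h5 : dil 5 pm * e 10 = e 5 ^+ 2 := dil_phi_minus_eta (isT : 0 < 5)%N.
have h10 : dil 10 pm * e 20 = e 10 ^+ 2 := dil_phi_minus_eta (isT : 0 < 10)%N.
have p2 : psi2 * e 2 = e 4 ^+ 2 := dil_psi_eta (isT : 0 < 2)%N.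
have p10 : psi10 * e 10 = e 20 ^+ 2 := dil_psi_eta (isT : 0 < 10)%N.
have X2E : dil 2 X * e 2 = q ^+ 2 * e 10 ^+ 5.
  transitivity (dil 2 (X * e 1)); first by rewrite rmorphM /= dil_eta.
  by rewrite XE rmorphM rmorphXn /= dil_qX // dil_eta.
have X4E : dil 4 X * e 4 = q ^+ 4 * e 20 ^+ 5.
  transitivity (dil 4 (X * e 1)); first by rewrite rmorphM /= dil_eta.
  by rewrite XE rmorphM rmorphXn /= dil_qX // dil_eta.
have XG : X * e 2 = q * (e 10 ^+ 2 * (GG * dil 5 pm)).
  eta_cancel (e 1 * e 10 ^+ 2).
  transitivity ((X * e 1) * e 2 * e 10 ^+ 2); first by ring.
  transitivity (q * e 10 ^+ 2 * (GG * (e 1 * e 10)) * (dil 5 pm * e 10)); last by ring.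
  by rewrite XE hG h5; ring.
have conj5 : phi5 * dil 5 pm = dil 10 pm ^+ 2.
  by rewrite -rmorphM phi_conj rmorphXn /= dil_dil.
have GE : GG * dil 5 pm = pp * dil 5 pm * psi2 - q * (dil 10 pm ^+ 2 * psi10).
  have -> : GG = pp * psi2 - q * (phi5 * psi10).
    by rewrite -psi_phi -psi_phi5 psi_square; ring.
  by rewrite -conj5; ring.
have pE : pp = dil 4 pp + 2%:R * (q * dil 8 ps).
  by rewrite {1}phi_even_odd // rmorph1 mul1r.
have mE : dil 5 pm = dil 20 pp - 2%:R * (q ^+ 5 * dil 40 ps).
  have cN : const (-1) = -1 :> series int by rewrite rmorphN rmorph1.
  rewrite {1}phi_even_odd // cN rmorphD !rmorphM rmorphN rmorph1 rmorph_nat /= !dil_dil.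
  by rewrite dil_qX //; ring.
have J4 : dil 8 ps * dil 20 pp - q ^+ 4 * dil 4 pp * dil 40 ps = e 4 * e 20.
  transitivity (dil 4 (psi2 * phi5 - q * pp * psi10)).
    by rewrite rmorphB !rmorphM /= /psi2 /phi5 /psi10 !dil_dil dil_qX.
  by rewrite eta_one_five rmorphM /= !dil_eta.
pose ev := q ^+ 2 * (e 10 ^+ 2 * (2%:R * (e 4 * e 20) * psi2 - dil 10 pm ^+ 2 * psi10)).
pose od := e 10 ^+ 2 * (dil 4 pp * dil 20 pp - 4%:R * q ^+ 6 * (dil 8 ps * dil 40 ps)) * psi2.
have XEO : X * e 2 = ev + q * od.
  rewrite XG GE pE mE /ev /od -J4; ring.
have c_dil k f : (0 < k)%N -> in_class 2 0 (dil (2 * k) f : series int).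
  by move=> k0; apply: in_class_dil; [exact: dvdn_mulr | rewrite muln_gt0 k0].
have c_e k : (0 < k)%N -> in_class 2 0 (e (2 * k)).
  by move=> k0; rewrite -[(2 * k)%N]muln1 -dil_eta ?muln_gt0 ?k0 //; apply: (c_dil).
have cM f g : in_class 2 0 f -> in_class 2 0 g -> in_class 2 0 (f * g : series int).
  by move=> f0 g0; apply: in_classM f0 g0.
have cX f n : in_class 2 0 f -> in_class 2 0 (f ^+ n : series int).
  by move=> f0; have := in_classX (k := n) f0; rewrite muln0.
have cn n : in_class 2 0 (n%:R : series int).
  by rewrite -(rmorph_nat (@const int)); apply: in_class_const.
have cq k : in_class 2 0 (q ^+ (2 * k)).
  by apply: (@in_class_eq _ _ (2 * k * 1)); [rewrite muln1 modnMr mod0n | apply/in_classX/in_class_qX].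
have ev0 : in_class 2 0 ev.
  apply: (cM); first exact: (cq 1%N).
  apply: (cM); first by apply: (cX); exact: (c_e 5).
  apply: in_classD; first by do !apply: (cM); [exact: cn | exact: (c_e 2) | exact: (c_e 10) | exact: (c_dil 1%N)].
  by apply: in_classN; apply: (cM); [apply: (cX); exact: (c_dil 5) | exact: (c_dil 5)].
have od0 : in_class 2 0 od.
  apply: (cM); last exact: (c_dil 1%N).
  apply: (cM); first by apply: (cX); exact: (c_e 5).
  apply: in_classD; first by apply: (cM); [exact: (c_dil 2) | exact: (c_dil 10)].
  apply: in_classN; apply: (cM); first by apply: (cM); [exact: cn | exact: (cq 3)].
  by apply: (cM); [exact: (c_dil 4) | exact: (c_dil 20)].
have qod : in_class 2 1 (q * od) by apply: (in_classM (@in_class_qX _ 2) od0).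
have partE : part_of 2 0 X * e 2 = ev.
  rewrite -part_ofMr; last exact: (c_e 1%N).
  by rewrite XEO raddfD /= (part_of_id ev0) (part_of_out _ qod) ?addr0.
have rel2 : e 4 ^+ 4 * e 10 ^+ 2 * e 20 = q ^+ 2 * e 2 ^+ 2 * e 20 ^+ 5 + e 2 * e 4 * e 10 ^+ 5.
  transitivity (dil 2 (e 2 ^+ 4 * e 5 ^+ 2 * e 10)).
    by rewrite 2!rmorphM 2!rmorphXn /= !dil_eta.
  rewrite eta_psi_relation rmorphD /=; congr (_ + _).
    by rewrite 2!rmorphM 2!rmorphXn /= !dil_eta // dil_qX.
  by rewrite 2!rmorphM rmorphXn /= !dil_eta.
eta_cancel (e 2 ^+ 2 * e 4 * e 20 ^+ 2 * e 10).
transitivity ((part_of 2 0 X * e 2) * e 2 * e 4 * e 20 ^+ 2 * e 10); first by ring.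
transitivity ((dil 2 X * e 2) * e 2 * e 4 * e 20 ^+ 2 * e 10
   + 2%:R * (dil 4 X * e 4) * e 2 ^+ 2 * e 20 ^+ 2 * e 10); last by ring.
rewrite partE X2E X4E.
transitivity (q ^+ 2 * e 10 ^+ 3 * (2%:R * (e 4 ^+ 2 * e 20 ^+ 3) * (psi2 * e 2))
  - q ^+ 2 * e 10 ^+ 2 * (dil 10 pm * e 20) ^+ 2 * (psi10 * e 10) * e 2 * e 4).
  by rewrite /ev; ring.
rewrite p2 h10 p10.
transitivity (2%:R * q ^+ 2 * e 10 * e 20 ^+ 2 * (e 4 ^+ 4 * e 10 ^+ 2 * e 20)
   - q ^+ 2 * e 10 ^+ 6 * e 20 ^+ 2 * e 2 * e 4).
  by ring.
by rewrite rel2; ring.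
Qed.

End EtaQuotients.

(** * Cores and the abacus *)

Section BetaSets.

(** The positions of [m] beads on the abacus, [l] being padded with zero parts to length [m]. *)
Definition beta (m : nat) (l : seq nat) : seq nat :=
  mkseq (fun a => nth 0%N l a + (m - a.+1))%N m.

Lemma nth_beta m l a : (a < m)%N -> nth 0%N (beta m l) a = (nth 0%N l a + (m - a.+1))%N.
Proof. by move=> am; rewrite nth_mkseq. Qed.

Lemma partition_nth_le l a b : is_partition l -> (a <= b)%N ->
  (nth 0%N l b <= nth 0%N l a)%N.
Proof.
case/andP=> sl _ ab; have [bl|lb] := ltnP b (size l); last by rewrite nth_default.
have geq_trans : transitive geq by move=> x y z /= yx xz; apply: leq_trans xz yx.
by have := sorted_leq_nth geq_trans leqnn 0%N sl; apply => //; rewrite inE; apply: leq_ltn_trans bl.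
Qed.

Lemma beta_lt m l a b : is_partition l -> (a < b < m)%N ->
  (nth 0%N (beta m l) b < nth 0%N (beta m l) a)%N.
Proof.
move=> pl /andP[ab bm]; rewrite !nth_beta //; last by lia.
have := partition_nth_le pl (ltnW ab); lia.
Qed.

Lemma gtn_trans : transitive gtn.
Proof. by move=> x y z /= yx xz; apply: ltn_trans xz yx. Qed.

Lemma beta_sorted m l : is_partition l -> sorted gtn (beta m l).
Proof.
move=> pl; apply/(sortedP 0%N) => a; rewrite size_mkseq => am.
by apply: beta_lt => //; rewrite ltnSn.
Qed.

Lemma sumn_beta m l : (size l <= m)%N -> sumn (beta m l) = (sumn l + 'C(m, 2))%N.
Proof.
move=> lm; have iotaE k : iota 0 k = index_iota 0 k by rewrite /index_iota subn0.
rewrite /beta sumnE big_map iotaE big_split /=.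
congr (_ + _)%N.
  rewrite (big_cat_nat (leq0n _) lm) //= [X in (_ + X)%N]big_nat_cond.
  rewrite [X in (_ + X)%N]big1 ?addn0; first by rewrite sumnE [RHS](big_nth 0%N).
  by move=> a /andP[/andP[la _] _]; rewrite nth_default.
rewrite big_mkord (reindex_inj rev_ord_inj) /= -bin2_sum big_mkord.
by apply: eq_bigr => a _; have := ltn_ord a; lia.
Qed.

Lemma mem_beta m l x :
  reflect (exists2 a, (a < m)%N & x = (nth 0%N l a + (m - a.+1))%N) (x \in beta m l).
Proof.
apply: (iffP mapP) => [[a am ->]|[a am ->]]; exists a => //; last by rewrite mem_iota.
by rewrite mem_iota in am.
Qed.

(** The hook numbers in row [a] are the differences between its bead and the gaps below it. A
    missing bead at x - t thus gives a hook number t; conversely, a hook number k t puts a gap at x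
    - k t, which k steps down by t would fill. *)
Lemma core_beta t m l : (0 < t)%N -> is_partition l -> (size l <= m)%N ->
  is_core t l <-> forall x, x \in beta m l -> (t <= x)%N -> (x - t)%N \in beta m l.
Proof.
move=> t0 pl lm.
have count_le j : conj_part l j = count (fun a => j <= nth 0%N l a)%N (iota 0 (size l)).
  by rewrite /conj_part -{1}(mkseq_nth 0%N l) count_map.
have conjP j c : (0 < j)%N -> (c <= m)%N ->
    (forall a, (a < c)%N -> (j <= nth 0%N l a)%N) -> (nth 0%N l c < j)%N -> conj_part l j = c.
  move=> j0 cm jc cj; have cl : (c <= size l)%N.
    rewrite leqNgt; apply/negP => lc; have := jc _ lc; rewrite nth_default //; lia.
  rewrite count_le -(subnKC cl) iotaD count_cat add0n.
  rewrite (eq_in_count (a2 := predT)) ?count_predT ?size_iota; last first.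
    by move=> a; rewrite mem_iota /= => ac; apply: jc.
  rewrite (eq_in_count (a2 := pred0)) ?count_pred0 ?addn0 // => a.
  rewrite mem_iota => /andP[ca _]; apply/negbTE; rewrite -ltnNge.
  by apply: leq_ltn_trans cj; apply: partition_nth_le.
have nthE a : (a < m)%N -> nth 0%N (beta m l) a = (nth 0%N l a + (m - a.+1))%N.
  exact: nth_beta.
split.
  move=> /allP cl x /mem_beta[a am xE] tx; apply: contraT => yN.
  have [y yE] : exists y, (y + t)%N = x by exists (x - t)%N; lia.
  rewrite -yE addnK in yN.
  (* The number of beads above the gap [y], hence the height of the column attached to that gap. *)
  pose c := find (fun z => z < y)%N (beta m l).
  have cm : (c <= m)%N by rewrite -[X in (_ <= X)%N](size_mkseq (fun a => nth 0%N l a + (m - a.+1))%N) find_size.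
  have lt_c b : (b < c)%N -> (y < nth 0%N l b + (m - b.+1))%N.
    move=> bc; have := before_find 0%N bc; rewrite nthE; last by lia.
    move=> /negbT; rewrite -leqNgt leq_eqVlt => /orP[/eqP yb|//].
    by case/negP: yN; apply/mem_beta; exists b => //; lia.
  have c_lt : (c < m)%N -> (nth 0%N l c + (m - c.+1) < y)%N.
    move=> c_m; rewrite -nthE //; apply: (nth_find 0%N (a := fun z => z < y)%N).
    by rewrite has_find size_mkseq.
  have ac : (a < c)%N.
    rewrite ltnNge; apply/negP => ca; have := c_lt (leq_ltn_trans ca am).
    have := partition_nth_le pl ca; lia.
  have ym : (m <= y + c)%N.
    by case: (ltnP c m) => [/c_lt|]; lia.
  (* Of the positions below [y], m - c hold beads and y + c - m are gaps; the column index is one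
     more than the latter number. *)
  pose j := ((y + c).+1 - m)%N.
  have jc b : (b < c)%N -> (j <= nth 0%N l b)%N.
    move=> bc; have bc1 : (b <= c.-1)%N by lia.
    apply: leq_trans (partition_nth_le pl bc1); rewrite /j.
    by have := lt_c c.-1; lia.
  have cj : (nth 0%N l c < j)%N.
    case: (ltnP c m) => [/c_lt|mc]; rewrite /j; first by lia.
    rewrite nth_default; last by apply: leq_trans lm mc.
    by lia.
  have al : (a < size l)%N.
    rewrite ltnNge; apply/negP => la; have := jc a ac; rewrite nth_default // /j; lia.
  have := cl a.+1; rewrite mem_iota; have -> : (0 < a.+1 < 1 + size l)%N by lia.
  move=> /(_ isT) /allP /(_ j); rewrite mem_iota /part /=.
  have -> : (0 < j < 1 + nth 0%N l a)%N by have := jc a ac; rewrite /j; lia.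
  move=> /(_ isT); rewrite /hook /part /= (@conjP j c) //; last by rewrite /j; lia.
  have -> : (nth 0%N l a + c + 1 - (a.+1 + j) = t)%N by rewrite /j; lia.
  by rewrite dvdnn.
move=> cl; apply/allP => i; rewrite mem_iota => /andP[i0 il].
apply/allP => j; rewrite mem_iota => /andP[j0 jl].
have [a ia] : exists a, i = a.+1 by exists i.-1; lia.
rewrite ia in il jl *; have al : (a < size l)%N by lia.
rewrite /part /= in jl.
pose c := find (fun p => p < j)%N l.
have cl' : (c <= size l)%N by exact: find_size.
have cE : conj_part l j = c.
  apply: conjP => //; first by lia.
    by move=> b /(before_find 0%N) /negbT; rewrite -leqNgt.
  have [c_l|lc] := ltnP c (size l); last by rewrite nth_default.
  by apply: (nth_find 0%N (a := fun p => p < j)%N); rewrite has_find.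
have jc b : (b < c)%N -> (j <= nth 0%N l b)%N.
  by move=> /(before_find 0%N) /negbT; rewrite -leqNgt.
have cj b : (c <= b)%N -> (nth 0%N l b < j)%N.
  move=> cb; apply: leq_ltn_trans (partition_nth_le pl cb) _.
  have [c_l|lc] := ltnP c (size l); last by rewrite nth_default.
  by apply: (nth_find 0%N (a := fun p => p < j)%N); rewrite has_find.
have ac : (a < c)%N by rewrite ltnNge; apply/negP => /cj; lia.
rewrite /hook /part /= cE; apply/negP => /dvdnP[k kE].
pose x := (nth 0%N l a + (m - a.+1))%N.
have xb : x \in beta m l by apply/mem_beta; exists a => //; lia.
have iter_cl k' : (k' * t <= x)%N -> (x - k' * t)%N \in beta m l.
  elim: k' => [|k' IHk] kx; first by rewrite mul0n subn0.
  rewrite mulSn in kx *; rewrite addnC subnDA; apply: cl; last by lia.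
  by apply: IHk; lia.
have kx : (k * t <= x)%N by rewrite -kE /x; lia.
have /mem_beta[b bm bE] := iter_cl k kx.
rewrite -kE /x in bE.
case: (ltnP b c) => bc; first by have := jc b bc; lia.
by have := cj b bc; lia.
Qed.

Lemma mem_downset (J : seq nat) j : uniq J -> (forall k, k.+1 \in J -> k \in J) ->
  (j \in J) = (j < size J)%N.
Proof.
move=> uJ dJ; have down k i : k \in J -> (i <= k)%N -> i \in J.
  elim: k => [|k IHk] kJ; first by rewrite leqn0 => /eqP ->.
  by rewrite leq_eqVlt => /orP[/eqP -> //|]; rewrite ltnS; apply/IHk/dJ.
apply/idP/idP => [jJ|jl].
  rewrite -(size_iota 0 j.+1); apply: uniq_leq_size; first exact: iota_uniq.
  by move=> i; rewrite mem_iota add0n ltnS; apply: down.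
apply: contraLR jl => jJ; rewrite -leqNgt -(size_iota 0 j); apply: uniq_leq_size => // i iJ.
by rewrite mem_iota /= add0n ltnNge; apply/negP => ji; case/negP: jJ; apply: down ji.
Qed.

Definition residues (s : seq nat) (i : nat) : nat := count (fun x => x %% 5 == i)%N s.

(** The abacus with [u i] beads pushed to the bottom of runner [i]; [K] bounds the runners so that
    the positions form a finite list. *)
Definition residue_set (K : nat) (u : nat -> nat) : seq nat :=
  [seq x <- iota 0 (5 * K) | x %/ 5 < u (x %% 5)]%N.

Lemma mem_residue_set K u x : (forall i, (i < 5)%N -> (u i <= K)%N) ->
  (x \in residue_set K u) = (x %/ 5 < u (x %% 5))%N.
Proof.
move=> uK; rewrite mem_filter mem_iota /= add0n; apply: andb_idr => xu.
have := uK (x %% 5)%N; rewrite ltn_mod => /(_ isT); lia.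
Qed.

Lemma sum_residue_set K u (F : nat -> nat) : (forall i, (i < 5)%N -> (u i <= K)%N) ->
  (\sum_(x <- residue_set K u) F x = \sum_(i < 5) \sum_(j < u i) F (5 * j + i)%N)%N.
Proof.
move=> uK; rewrite big_filter big_mkcond /=.
have block G : (\sum_(x <- iota 0 (5 * K)) G x = \sum_(j < K) \sum_(i < 5) G (5 * j + i)%N)%N.
  have -> : iota 0 (5 * K) = index_iota 0 (5 * K) by rewrite /index_iota subn0.
  rewrite big_mkord; elim: K {uK} => [|K IHK]; first by rewrite muln0 !big_ord0.
  by rewrite [RHS]big_ord_recr /= -IHK mulnS addnC big_split_ord.
rewrite block exchange_big; apply: eq_bigr => i _ /=.
rewrite [RHS](big_ord_widen K (fun j => F (5 * j + i)%N)) ?uK // [RHS]big_mkcond.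
apply: eq_bigr => j _; have i5 := ltn_ord i.
have -> : ((5 * j + i) %/ 5)%N = j by lia.
by have -> : ((5 * j + i) %% 5)%N = i by lia.
Qed.

Lemma residues_residue_set K u i : (forall i, (i < 5)%N -> (u i <= K)%N) -> (i < 5)%N ->
  residues (residue_set K u) i = u i.
Proof.
move=> uK i5; rewrite /residues -sum1_count big_mkcond (sum_residue_set (fun x => if (x %% 5 == i)%N then 1%N else 0%N)) //.
have mod5 j k : (k < 5)%N -> ((5 * j + k) %% 5 = k)%N by lia.
rewrite (bigD1 (Ordinal i5)) //= [X in (_ + X)%N]big1 ?addn0 => [|k ki].
  by under eq_bigr => j _ do rewrite mod5 ?eqxx //; rewrite sum1_card card_ord.
apply: big1 => j _; rewrite mod5 //.
by case: eqP => // ki'; case/eqP: ki; apply: val_inj.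
Qed.

Lemma sum_iota5 (u i : nat) : (\sum_(j < u) (5 * j + i) = 5 * 'C(u, 2) + i * u)%N.
Proof.
by rewrite big_split /= -big_distrr /= sum_nat_const card_ord -bin2_sum big_mkord mulnC [(u * i)%N]mulnC mulnC.
Qed.

Lemma sumn_residue_set K u : (forall i, (i < 5)%N -> (u i <= K)%N) ->
  sumn (residue_set K u) = (\sum_(i < 5) (5 * 'C(u i, 2) + i * u i))%N.
Proof.
move=> uK; rewrite sumnE (sum_residue_set id) //.
by apply: eq_bigr => i _; rewrite sum_iota5.
Qed.

Lemma size_residue_set K u : (forall i, (i < 5)%N -> (u i <= K)%N) ->
  size (residue_set K u) = (\sum_(i < 5) u i)%N.
Proof.
move=> uK; rewrite -sum1_size (sum_residue_set (fun=> 1%N)) //.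
by apply: eq_bigr => i _; rewrite sum1_card card_ord.
Qed.

(** Closure under subtraction of 5 makes the beads on each runner an initial segment, which is
    determined by its length. *)
Lemma mem_closed s x : uniq s ->
  (forall y, y \in s -> (5 <= y)%N -> (y - 5)%N \in s) ->
  (x \in s) = (x %/ 5 < residues s (x %% 5))%N.
Proof.
move=> us cs; set i := (x %% 5)%N; have i5 : (i < 5)%N by rewrite ltn_mod.
pose J := [seq (y %/ 5)%N | y <- s & (y %% 5 == i)%N].
have memJ j : (j \in J) = ((5 * j + i)%N \in s).
  apply/mapP/idP => [[y]|js].
    rewrite mem_filter => /andP[/eqP yi ys] ->.
    by have -> : (5 * (y %/ 5) + i = y)%N by lia.
  by exists (5 * j + i)%N; rewrite ?mem_filter ?js; lia.
have uJ : uniq J.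
  rewrite map_inj_in_uniq ?filter_uniq // => y y'.
  by rewrite !mem_filter => /andP[/eqP yi _] /andP[/eqP yi' _]; lia.
have dJ k : k.+1 \in J -> k \in J.
  rewrite !memJ => /cs; have -> : (5 * k.+1 + i - 5 = 5 * k + i)%N by lia.
  by apply; lia.
have xE : x = (5 * (x %/ 5) + i)%N by rewrite /i; lia.
rewrite {1}xE -memJ (mem_downset _ uJ dJ) size_map size_filter.
by [].
Qed.

Lemma closed_residue_set s : uniq s ->
  (forall y, y \in s -> (5 <= y)%N -> (y - 5)%N \in s) ->
  perm_eq s (residue_set (size s) (residues s)).
Proof.
move=> us cs; apply: uniq_perm => //; first by rewrite filter_uniq ?iota_uniq.
move=> x; rewrite mem_residue_set ?(mem_closed x us cs) // => i _.
exact: count_size.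
Qed.

Lemma nth_filter_pos p a : sorted geq p ->
  nth 0%N [seq x <- p | 0 < x]%N a = nth 0%N p a.
Proof.
elim: p a => [|x p IHp] a //= xp; have sp := path_sorted xp.
case: (posnP x) => [x0|x0] /=; last by case: a => //= a; rewrite IHp.
have p0 : all (fun y => y == 0)%N p.
  move: xp; rewrite path_sortedE; last by move=> ? ? ? /= h1 h2; apply: leq_trans h2 h1.
  by move=> /andP[/allP xp _]; apply/allP => y /xp; rewrite x0 /= leqn0.
have -> : [seq y <- p | 0 < y]%N = [::].
  by apply/eqP; rewrite -(negbK (_ == _)) -has_filter; apply/hasPn => y /(allP p0) /eqP ->.
rewrite nth_nil; case: a => [|a] /=; first by rewrite x0.
have [ap|pa] := ltnP a (size p); last by rewrite nth_default.
by rewrite (eqP (allP p0 _ (mem_nth 0%N ap))).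
Qed.

Lemma eq_from_nth_pos l l' : 0%N \notin l -> 0%N \notin l' ->
  (forall a, nth 0%N l a = nth 0%N l' a) -> l = l'.
Proof.
have le k k' : 0%N \notin k -> (forall a, nth 0%N k a = nth 0%N k' a) -> (size k <= size k')%N.
  move=> k0 kk; rewrite leqNgt; apply/negP => lt_k; case/negP: k0.
  by rewrite -[X in X \in _](nth_default 0%N (leqnn (size k'))) -kk mem_nth.
move=> l0 l'0 ll; apply: (@eq_from_nth _ 0%N) => [|a _]; last exact: ll.
by apply/eqP; rewrite eqn_leq !le.
Qed.

Definition is_core5_partition (l : seq nat) : bool := is_partition l && is_core 5 l.

Lemma core_closed m l : is_core5_partition l -> (size l <= m)%N ->
  forall y, y \in beta m l -> (5 <= y)%N -> (y - 5)%N \in beta m l.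
Proof. by case/andP=> pl cl lm; apply/(core_beta (isT : 0 < 5)%N pl lm). Qed.

Lemma beta_uniq m l : is_partition l -> uniq (beta m l).
Proof.
move=> pl; apply: (sorted_uniq gtn_trans) (beta_sorted m pl).
by move=> x /=; rewrite ltnn.
Qed.

Lemma residues_beta_sum m l : is_core5_partition l -> (size l <= m)%N ->
  (\sum_(i < 5) residues (beta m l) i = m)%N /\
  (\sum_(i < 5) (5 * 'C(residues (beta m l) i, 2) + i * residues (beta m l) i)
     = sumn l + 'C(m, 2))%N.
Proof.
move=> cl lm; have /andP[pl _] := cl.
have pe := closed_residue_set (beta_uniq m pl) (core_closed cl lm).
have uK i : (i < 5)%N -> (residues (beta m l) i <= size (beta m l))%N by move=> _; apply: count_size.
rewrite -(size_residue_set uK) -(sumn_residue_set uK) -(perm_size pe) -(perm_sumn pe).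
by rewrite size_mkseq sumn_beta.
Qed.

Lemma core_inj m l l' : is_core5_partition l -> is_core5_partition l' ->
  (size l <= m)%N -> (size l' <= m)%N ->
  (forall i, (i < 5)%N -> residues (beta m l) i = residues (beta m l') i) -> l = l'.
Proof.
move=> cl cl' lm lm' uu; have /andP[pl _] := cl; have /andP[pl' _] := cl'.
have bb : beta m l = beta m l'.
  apply: (irr_sorted_eq gtn_trans) => [x|||x]; rewrite ?beta_sorted //=; first by rewrite ltnn.
  rewrite (mem_closed x (beta_uniq m pl) (core_closed cl lm)).
  rewrite (mem_closed x (beta_uniq m pl') (core_closed cl' lm')).
  by rewrite uu // ltn_mod.
case/andP: pl => _ l0; case/andP: pl' => _ l'0.
apply: eq_from_nth_pos => // a; have [am|ma] := ltnP a m.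
  by have := congr1 (fun s => nth 0%N s a) bb; rewrite !nth_beta //; lia.
by rewrite !nth_default //; [apply: leq_trans lm' ma | apply: leq_trans lm ma].
Qed.

(** Sorting the beads decreasingly, subtracting the staircase m - 1, ..., 1, 0 and dropping zero
    parts inverts [beta]. *)
Lemma core_surj m (u : nat -> nat) : (\sum_(i < 5) u i = m)%N ->
  exists l, [/\ is_core5_partition l, (size l <= m)%N &
    forall i, (i < 5)%N -> residues (beta m l) i = u i].
Proof.
move=> um; have uK i : (i < 5)%N -> (u i <= m)%N.
  by move=> i5; rewrite -um (bigD1 (Ordinal i5)) //= leq_addr.
pose s := rev (residue_set m u).
have ss : sorted gtn s.
  by rewrite rev_sorted; apply: sorted_filter (iota_ltn_sorted _ _); apply: ltn_trans.
have szs : size s = m by rewrite size_rev size_residue_set.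
have s_lt a b : (a < b < m)%N -> (nth 0%N s b < nth 0%N s a)%N.
  move=> /andP[ab bm]; have := sorted_ltn_nth gtn_trans 0%N ss.
  by apply=> //; rewrite inE szs //; apply: ltn_trans bm.
(* This keeps the subtraction in [p] below from being truncated. *)
have s_ge a : (a < m)%N -> (m - a.+1 <= nth 0%N s a)%N.
  move=> am; have [k kE] : exists k, (k + a.+1)%N = m by exists (m - a.+1)%N; lia.
  elim: k a am kE => [|k IHk] a am kE; first by lia.
  have := IHk a.+1; have := @s_lt a a.+1; lia.
pose p := mkseq (fun a => nth 0%N s a - (m - a.+1))%N m.
have ps : sorted geq p.
  apply/(sortedP 0%N) => a; rewrite size_mkseq => am /=.
  rewrite !nth_mkseq //; last by lia.
  have := @s_lt a a.+1; have := s_ge a; have := s_ge a.+1; lia.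
pose l := [seq x <- p | 0 < x]%N.
have lm : (size l <= m)%N by rewrite size_filter -[X in (_ <= X)%N](size_mkseq (fun a => nth 0%N s a - (m - a.+1))%N) count_size.
have bl : beta m l = s.
  apply: (@eq_from_nth _ 0%N); first by rewrite size_mkseq szs.
  move=> a; rewrite size_mkseq => am; rewrite nth_beta // nth_filter_pos // nth_mkseq //.
  by rewrite subnK // s_ge.
have mem_s x : (x \in s) = (x %/ 5 < u (x %% 5))%N by rewrite mem_rev mem_residue_set.
have pl : is_partition l.
  rewrite /is_partition mem_filter ltnn /= andbT.
  by apply: sorted_filter ps; move=> x y z /= yx xz; apply: leq_trans xz yx.
exists l; split=> //.
  apply/andP; split => //; apply/(core_beta (isT : 0 < 5)%N pl lm) => x; rewrite bl !mem_s => xu x5.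
  have -> : ((x - 5) %% 5 = x %% 5)%N by lia.
  by lia.
move=> i i5; rewrite bl /residues /s count_rev; exact: residues_residue_set.
Qed.

End BetaSets.

(** * The generating function of 5-cores *)

Section CoreSeries.
Local Notation e := (eta int).
Local Notation q := (qX : series int).

Definition core5 := {l : seq nat | is_core5_partition l}.

Definition core_series : series int := Series (fun n => (num_cores 5 n)%:Z).

Definition core_size (l : core5) : int := (sumn (val l))%:Z.

Lemma size_le_sumn l : 0%N \notin l -> (size l <= sumn l)%N.
Proof.
elim: l => //= x l IHl; rewrite inE negb_or eq_sym -lt0n => /andP[x0 /IHl szl].
by rewrite -add1n leq_add.
Qed.

Lemma empty_core : is_core5_partition [::]. Proof. by []. Qed.

Lemma core_series_lat : core_series = lat (fun _ : core5 => 1) core_size.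
Proof.
apply: seriesP => n /=; rewrite /num_cores -sum1_card -[RHS]/(\sum_(i \in _) 1).
pose A := [set b : {bseq n of 'I_n.+1} |
   let p := [seq nat_of_ord x | x <- b] in [&& is_partition p, sumn p == n & is_core 5 p]]%SET.
pose h (b : {bseq n of 'I_n.+1}) : core5 :=
  insubd (exist _ [::] empty_core) [seq nat_of_ord x | x <- b].
have hE b : b \in A -> val (h b) = [seq nat_of_ord x | x <- b].
  rewrite inE => /and3P[pb _ cb]; rewrite val_insubd.
  by rewrite /is_core5_partition pb cb.
rewrite (reindex_fsbig h [set` A]).
  rewrite -(@bigfs _ _ _ _ (index_enum {bseq n of 'I_n.+1}) (mem A)) ?index_enum_uniq //; last first.
    by move=> i _; rewrite mem_index_enum.
  by rewrite -/A; elim/big_rec2: _ => // b x y _ <-; rewrite PoszD.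
split.
- move=> b /= bA; rewrite /core_size hE //.
  by move: bA; rewrite inE => /and3P[_ /eqP -> _].
- move=> b b' /set_mem bA /set_mem bA' bb; have := congr1 val bb; rewrite !hE // => eq_b.
  by apply: val_inj; apply: (inj_map val_inj).
move=> [l cl] /=; rewrite /core_size /= => -[ln].
have /andP[pl cl'] := cl; have [b bE] := partition_bounded pl ln.
have bA : b \in A by rewrite inE; apply/and3P; rewrite -bE; split => //; apply/eqP.
by exists b => //; apply: val_inj; rewrite hE.
Qed.

Lemma summable_core_size : summable core_size.
Proof.
split=> // N; have cov : [set l | core_size l < N%:Z] `<=`
    \bigcup_(n in `I_N) ((fun b : {bseq n of 'I_n.+1} =>
      insubd (exist _ [::] empty_core : core5) [seq nat_of_ord x | x <- b]) @` setT).
  move=> [l cl]; rewrite /core_size /= ltz_nat => lN; exists (sumn l) => //=.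
  have /andP[pl _] := cl; have [b bE] := partition_bounded pl (erefl (sumn l)).
  exists b => //; apply: val_inj; rewrite val_insubd -bE /=.
  by rewrite cl.
apply: sub_finite_set cov _; apply: bigcup_finite => [|n _]; first exact: finite_II.
by apply: finite_image; apply: finite_finset.
Qed.

(** The right-hand side is the size of the core. The exponents centred at [r] exceed it by [tri s],
    independently of [r]; this surplus is the weight of the charge [s] in [core_lattice]. *)
Lemma core_energy (u0 u1 u2 u3 u4 m r : nat) (s : int) :
  m%:Z = 5 * r%:Z + s :> int -> (u0 + u1 + u2 + u3 + u4 = m)%N ->
  theta_exp 5 0 (u0%:Z - r%:Z) + (theta_exp 5 1 (u1%:Z - r%:Z) +
    (theta_exp 5 2 (u2%:Z - r%:Z) + (theta_exp 5 3 (u3%:Z - r%:Z) +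
    theta_exp 5 4 (u4%:Z - r%:Z)))) - theta_exp 1 0 s =
  (5 * 'C(u0, 2) + 0 * u0 + (5 * 'C(u1, 2) + 1 * u1) + (5 * 'C(u2, 2) + 2 * u2)
   + (5 * 'C(u3, 2) + 3 * u3) + (5 * 'C(u4, 2) + 4 * u4))%N%:Z - 'C(m, 2)%:Z :> int.
Proof.
move=> ms um; have sE : s = u0%:Z + u1%:Z + u2%:Z + u3%:Z + u4%:Z - 5 * r%:Z by lia.
have mE : m%:Z = u0%:Z + u1%:Z + u2%:Z + u3%:Z + u4%:Z by lia.
have binE (k : nat) : 2 * 'C(k, 2)%:Z = k%:Z * (k%:Z - 1) by rewrite -tri_bin tri2.
apply: (@mulfI _ (2 : int)) => //.
transitivity (2 * theta_exp 5 0 (u0%:Z - r%:Z) + (2 * theta_exp 5 1 (u1%:Z - r%:Z) +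
    (2 * theta_exp 5 2 (u2%:Z - r%:Z) + (2 * theta_exp 5 3 (u3%:Z - r%:Z) +
    2 * theta_exp 5 4 (u4%:Z - r%:Z)))) - 2 * theta_exp 1 0 s); first by ring.
transitivity (5 * (2 * 'C(u0, 2)%:Z) + (5 * (2 * 'C(u1, 2)%:Z) + 2 * u1%:Z)
   + (5 * (2 * 'C(u2, 2)%:Z) + 4 * u2%:Z) + (5 * (2 * 'C(u3, 2)%:Z) + 6 * u3%:Z)
   + (5 * (2 * 'C(u4, 2)%:Z) + 8 * u4%:Z) - 2 * 'C(m, 2)%:Z); last by lia.
by rewrite !theta_exp2 !binE mE sE; ring.
Qed.

Definition quintuple := (int * (int * (int * (int * int))))%type.

Definition quintuple_exp (v : quintuple) : int :=
  theta_exp 5 0 v.1 + (theta_exp 5 1 v.2.1 + (theta_exp 5 2 v.2.2.1 +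
  (theta_exp 5 3 v.2.2.2.1 + theta_exp 5 4 v.2.2.2.2))).

(* The five abacus runners of a 5-core, whose beta set of size [m = 5 r + s]
   has [v_i + r] elements congruent to [i] modulo 5.  The shift [r] only has to
   be large, and is chosen once the coefficient is fixed. *)
Definition runners (r : nat) (p : int * core5) : quintuple :=
  let u i : int := (residues (beta (absz (5 * r%:Z + p.1)) (val p.2)) i)%:Z - r%:Z in
  (u 0%N, (u 1%N, (u 2%N, (u 3%N, u 4%N)))).

(** The centred bead counts of a core add up to the charge [s]. With [s] summed over Z as well, they
    range over all integer quintuples, and the right-hand sum factors into theta series. *)
Lemma core_lattice :
  lat (fun _ : int * core5 => 1) (fun p => theta_exp 1 0 p.1 + core_size p.2)
  = lat (fun _ : quintuple => 1) quintuple_exp :> series int.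
Proof.
have th0 (i : nat) (x : int) : (i < 5)%N -> 0 <= theta_exp 5 i x.
  by move=> i5; apply: theta_exp_ge0 => //; apply: ltnW.
have thx (i : nat) (x : int) : (i < 5)%N -> (absz x)%:Z <= theta_exp 5 i x + 1.
  by move=> i5; apply: theta_exp_ge => //; apply: ltnW.
have sum5 (F : nat -> nat) : (\sum_(i < 5) F i = F 0 + F 1 + F 2 + F 3 + F 4)%N.
  by rewrite 5!big_ord_recr big_ord0 /= add0n.
(* Every exponent at [n] involves integers of absolute value at most n + 1, and the core has at most
   n parts. So r = n + 2 makes all bead counts nonnegative and leaves at least as many beads as
   parts. *)
apply: seriesP => n /=; apply/esym; have [r rE] : exists r : nat, r%:Z = n%:Z + 2 by exists (n + 2)%N.
apply: (reindex_fsbig (runners r)).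
have dom (s : int) (l : core5) : theta_exp 1 0 s + core_size l = n%:Z :> int ->
    exists m : nat, [/\ absz (5 * r%:Z + s) = m, m%:Z = 5 * r%:Z + s & (size (val l) <= m)%N].
  move=> sl; have ge1 := @theta_exp_ge 1 0 isT isT s; have ge0 := @theta_exp_ge0 1 0 isT isT s.
  have l0 : 0%N \notin val l by have /andP[/andP[_ ?] _] := valP l.
  have szl := size_le_sumn l0; rewrite /core_size in sl.
  exists (absz (5 * r%:Z + s)); move: (sumn _) (size _) sl szl => a b sl szl.
  by split=> //; lia.
split.
- move=> [s l] /= sl; have [m [mE ms lm]] := dom s l sl.
  have [um uE] := residues_beta_sum (valP l) lm; rewrite sum5 in um.
  rewrite (sum5 (fun i => 5 * 'C(residues (beta m (val l)) i, 2) + i * residues (beta m (val l)) i)%N) in uE.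
  rewrite /quintuple_exp /runners /= mE.
  have := core_energy ms um; rewrite uE.
  rewrite PoszD addrK => /(canRL (subrK _)) /= ->.
  by rewrite addrC.
- move=> [s l] [s' l'] /set_mem /= sl /set_mem /= sl'.
  have [m [mE ms lm]] := dom s l sl; have [m' [mE' ms' lm']] := dom s' l' sl'.
  have [um _] := residues_beta_sum (valP l) lm; rewrite sum5 in um.
  have [um' _] := residues_beta_sum (valP l') lm'; rewrite sum5 in um'.
  rewrite /runners /= mE mE' => -[] /addIr [u0] /addIr [u1] /addIr [u2] /addIr [u3] /addIr [u4].
  have mm : m' = m by rewrite -um -um' u0 u1 u2 u3 u4.
  rewrite mm in ms' u0 u1 u2 u3 u4 lm'.
  have -> : s' = s by lia.
  congr (_, _); apply: val_inj; apply: (@core_inj m) => //; try exact: valP.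
  by case=> [|[|[|[|[|i]]]]].
move=> [v0 [v1 [v2 [v3 v4]]]] /=; rewrite /quintuple_exp /= => vn.
have v_r i x : (i < 5)%N -> theta_exp 5 i x <= n%:Z -> exists u : nat, u%:Z = x + r%:Z :> int.
  by move=> i5 xn; exists (absz (x + r%:Z)); have := thx i x i5; lia.
have t0 := th0 0%N v0 isT; have t1 := th0 1%N v1 isT; have t2 := th0 2 v2 isT.
have t3 := th0 3 v3 isT; have t4 := th0 4 v4 isT.
have le5 (a b c d f k : int) : 0 <= a -> 0 <= b -> 0 <= c -> 0 <= d -> 0 <= f ->
    a + (b + (c + (d + f))) = k -> [/\ a <= k, b <= k, c <= k, d <= k & f <= k].
  by move=> *; split; lia.
have [l0 l1 l2 l3 l4] := le5 _ _ _ _ _ _ t0 t1 t2 t3 t4 vn.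
have [u0 u0E] := v_r 0%N v0 isT l0; have [u1 u1E] := v_r 1%N v1 isT l1.
have [u2 u2E] := v_r 2 v2 isT l2; have [u3 u3E] := v_r 3 v3 isT l3.
have [u4 u4E] := v_r 4 v4 isT l4.
pose u i := nth 0%N [:: u0; u1; u2; u3; u4] i.
pose m := (u0 + u1 + u2 + u3 + u4)%N.
have um : (\sum_(i < 5) u i = m)%N by rewrite sum5.
have [l [cl lm ul]] := core_surj um.
pose s : int := m%:Z - 5 * r%:Z.
have ms : m%:Z = 5 * r%:Z + s :> int by rewrite /s; lia.
have mE : absz (5 * r%:Z + s) = m by rewrite -ms.
have [_ uE] := residues_beta_sum cl lm; rewrite (sum5 (fun i => 5 * 'C(residues (beta m l) i, 2) + i * residues (beta m l) i)%N) !ul // in uE.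
exists (s, exist _ l cl : core5); last first.
  by rewrite /runners /= mE !ul //= /u /= u0E u1E u2E u3E u4E !addrK.
have := core_energy ms (erefl m); rewrite /u /= in uE; rewrite uE /= /core_size /=.
rewrite u0E u1E u2E u3E u4E !addrK; lia.
Qed.

Lemma theta_reflect A B : (0 < A)%N -> (B <= A)%N ->
  theta 1 A (A - B) = theta 1 A B :> series int.
Proof.
move=> A0 BA; rewrite theta.unlock; apply: (lat_bij (bij_reflect 0)) => k.
  by rewrite !expr1n.
apply: (@mulfI _ (2 : int)) => //; rewrite !theta_exp2.
have -> : (A - B)%N%:Z = A%:Z - B%:Z by lia.
by ring.
Qed.

(** The reflection of the index pairs the theta series for residues 1, 4 and 2, 3, whence the
    product in [core_lattice] is the triangular series at q^5 times G^2. Eta quotients do the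
    rest. *)
Theorem core_series_eta : core_series * e 1 = e 5 ^+ 5.
Proof.
have TC : triangular int * core_series = dil 5 (triangular int) * G int ^+ 2.
  transitivity (theta 1 5 0 * (theta 1 5 1 * (theta 1 5 2 * (theta 1 5 3 * theta 1 5 4))) : series int).
    have th A B : (0 < A)%N -> (B <= A)%N -> theta 1 A B = lat (fun _ : int => 1) (theta_exp A B) :> series int.
      by move=> A0 BA; rewrite theta.unlock; apply: eq_lat => // k; rewrite expr1n.
    have s5 B : (B <= 5)%N -> summable (theta_exp 5 B) by move=> B5; apply: summable_theta.
    rewrite /triangular !th // core_series_lat.
    rewrite (latM _ _ (@summable_theta 1 0 isT isT) summable_core_size).
    have s34 := summable_pair (s5 3 isT) (s5 4 isT).
    have s234 := summable_pair (s5 2 isT) s34.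
    have s1234 := summable_pair (s5 1%N isT) s234.
    rewrite (latM _ _ (s5 3 isT) (s5 4 isT)) (latM _ _ (s5 2 isT) s34).
    rewrite (latM _ _ (s5 1%N isT) s234) (latM _ _ (s5 0%N isT) s1234).
    rewrite !mulr1; exact: core_lattice.
  rewrite /triangular dil_theta // (@theta_reflect 5 2 isT isT) (@theta_reflect 5 1 isT isT) /G; ring.
have h1 := psi_eta int; have hG := G_eta int.
have h5 : dil 5 (psi int) * e 5 = e 10 ^+ 2 := dil_psi_eta (isT : 0 < 5)%N.
rewrite triangular_psi rmorphM rmorph_nat /= in TC.
apply: (@mulfI _ (2%:R * (e 2 ^+ 2 * e 10 ^+ 2 * e 5))).
  by rewrite ?(mulf_neq0, expf_neq0, eta_neq0) // (natr_series_neq0 1).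
transitivity (2%:R * psi int * core_series * (e 1 ^+ 2 * e 10 ^+ 2 * e 5)).
  by rewrite -h1; ring.
rewrite TC.
transitivity (2%:R * (dil 5 (psi int) * e 5) * (G int * (e 1 * e 10)) ^+ 2); first by ring.
by rewrite h5 hG; ring.
Qed.

End CoreSeries.

(** * Coefficient relations *)

Section CoreIdentities.
Local Notation e := (eta int).
Local Notation q := (qX : series int).

Lemma exprz_sign (k : int) : (-1 : int) ^ k = (-1) ^+ `|k|%N.
Proof.
by case: k => n //; rewrite NegzE -exprnN absz_nat abszN.
Qed.

Lemma phi_neg_series : Series phi_neg = phi (-1).
Proof.
rewrite /phi theta.unlock; apply: seriesP => m /=.
have thE (k : int) : theta_exp 2 1 k = k ^+ 2.
  by apply: (@mulfI _ (2 : int)) => //; rewrite theta_exp2; ring.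
pose s : seq int := [seq i%:Z - m%:Z | i <- iota 0 (2 * m).+1].
rewrite -[RHS]/(coef (lat _ _) m) (@coef_lat _ _ _ _ s); first last.
- move=> k; rewrite thE => km; have k_m : (absz k <= m)%N by nia.
  have -> : k = (absz (k + m%:Z))%:Z - m%:Z by lia.
  by apply: (map_f (fun i : nat => i%:Z - m%:Z : int)); rewrite mem_iota; lia.
- by rewrite map_inj_uniq ?iota_uniq // => i j; lia.
by apply: eq_big => [k|k _]; [rewrite thE | exact: exprz_sign].
Qed.

Lemma psi_neg_series : Series psi_neg = scal (-1) (psi int).
Proof.
(* The solution of 2 n^2 - n = k(k+1)/2: n = (k+1)/2 for odd k and n = -k/2 for even k. *)
pose h (k : nat) : int := if odd k then (uphalf k)%:Z else - (k./2)%:Z.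
have hB : bijective h.
  exists (fun n : int => if 0 < n then (2 * absz n).-1 else (2 * absz n)%N) => [k|n]; rewrite /h.
    have kE := odd_double_half k; have uE := uphalf_half k.
    by case: (odd k) kE uE => /= kE uE; case: ifP => ?; lia.
  case: (ltP 0 n) => n0.
    have [i iE] : exists i : nat, n = i.+1%:Z by exists (absz n).-1; lia.
    rewrite iE; have -> : ((2 * absz i.+1%:Z).-1 = i.*2.+1)%N by lia.
    by rewrite /= odd_double /= doubleK.
  have [i iE] : exists i : nat, n = - i%:Z by exists (absz n); lia.
  rewrite iE; have -> : (2 * absz (- i%:Z) = i.*2)%N by lia.
  by rewrite odd_double doubleK.
have hE k : theta_exp 4 1 (h k) = (k * k.+1 %/ 2)%N%:Z.
  apply: (@mulfI _ (2 : int)) => //; rewrite theta_exp2 /h.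
  have -> : 2 * (k * k.+1 %/ 2)%N%:Z = k%:Z * (k%:Z + 1) :> int.
    have : (2 %| k * k.+1)%N by rewrite dvdn2 oddM /=; case: (odd k).
    nia.
  have kE := odd_double_half k; case: ifP => ko; rewrite ko /= in kE.
    have -> : (uphalf k)%:Z = (k./2)%:Z + 1 by lia.
    by rewrite -[k in RHS]kE -mul2n PoszD PoszM; ring.
  by rewrite -[k in RHS]kE -mul2n PoszD PoszM; ring.
rewrite /psi theta.unlock -(lat_reindex _ _ hB); apply: seriesP => m /=.
rewrite -[X in _ = _ * X]/(coef (lat _ _) m) (@coef_lat _ _ _ _ (index_iota 0 m.+1)); first last.
- by move=> k /=; rewrite hE => -[km]; rewrite mem_index_iota; nia.
- exact: iota_uniq.
rewrite big_mkord /psi_neg mulr_sumr; apply: eq_big => [k|k /eqP ->]; first by rewrite /= hE.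
by rewrite /= expr1n mulr1.
Qed.

Lemma fps_mul_series f g : Series (fps_mul f g) = Series f * Series g :> series int.
Proof. by []. Qed.

Lemma fps_exp_series f k : Series (fps_exp f k) = Series f ^+ k :> series int.
Proof. by elim: k => [|k IHk]; [apply: seriesP | rewrite exprS -IHk]. Qed.

Lemma fps_inv_series f : f 0%N = 1 -> Series (fps_inv f) * Series f = 1 :> series int.
Proof. by move=> f0; rewrite mulrC; apply: seriesP => n; exact: fps_mulV. Qed.

Lemma abar5_relation : Series abar5_series * phi (-1) = dil 5 (phi (-1)) ^+ 5.
Proof.
rewrite /abar5_series fps_mul_series fps_exp_series -phi_neg_series -mulrA.
by rewrite fps_inv_series ?mulr1 // /phi_neg /= big_cons big_nil addr0.
Qed.

(** Since 5 is odd, the substitutions of -q and of q^5 for q commute, which brings the definition to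
    the form required by [psi_quotient]. *)
Lemma bbar5_relation : scal (-1) (Series bbar5_series) * psi int = dil 5 (psi int) ^+ 5.
Proof.
have scalK : involutive (scal (-1 : int)).
  by move=> f; apply: seriesP => n /=; rewrite mulrA -exprMn mulrNN mulr1 expr1n mul1r.
have scal_dil : scal (-1) (dil 5 (scal (-1) (psi int))) = dil 5 (psi int).
  apply: seriesP => n /=; case: ifP => [/dvdnP[m ->]|]; last by rewrite mulr0.
  rewrite mulnK // mulrA -exprD (_ : m * 5 + m = 2 * (3 * m))%N; last by lia.
  by rewrite exprM sqrrN expr1n mul1r.
have /(congr1 (scal (-1))) : Series bbar5_series * scal (-1) (psi int)
    = dil 5 (scal (-1) (psi int)) ^+ 5.
  rewrite /bbar5_series fps_mul_series fps_exp_series -psi_neg_series -mulrA.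
  by rewrite fps_inv_series ?mulr1 // /psi_neg big_mkcond big_ord_recl big_ord0.
by rewrite rmorphM rmorphXn /= scalK scal_dil.
Qed.

Let X := q * core_series.
Let Y := e 1 ^+ 5 * Series (fps_inv (coef (e 5))).

Let XE : X * e 1 = q * e 5 ^+ 5.
Proof. by rewrite -mulrA core_series_eta. Qed.

Let YE : Y * e 5 = e 1 ^+ 5.
Proof.
rewrite /Y -mulrA; have eE : e 5 = Series (coef (e 5)) by case: (e 5).
by rewrite {2}eE fps_inv_series ?coef0_eta // mulr1.
Qed.

Local Notation x := (coef X).
Local Notation y := (coef Y).

Let xS n : x n.+1 = c5 n.
Proof. by rewrite coef_qXM. Qed.

Let abar_coef n : 5 * abar5 n%:Z = 15 * x n + 20 * fps_dilate 2 x n + y n + 4 * fps_dilate 2 y n.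
Proof.
have := congr1 (fun f => coef f n) (phi_quotient XE YE abar5_relation).
by rewrite !coefD_series !coef_natrM.
Qed.

Let bbar_coef n : 20 * ((-1) ^+ n * bbar5 n%:Z) =
  5 * x (n + 3) - 15 * fps_dilate 2 x (n + 3)%N + y (n + 3) - fps_dilate 2 y (n + 3)%N.
Proof.
have := congr1 (fun f => coef f (n + 3)%N) (psi_quotient XE YE bbar5_relation).
rewrite coefB_series coefD_series coefB_series !coef_natrM coef_qXnM.
by rewrite ltnNge leq_addl addnK.
Qed.

Let x5 n : x (5 * n) = 5 * x n.
Proof.
have [H _] := five_dissection_relations XE YE.
have := congr1 (fun f => coef f (5 * n)%N) H.
rewrite coef_natrM coef_dil // => <-.
by rewrite /= modnMr.
Qed.

Let y5 n : y (5 * n) = y n.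
Proof.
have [_ H] := five_dissection_relations XE YE.
have := congr1 (fun f => coef f (5 * n)%N) H.
rewrite coefB_series coef_dil // coef_natrM /= /chi5 modnMr /=.
by rewrite mul0r mulr0 subr0.
Qed.

Let y_chi n : ~~ (5 %| n)%N -> y n = - 5 * chi5 n * x n.
Proof.
move=> n5; have [_ H] := five_dissection_relations XE YE.
have := congr1 (fun f => coef f n) H.
by rewrite coefB_series coef_natrM /= (negPf n5) sub0r mulrA !mulNr.
Qed.

Let x2 n : x (2 * n) = x n + 2 * fps_dilate 2 x n.
Proof.
have := congr1 (fun f => coef f (2 * n)%N) (quintic_two_dissection XE).
have -> : coef (part_of 2 0 X) (2 * n) = x (2 * n) by rewrite /= modnMr eqxx.
rewrite coefD_series coef_natrM coef_dil // => ->; congr (_ + _ * _).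
by rewrite -[dil 4 X](@dil_dil int 2 2) coef_dil.
Qed.

Let dilate_even (f : fps) n : fps_dilate 2 f (2 * n)%N = f n.
Proof. by rewrite /fps_dilate dvdn_mulr // mulKn. Qed.

Let dilate_odd (f : fps) n : fps_dilate 2 f (2 * n + 1)%N = 0.
Proof. by rewrite /fps_dilate (_ : (2 %| 2 * n + 1)%N = false) //; lia. Qed.

Let x_even n m : m = (2 * n)%N -> x (2 * m) = x m + 2 * x n.
Proof. by move=> ->; rewrite x2 dilate_even. Qed.

Let x_odd n : odd n -> x (2 * n) = x n.
Proof.
move=> no; rewrite x2; have -> : n = (2 * n./2 + 1)%N by lia.
by rewrite dilate_odd mulr0 addr0.
Qed.

Let chi5_double n : chi5 (2 * n) = - chi5 n.
Proof.
rewrite /chi5 -modnMmr; have: (n %% 5 < 5)%N by rewrite ltn_mod.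
by case: (n %% 5)%N => [|[|[|[|[|]]]]].
Qed.

Let y_square n : (n %% 5 == 1)%N || (n %% 5 == 4)%N -> y n = - 5 * x n.
Proof. by move=> nr; rewrite y_chi /chi5 1?mulrC; [case/orP: nr => /eqP-> /=; ring | lia]. Qed.

Let y_nonsquare n : (n %% 5 == 2)%N || (n %% 5 == 3)%N -> y n = 5 * x n.
Proof. by move=> nr; rewrite y_chi /chi5 1?mulrC; [case/orP: nr => /eqP-> /=; ring | lia]. Qed.

(* Invariance under n -> 5n reduces statements about y to indices prime to 5,
   where y is a multiple of x. *)
Let strip5 (P : nat -> Prop) : P 0%N -> (forall n, P n -> P (5 * n)%N) ->
  (forall n, ~~ (5 %| n)%N -> P n) -> forall n, P n.
Proof.
move=> P0 P5 Pn; elim/ltn_ind => n IHn; have [/dvdnP[m nE]|/Pn //] := boolP (5 %| n)%N.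
case: n nE IHn => // n nE IHn; rewrite nE mulnC; apply: P5; apply: IHn; lia.
Qed.

(** The Hecke relation x(4n) = x(2n) + 2 x(n), with signs changed by (2/5) = -1 and (4/5) = 1. *)
Let y4 n : y (2 * (2 * n)) + y (2 * n) = 2 * y n.
Proof.
elim/strip5: n => [|n|n n5]; first by rewrite !muln0; ring.
  by rewrite !(mulnCA _ 5) !y5.
rewrite !y_chi; try lia.
by rewrite !chi5_double (@x_even n) //; ring.
Qed.

Let y_odd n : odd n -> y (2 * n) = - y n.
Proof.
elim/strip5: n => // [n|n n5]; first by rewrite (mulnCA _ 5) !y5 oddM.
by move=> no; rewrite !y_chi ?chi5_double ?x_odd //; first ring; lia.
Qed.

Let abar_odd n : odd n -> 5 * abar5 n = 15 * x n + y n.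
Proof.
move=> no; rewrite abar_coef; have -> : n = (2 * n./2 + 1)%N by lia.
by rewrite !dilate_odd !mulr0 !addr0.
Qed.

(** The shift by 3 is the factor q^3 of [psi_quotient]. For [n] prime to 5 the right-hand side is 10
    x(n) if n is a nonresidue modulo 5, and 0 if it is a residue. *)
Let bbar_even m n : odd n -> (m + 3 = n)%N -> 20 * bbar5 m = 5 * x n + y n.
Proof.
move=> no mn; have := bbar_coef m; rewrite -signr_odd mn (_ : odd m = false); last lia.
rewrite mul1r => ->; have -> : n = (2 * n./2 + 1)%N by lia.
by rewrite !dilate_odd mulr0 !subr0.
Qed.

(** As (2/5) = -1, for n prime to 5 the signs of y at n and 2n are opposite relative to x. The
    right-hand side is 20 x(n) for a nonresidue n and 10 x(n) - 10 x(2n) for a residue, where the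
    two-dissection applies. *)
Let bbar_odd m n : (m + 3 = 2 * n)%N ->
  20 * bbar5 m = - 5 * x (2 * n) + 15 * x n - y (2 * n) + y n.
Proof.
move=> mn; have := bbar_coef m; rewrite -signr_odd mn !dilate_even (_ : odd m = true); last lia.
by rewrite expr1 mulN1r; lia.
Qed.

Lemma bbar5_4n1 n : bbar5 (4 * n + 1)%N = c5 n - 2 * bbar5 (2 * n%:Z - 1).
Proof.
have h := @bbar_odd (4 * n + 1) (2 * n.+1) ltac:(lia).
have h4 := y4 n.+1; have hx := @x_even n.+1 _ erefl; rewrite -xS.
case: n h h4 hx => [|n] h h4 hx.
  (* Here the index 2 n - 1 is negative and [bbar5] is 0 by convention, so the values at 1 and 2 are
     computed directly. *)
  have hx1 := x_odd (isT : odd 1).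
  have h1 := @y_square 1 erefl; have h2 := @y_nonsquare (2 * 1) erefl.
  by rewrite (_ : bbar5 (2 * 0%:Z - 1) = 0) //; lia.
have -> : 2 * n.+1%:Z - 1 = (2 * n + 1)%N :> int by lia.
by have h' := @bbar_odd (2 * n + 1) n.+2 ltac:(lia); lia.
Qed.

Lemma bbar5_10n n : 2 * bbar5 (10 * n)%N = c5 (10 * n + 2)%N.
Proof.
have h := @bbar_even (10 * n) (10 * n + 2).+1 ltac:(lia) ltac:(lia).
have h1 := @y_nonsquare (10 * n + 2).+1 ltac:(lia).
rewrite -xS; lia.
Qed.

Lemma bbar5_10n1 n : bbar5 (10 * n + 1)%N = c5 (5 * n + 1)%N.
Proof.
have h := @bbar_odd (10 * n + 1) (5 * n + 1).+1 ltac:(lia).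
have h1 := @y_nonsquare (5 * n + 1).+1 ltac:(lia).
have h2 := @y_square (2 * (5 * n + 1).+1) ltac:(lia).
rewrite -xS; lia.
Qed.

(** With k = 2n + 1, the shifted index is 5 k and 25 x(k) + y(k) = (15 x(k) + y(k)) + 10 x(k). *)
Lemma bbar5_10n2 n :
  4 * bbar5 (10 * n + 2)%N = abar5 (2 * n + 1)%N + 2 * c5 (2 * n)%N.
Proof.
have h := @bbar_even (10 * n + 2) (5 * (2 * n + 1)) ltac:(lia) ltac:(lia).
have h1 := @abar_odd (2 * n + 1) ltac:(lia).
rewrite x5 y5 in h; rewrite -xS -[(2 * n).+1]addn1; lia.
Qed.

Lemma bbar5_10n3 n : bbar5 (10 * n + 3)%N = c5 (5 * n + 2)%N.
Proof.
have h := @bbar_odd (10 * n + 3) (5 * n + 2).+1 ltac:(lia).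
have h1 := @y_nonsquare (5 * n + 2).+1 ltac:(lia).
have h2 := @y_square (2 * (5 * n + 2).+1) ltac:(lia).
rewrite -xS; lia.
Qed.

Lemma bbar5_10n4 n : 2 * bbar5 (10 * n + 4)%N = c5 (10 * n + 6)%N.
Proof.
have h := @bbar_even (10 * n + 4) (10 * n + 6).+1 ltac:(lia) ltac:(lia).
have h1 := @y_nonsquare (10 * n + 6).+1 ltac:(lia).
rewrite -xS; lia.
Qed.

Lemma bbar5_10n6 n : bbar5 (10 * n + 6)%N = 0.
Proof.
have h := @bbar_even (10 * n + 6) (10 * n + 9) ltac:(lia) ltac:(lia).
have h1 := @y_square (10 * n + 9) ltac:(lia).
lia.
Qed.

Lemma bbar5_10n8 n : bbar5 (10 * n + 8)%N = 0.
Proof.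
have h := @bbar_even (10 * n + 8) (10 * n + 11) ltac:(lia) ltac:(lia).
have h1 := @y_square (10 * n + 11) ltac:(lia).
lia.
Qed.

Lemma bbar5_20n5 n : bbar5 (20 * n + 5)%N = - c5 (5 * n + 1)%N.
Proof.
pose k := (2 * (5 * n + 1).+1)%N.
have h := @bbar_odd (20 * n + 5) k ltac:(lia).
have h1 := @y_square k ltac:(lia); have h2 := @y_nonsquare (2 * k) ltac:(lia).
have h3 := @x_even (5 * n + 1).+1 k erefl.
rewrite -xS; lia.
Qed.

(** With k = 2n + 1, the indices are 10 k and 5 k; as k is odd, x(2k) = x(k) and y(2k) = - y(k),
    which leaves 50 x(k) + 2 y(k). *)
Lemma bbar5_20n7 n :
  2 * bbar5 (20 * n + 7)%N = abar5 (2 * n + 1)%N + 2 * c5 (2 * n)%N.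
Proof.
have h := @bbar_odd (20 * n + 7) (5 * (2 * n + 1)) ltac:(lia).
have h1 := @abar_odd (2 * n + 1) ltac:(lia).
rewrite mulnCA !x5 !y5 x_odd ?y_odd in h; try lia.
rewrite -xS -[(2 * n).+1]addn1; lia.
Qed.

Lemma bbar5_20n9 n : bbar5 (20 * n + 9)%N = - c5 (5 * n + 2)%N.
Proof.
pose k := (2 * (5 * n + 2).+1)%N.
have h := @bbar_odd (20 * n + 9) k ltac:(lia).
have h1 := @y_square k ltac:(lia); have h2 := @y_nonsquare (2 * k) ltac:(lia).
have h3 := @x_even (5 * n + 2).+1 k erefl.
rewrite -xS; lia.
Qed.

Lemma bbar5_20n15 n : bbar5 (20 * n + 15)%N = 0.
Proof.
pose k := (10 * n + 9)%N; have h := @bbar_odd (20 * n + 15) k ltac:(lia).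
have h1 := @y_square k ltac:(lia); have h2 := @y_nonsquare (2 * k) ltac:(lia).
have h3 := @x_odd k ltac:(lia).
lia.
Qed.

Lemma bbar5_20n19 n : bbar5 (20 * n + 19)%N = 0.
Proof.
pose k := (10 * n + 11)%N; have h := @bbar_odd (20 * n + 19) k ltac:(lia).
have h1 := @y_square k ltac:(lia); have h2 := @y_nonsquare (2 * k) ltac:(lia).
have h3 := @x_odd k ltac:(lia).
lia.
Qed.

End CoreIdentities.

Theorem theorem5 (n : nat) :
  bbar5 (4 * n + 1)%N = c5 n - 2 * bbar5 (2 * n%:Z - 1) /\
  (bbar5 (10 * n)%N)%:Q = 1 / 2 * (c5 (10 * n + 2)%N)%:Q /\
  bbar5 (10 * n + 1)%N = c5 (5 * n + 1)%N /\
  (bbar5 (10 * n + 2)%N)%:Q =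
    1 / 4 * (abar5 (2 * n + 1)%N)%:Q + 1 / 2 * (c5 (2 * n)%N)%:Q /\
  bbar5 (10 * n + 3)%N = c5 (5 * n + 2)%N /\
  (bbar5 (10 * n + 4)%N)%:Q = 1 / 2 * (c5 (10 * n + 6)%N)%:Q /\
  bbar5 (10 * n + 6)%N = 0 /\
  bbar5 (10 * n + 8)%N = 0 /\
  bbar5 (20 * n + 5)%N = - c5 (5 * n + 1)%N /\
  (bbar5 (20 * n + 7)%N)%:Q =
    1 / 2 * (abar5 (2 * n + 1)%N)%:Q + (c5 (2 * n)%N)%:Q /\
  bbar5 (20 * n + 9)%N = - c5 (5 * n + 2)%N /\
  bbar5 (20 * n + 15)%N = 0 /\
  bbar5 (20 * n + 19)%N = 0.
Proof.
have half (b c : int) : 2 * b = c -> b%:Q = 1 / 2 * c%:Q.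
  by move=> <-; rewrite intrM; field.
have quarter (b a c : int) : 4 * b = a + 2 * c -> b%:Q = 1 / 4 * a%:Q + 1 / 2 * c%:Q.
  by move/(congr1 (fun z => z%:Q)); rewrite !intrD !intrM => h; lra.
have mixed (b a c : int) : 2 * b = a + 2 * c -> b%:Q = 1 / 2 * a%:Q + c%:Q.
  by move/(congr1 (fun z => z%:Q)); rewrite !intrD !intrM => h; lra.
split; first exact: bbar5_4n1.
split; first exact/half/bbar5_10n.
split; first exact: bbar5_10n1.
split; first exact/quarter/bbar5_10n2.
split; first exact: bbar5_10n3.
split; first exact/half/bbar5_10n4.
split; first exact: bbar5_10n6.
split; first exact: bbar5_10n8.
split; first exact: bbar5_20n5.
split; first exact/mixed/bbar5_20n7.
split; first exact: bbar5_20n9.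
split; [exact: bbar5_20n15 | exact: bbar5_20n19].
Qed.
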